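(* Let $f$ be a polynomial of degree $m\ge 2$ such that $\Omega=\Omega(f)$ is simply connected. Let $R:\mathbb{D}\to\Omega$ be a biholomorphic map with $R(0)=\infty$, normalized (by precomposing with a rotation) so that $R^{-1}\circ f\circ R(z)=z^{m}$ on $\mathbb{D}$, and let $F=R^{-1}:\Omega\to\mathbb{D}$. Fix $r_0\in(0,1)$ and $z_0\in\mathbb{C}$ with $|z_0|=r_0$; put $w_0=R(z_0)$. For $n\ge 1$ let $z_{n,k}$ $(0\le k<m^{n})$ be the $m^n$ solutions of $z^{m^n}=z_0$ in $\mathbb{D}$, and $w_{n,k}=R(z_{n,k})$ (these are the $m^n$ preimages of $w_0$ under $f^n$), and set $$S_{n}=\sum_{k=0}^{m^{n}-1}\left|(f^{n})'(w_{n,k})\right|^{2}.$$ Then there are constants $C_1,C_2<+\infty$, independent of $p$, such that for every $2\le p\le 4$, $$\int_{\Omega\cap\mathbb{C}}|F'(z)|^{p}\,dA(z)\;<\;C_{1}\sum_{n=1}^{+\infty}m^{-4n}S_{n}+C_{2}.$$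
   Context: $\Omega(f)=\{z\in\hat{\mathbb{C}}: f^{n}(z)\to\infty\}$ is the basin of attraction of infinity ($f^n$ the $n$-th iterate), $dA$ is Lebesgue area measure. The right-hand side may be $+\infty$.
   Formalization: The strict inequality is asserted when the series on the right converges; when it diverges nothing is claimed, since the literal inequality can fail: for f(z)=z²−2 and p=4 the integral is itself +∞. *)

(* Defs.v *)
From HB Require Import structures.
From mathcomp Require Import all_boot all_order all_algebra.
From mathcomp Require Import complex.
From mathcomp Require Import all_classical all_reals all_analysis.
Import Order.TTheory GRing.Theory Num.Theory numFieldNormedType.Exports.
Set Implicit Arguments. Unset Strict Implicit. Unset Printing Implicit Defensive.
Local Open Scope classical_set_scope.
Local Open Scope ring_scope.

(* The complex plane C = R[i]; as a numFieldType it is a normed module over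
   itself, so [derivable g z 1] / [derive1 g z] are complex derivatives. *)
Definition CC (R : realType) : numFieldType := (R[i] : numFieldType).

Definition cplx (R : realType) (xy : R * R) : CC R := Complex xy.1 xy.2.

Definition cmod (R : realType) (z : CC R) : R := ComplexField.Normc.normc z.

Definition disc (R : realType) : set (CC R) := [set z | cmod z < 1].
Definition pdisc (R : realType) : set (CC R) := [set z | 0 < cmod z < 1].

Definition iter_poly (R : realType) (f : {poly CC R}) (n : nat) : {poly CC R} :=
  iter n (fun q => f \Po q) 'X.

Definition basin (R : realType) (f : {poly CC R}) : set (CC R) :=
  [set z | (fun n => cmod (iter n (fun x => f.[x]) z)) @ \oo --> +oo].

Definition S_n (R : realType) (f : {poly CC R}) (Rmap : CC R -> CC R)
    (z0 : CC R) (n : nat) : R :=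
  let m := (size f).-1 in
  \sum_(z \in [set z : CC R | z ^+ (m ^ n) = z0 /\ disc z])
     cmod ((iter_poly f n)^`().[Rmap z]) ^+ 2.

Definition area (R : realType) := ((@lebesgue_measure R) \x (@lebesgue_measure R))%E.

(* Main.v *)
Require Import Defs.
From HB Require Import structures.
From mathcomp Require Import all_boot all_order all_algebra.
From mathcomp Require Import complex.
From mathcomp Require Import all_classical all_reals all_analysis.
From mathcomp Require Import ring lra.
Import Order.TTheory GRing.Theory Num.Theory numFieldNormedType.Exports.
Local Open Scope classical_set_scope.
Local Open Scope ring_scope.
Set Implicit Arguments. Unset Strict Implicit. Unset Printing Implicit Defensive.

(** A change of variables is not needed for an upper bound up to a constant: it suffices to cover
    [Omega] by squares on which [F'] has a known size.  Let [N = m ^ n].  The shell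
    [cmod z0 ^ m < cmod z ^ N <= cmod z0] lies within [O(1 / N)] of the [N] roots [u] of
    [z ^ N = z0], and at distance [>= c / N] from the boundary of the punctured disc.  An injective
    holomorphic [G] satisfies [|G''| <= L |G'| / dist]: otherwise, rescaling at a suitable point
    gives [G'' / G'] nearly equal to [1], so [G] is close to [exp - 1] up to affine maps and takes
    some value twice.  Hence the derivative [R'] of [Rmap] is comparable to [R' u] near [u], the
    shell is mapped into [N] squares of side [O(|R' u| / N)], and there
    [|F'| ^ p <= O(|R' u| ^ -2 + |R' u| ^ -4)].  So the shell contributes at most
    [N * O(N ^ -2) + O(N ^ -2) * sum_u |R' u| ^ -2].  Differentiating [f^n (R z) = R (z ^ N)] at
    [u] turns [N ^ -2 |R' u| ^ -2] into [O(N ^ -4 |(f^n)' (R u)| ^ 2)].  The part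
    [0 < cmod z <= b] is treated in the same way with geometric shells, using that [R'] is bounded
    below there. *)

(** * Modulus and continuity on the complex plane *)

(** All constants have to be uniform in [n], in the root [u] and in [p]. Uniformity in [p] comes
    from x^p <= x^2 + x^4 for p in [2, 4], so [p] disappears before any sum is formed. In the square
    attached to [u], the power 2 times the area is O(N^-2) whatever [R' u] is, because the side is
    proportional to |R' u|; only the power 4 sees the dynamics, and it alone produces [S_n].
    Uniformity in [u] comes from the scale invariance of |G''| <= L |G'| / dist: along a segment
    whose length is a bounded multiple of its distance to the boundary, it integrates to a bounded
    ratio of derivatives. The value of [L] is irrelevant, so a rescaling argument is enough. Two
    facts about [R'] rest on the functional equation and the pole: it has no zeros, and it is
    bounded below on every disc around 0 of radius less than 1, punctured at 0. The estimates on
    shells need [N] large, since a neighbourhood of size O(1 / N) of a root must stay away from 0;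
    the finitely many first levels are therefore left to the inner disc of radius [b]. *)

Section Modulus.
Variable R : realType.
Implicit Types (z w : CC R) (x y : R).

Definition rc (x : R) : CC R := real_complex R x.
Definition cre (z : CC R) : R := complex.Re z.
Definition cim (z : CC R) : R := complex.Im z.

Lemma normCCE z : `|z| = rc (cmod z). Proof. by []. Qed.

Lemma cmodM z w : cmod (z * w) = cmod z * cmod w.
Proof. exact: ComplexField.Normc.normcM. Qed.

Lemma ler_cmodD z w : cmod (z + w) <= cmod z + cmod w.
Proof. exact: le_normcD. Qed.

Lemma cmodN z : cmod (- z) = cmod z.
Proof. exact: normcN. Qed.

Lemma cmodB z w : cmod (z - w) = cmod (w - z).
Proof. by rewrite -cmodN opprB. Qed.

Lemma cmod0 : cmod (0 : CC R) = 0. Proof. exact: ComplexField.Normc.normc0. Qed.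
Lemma cmod1 : cmod (1 : CC R) = 1. Proof. exact: ComplexField.Normc.normc1. Qed.

Lemma cmodV z : cmod z^-1 = (cmod z)^-1.
Proof. exact: ComplexField.Normc.normcV. Qed.

Lemma cmodX z n : cmod (z ^+ n) = cmod z ^+ n.
Proof. by elim: n => [|n IH]; rewrite ?cmod1// !exprS cmodM IH. Qed.

Lemma cmodE z : cmod z = Num.sqrt (cre z ^+ 2 + cim z ^+ 2).
Proof. by case: z. Qed.

Lemma cmod_ge0 z : 0 <= cmod z. Proof. by rewrite cmodE sqrtr_ge0. Qed.

Lemma cmod_eq0 z : (cmod z == 0) = (z == 0).
Proof.
apply/eqP/eqP => [/ComplexField.Normc.eq0_normc //|->]; exact: cmod0.
Qed.

Lemma cmod_gt0 z : (0 < cmod z) = (z != 0).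
Proof. by rewrite lt_neqAle cmod_ge0 andbT eq_sym cmod_eq0. Qed.

Lemma sqr_cmod z : cmod z ^+ 2 = cre z ^+ 2 + cim z ^+ 2.
Proof. by rewrite cmodE sqr_sqrtr// addr_ge0 ?sqr_ge0. Qed.

Lemma cre_le z : `|cre z| <= cmod z.
Proof.
rewrite -(@ler_pXn2r _ 2) ?nnegrE ?cmod_ge0// sqr_cmod real_normK ?num_real//.
by rewrite lerDl sqr_ge0.
Qed.

Lemma cim_le z : `|cim z| <= cmod z.
Proof.
rewrite -(@ler_pXn2r _ 2) ?nnegrE ?cmod_ge0// sqr_cmod real_normK ?num_real//.
by rewrite lerDr sqr_ge0.
Qed.

Lemma cmod_le_sum z : cmod z <= `|cre z| + `|cim z|.
Proof.
rewrite -(@ler_pXn2r _ 2) ?nnegrE ?cmod_ge0 ?addr_ge0// sqr_cmod.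
rewrite sqrrD !real_normK ?num_real// lerD2r lerDl.
by rewrite mulrn_wge0// mulr_ge0.
Qed.

Lemma creD z w : cre (z + w) = cre z + cre w. Proof. by case: z; case: w. Qed.
Lemma cimD z w : cim (z + w) = cim z + cim w. Proof. by case: z; case: w. Qed.
Lemma creN z : cre (- z) = - cre z. Proof. by case: z. Qed.
Lemma cimN z : cim (- z) = - cim z. Proof. by case: z. Qed.
Lemma creM z w : cre (z * w) = cre z * cre w - cim z * cim w.
Proof. by case: z; case: w. Qed.
Lemma cimM z w : cim (z * w) = cre z * cim w + cim z * cre w.
Proof. by case: z => a b; case: w. Qed.
Lemma cre_rc x : cre (rc x) = x. Proof. by []. Qed.
Lemma cim_rc x : cim (rc x) = 0. Proof. by []. Qed.
Lemma cre_cplx u : cre (@cplx R u) = u.1. Proof. by []. Qed.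
Lemma cim_cplx u : cim (@cplx R u) = u.2. Proof. by []. Qed.

Lemma cc_eq z w : cre z = cre w -> cim z = cim w -> z = w.
Proof. by case: z => a b; case: w => c d /= ; rewrite /cre /cim /= => -> ->. Qed.

Lemma cplxE z : z = cplx (cre z, cim z). Proof. by case: z. Qed.

Lemma rcB x y : rc (x - y) = rc x - rc y. Proof. exact: rmorphB. Qed.
Lemma rcM x y : rc (x * y) = rc x * rc y. Proof. exact: rmorphM. Qed.
Lemma rc0 : rc 0 = 0. Proof. by []. Qed.
Lemma rc1 : rc 1 = 1. Proof. by []. Qed.
Lemma rc_nat n : rc n%:R = n%:R. Proof. exact: rmorph_nat. Qed.
Lemma rc_eq0 x : (rc x == 0) = (x == 0).
Proof. exact: fmorph_eq0. Qed.

Lemma ltrc x y : (rc x < rc y) = (x < y). Proof. exact: ltcR. Qed.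

Lemma cmod_rc x : cmod (rc x) = `|x|.
Proof. by rewrite cmodE cre_rc cim_rc expr0n addr0 sqrtr_sqr. Qed.

Lemma cmod_nat n : cmod (n%:R : CC R) = n%:R.
Proof. by rewrite -rc_nat cmod_rc normr_nat. Qed.

Lemma cmod_sub_ge z w : cmod z - cmod w <= cmod (z - w).
Proof. by rewrite lerBlDr; apply: le_trans (ler_cmodD _ _); rewrite subrK. Qed.

Lemma cmod_dist_le z w : `|cmod z - cmod w| <= cmod (z - w).
Proof.
rewrite ler_norml cmod_sub_ge andbT lerNl opprB cmodB; exact: cmod_sub_ge.
Qed.

Lemma cmod_triangle u z w : cmod (z - w) <= cmod (z - u) + cmod (u - w).
Proof. by apply: le_trans (ler_cmodD _ _); rewrite addrA subrK. Qed.

End Modulus.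

#[global] Arguments cmod : simpl never.

(* An inductive wrapper: [done] and [apply] would otherwise unfold the filters. *)
Variant contat (T U : topologicalType) (u : T -> U) (x : T) : Prop :=
  Contat of {for x, continuous u}.

Lemma contatW (T U : topologicalType) (u : T -> U) (x : T) :
  contat u x -> {for x, continuous u}.
Proof. by case. Qed.

Lemma contat_cst (T U : topologicalType) (c : U) (x : T) : contat (fun=> c) x.
Proof. by constructor; exact: cst_continuous. Qed.

Lemma contat_id (T : topologicalType) (x : T) : contat (fun y => y) x.
Proof. by constructor; exact: cvg_id. Qed.

Lemma contat_comp (S T U : topologicalType) (f : S -> T) (g : T -> U) (x : S) :
  contat f x -> contat g (f x) -> contat (fun y => g (f y)) x.
Proof. by move=> [cf] [cg]; constructor; exact: (continuous_comp cf cg). Qed.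

Section ContatField.
Variables (K : numFieldType) (T : topologicalType).
Implicit Types (f g : T -> K) (x : T).

Lemma contatD f g x : contat f x -> contat g x -> contat (fun y => f y + g y) x.
Proof. by move=> [cf] [cg]; constructor; exact: (continuousD cf cg). Qed.

Lemma contatN f x : contat f x -> contat (fun y => - f y) x.
Proof. by move=> [cf]; constructor; exact: (continuousN cf). Qed.

Lemma contatB f g x : contat f x -> contat g x -> contat (fun y => f y - g y) x.
Proof. by move=> cf /contatN; exact: contatD. Qed.

Lemma contatM f g x : contat f x -> contat g x -> contat (fun y => f y * g y) x.
Proof. by move=> [cf] [cg]; constructor; exact: (continuousM cf cg). Qed.

Lemma contatV f x : f x != 0 -> contat f x -> contat (fun y => (f y)^-1) x.
Proof. by move=> f0 [cf]; constructor; exact: (continuousV f0 cf). Qed.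

Lemma contatX f n x : contat f x -> contat (fun y => f y ^+ n) x.
Proof.
move=> cf; elim: n => [|n IH]; first exact: contat_cst.
by under eq_fun do rewrite exprS; exact: contatM.
Qed.

End ContatField.

Section Continuity.
Variable R : realType.

(** The norm of [CC R] takes values in [R[i]], so balls come with complex radii. Positivity forces
    such a radius to be real, and this is the bridge that lets all later estimates use [cmod] and
    real radii. *)
Lemma nbhsCCP (z : CC R) (A : set (CC R)) :
  nbhs z A <-> exists2 d : R, 0 < d & forall w, cmod (w - z) < d -> A w.
Proof.
rewrite -nbhs_ballE; split.
  move=> [e /= e0 eA]; have : 0 < cre e.
    by move: e0; case: (e) => a b; rewrite ltcE /= => /andP[].
  exists (cre e) => // w wz; apply: eA; rewrite /ball /= normCCE cmodB.
  move: e0 wz; case: (e) => a b; rewrite ltcE /= => /andP[/eqP -> _] h.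
  by rewrite ltcE /= eqxx.
move=> [d d0 dA]; exists (rc d) => /=; first by rewrite ltrc.
by move=> w; rewrite /ball /= normCCE ltrc cmodB; exact: dA.
Qed.

Lemma contatCCP (u : CC R -> CC R) (z : CC R) :
  contat u z <-> forall e : R, 0 < e ->
    exists2 d : R, 0 < d & forall w, cmod (w - z) < d -> cmod (u w - u z) < e.
Proof.
split=> [[cu] e e0|h].
  have /cu : nbhs (u z) [set w | cmod (w - u z) < e].
    by apply/nbhsCCP; exists e.
  by move=> /nbhsCCP.
constructor=> A /nbhsCCP[e e0 eA]; have [d d0 dh] := h _ e0.
by apply/nbhsCCP; exists d => // w /dh /eA.
Qed.

Lemma contatCRP (u : CC R -> R) (z : CC R) :
  contat u z <-> forall e : R, 0 < e ->
    exists2 d : R, 0 < d & forall w, cmod (w - z) < d -> `|u w - u z| < e.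
Proof.
split=> [[cu] e e0|h].
  have /cu : nbhs (u z) [set w | `|w - u z| < e].
    rewrite -nbhs_ballE; exists e => // w; rewrite /ball /= distrC; exact.
  by move=> /nbhsCCP.
constructor=> A; rewrite -nbhs_ballE => -[e /= e0 eA]; have [d d0 dh] := h _ e0.
by apply/nbhsCCP; exists d => // w /dh ?; apply: eA; rewrite /ball/= distrC.
Qed.

Section Composition.
Variables (T : topologicalType) (u : T -> CC R) (x : T).
Hypothesis cu : contat u x.

Lemma contat_cmod : contat (fun y => cmod (u y)) x.
Proof.
apply: (contat_comp cu (g := @cmod R)); apply/contatCRP => e e0; exists e => // w.
exact/le_lt_trans/cmod_dist_le.
Qed.

Lemma contat_cre : contat (fun y => cre (u y)) x.
Proof.
apply: (contat_comp cu (g := @cre R)); apply/contatCRP => e e0; exists e => // w.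
by rewrite -creN -creD; exact/le_lt_trans/cre_le.
Qed.

Lemma contat_cim : contat (fun y => cim (u y)) x.
Proof.
apply: (contat_comp cu (g := @cim R)); apply/contatCRP => e e0; exists e => // w.
by rewrite -cimN -cimD; exact/le_lt_trans/cim_le.
Qed.

End Composition.

Lemma contatCC (T : topologicalType) (u : T -> CC R) (x : T) :
  contat (fun y => cre (u y)) x -> contat (fun y => cim (u y)) x -> contat u x.
Proof.
move=> [cr] [ci]; constructor=> A /nbhsCCP[e e0 eA].
have e20 : 0 < e / 2 by rewrite divr_gt0.
have h1 : nbhs x [set y | `|cre (u y) - cre (u x)| < e / 2].
  apply: (cr [set w | `|w - cre (u x)| < e / 2]).
  by rewrite -nbhs_ballE; exists (e/2) => // w; rewrite /ball /= distrC.
have h2 : nbhs x [set y | `|cim (u y) - cim (u x)| < e / 2].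
  apply: (ci [set w | `|w - cim (u x)| < e / 2]).
  by rewrite -nbhs_ballE; exists (e/2) => // w; rewrite /ball /= distrC.
apply: filterS2 h1 h2 => y /= k1 k2; apply: eA.
apply: le_lt_trans (cmod_le_sum _) _; rewrite creD creN cimD cimN; lra.
Qed.

Lemma contat_cplx (x : R * R) : contat (@cplx R) x.
Proof. by apply: contatCC; constructor; [exact: cvg_fst|exact: cvg_snd]. Qed.

Lemma contat_rc (x : R) : contat (@rc R) x.
Proof. by apply: contatCC; [exact: contat_id|exact: contat_cst]. Qed.

(** The extremal arguments below (Newton step, point picking, lower bound on an annulus) are run on
    squares: a square is the image of a product of two segments, so its compactness is immediate. *)
Lemma square_EVT_max (A : set (CC R)) (x0 x1 y0 y1 : R) (u : CC R -> R) :
  (exists z, A z) ->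
  A = [set z | x0 <= cre z <= x1 /\ y0 <= cim z <= y1] ->
  (forall z, A z -> contat u z) ->
  exists2 c, A c & forall z, A z -> u z <= u c.
Proof.
move=> A0 defA cu.
set B := @cplx R @` (`[x0, x1]%classic `*` `[y0, y1]%classic).
have cB : compact B.
  apply: continuous_compact.
    by apply: continuous_subspaceT => x; exact/contatW/contat_cplx.
  apply: compact_setX; exact: segment_compact.
have AB : A = B.
  rewrite defA; apply/seteqP; split=> z /=.
    move=> [h1 h2]; exists (cre z, cim z); rewrite -?cplxE//=.
  by move=> [[a b]] /= [h1 h2] <-.
have [||c] := @compact_EVT_max _ R u B _ cB.
- by case: A0 => z Az; exists z; rewrite -AB.
- apply: continuous_in_subspaceT => z /set_mem; rewrite -AB => Az; exact/contatW/cu.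
move=> /set_mem Bc cm; exists c => [|z]; rewrite AB // => Bz; apply: cm; exact/mem_set.
Qed.

End Continuity.

(** * Complex derivatives *)

Section ComplexDerivative.
Variable R : realType.
Implicit Types (f g : CC R -> CC R) (z w l : CC R).

(** Carathéodory's form of differentiability. Product and chain rules become ring identities, and
    the slope function [phi] later serves directly as the quotient from which a singularity is
    removed. *)
Definition cderiv g z l := exists phi : CC R -> CC R,
  [/\ contat phi z, phi z = l & forall w, g w = g z + phi w * (w - z)].

Lemma cderivP g z l : cderiv g z l <-> forall e : R, 0 < e ->
  exists2 d : R, 0 < d & forall w, cmod (w - z) < d ->
    cmod (g w - g z - l * (w - z)) <= e * cmod (w - z).
Proof.
split=> [[phi [/contatCCP cphi <- gphi]] e e0|h].
  have [d d0 hd] := cphi _ e0; exists d => // w /hd wz.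
  have -> : g w - g z - phi z * (w - z) = (phi w - phi z) * (w - z).
    by rewrite gphi; ring.
  rewrite cmodM ler_wpM2r ?cmod_ge0//.
  exact: ltW.
exists (fun w => if w == z then l else (g w - g z) / (w - z)); split.
- apply/contatCCP => e e0.
  have [d d0 hd] := h _ (divr_gt0 e0 (ltr0Sn R 1)).
  exists d => // w wz; rewrite eqxx; case: eqVneq => [_|nwz].
    by rewrite subrr cmod0.
  have := hd _ wz.
  have -> : g w - g z - l * (w - z) = ((g w - g z) / (w - z) - l) * (w - z).
    by rewrite mulrBl divfK// subr_eq0.
  rewrite cmodM ler_pM2r ?cmod_gt0 ?subr_eq0// => /le_lt_trans; apply.
  by rewrite ltr_pdivrMr// mulr_natr mulr2n ltrDl.
- by rewrite eqxx.
- move=> w; case: eqVneq => [->|nwz]; first by rewrite subrr mulr0 addr0.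
  by rewrite divfK ?subr_eq0// subrKC.
Qed.

Lemma dnbhsCCP (u : CC R -> CC R) l :
  u h @[h --> (0 : CC R)^'] --> l <-> forall e : R, 0 < e ->
    exists2 d : R, 0 < d & forall h, h != 0 -> cmod h < d -> cmod (u h - l) < e.
Proof.
split=> [cu e e0|h].
  have /cu : nbhs l [set w | cmod (w - l) < e] by apply/nbhsCCP; exists e.
  rewrite /= /nbhs /= /dnbhs /within /= => /nbhsCCP[d d0 hd].
  by exists d => // k k0 kd; apply: hd => //; rewrite subr0.
move=> A /nbhsCCP[e e0 eA]; have [d d0 dh] := h _ e0.
rewrite /= /nbhs /= /dnbhs /within /=; apply/nbhsCCP; exists d => // w.
by rewrite subr0 => wd w0; apply: eA; exact: dh.
Qed.

Lemma cderiv_cvg g z l : cderiv g z l <->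
  h^-1 *: (g (h + z) - g z) @[h --> (0 : CC R)^'] --> l.
Proof.
split=> [[phi [/contatCCP cphi <- gphi]]|/dnbhsCCP h].
  apply/dnbhsCCP => e e0; have [d d0 hd] := cphi _ e0; exists d => // h h0 hd'.
  have -> : h^-1 *: (g (h + z) - g z) = phi (h + z).
    by rewrite gphi /GRing.scale /=; field.
  by apply: hd; rewrite addrK.
apply/cderivP => e e0; have [d d0 hd] := h _ e0; exists d => // w wz.
have [->|nwz] := eqVneq w z; first by rewrite !subrr mulr0 subrr cmod0 mulr0.
have nwz' : w - z != 0 by rewrite subr_eq0.
have := hd _ nwz' wz; rewrite subrK /GRing.scale /= => /ltW.
have -> : g w - g z - l * (w - z) = ((w - z)^-1 * (g w - g z) - l) * (w - z).
  by field.
by move=> k; rewrite cmodM ler_wpM2r ?cmod_ge0.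
Qed.

Lemma derivable_cderiv g z : derivable g z 1 -> cderiv g z (derive1 g z).
Proof.
rewrite /derivable => k; apply/cderiv_cvg; rewrite /derive1.
have E : (fun h : CC R => h^-1 *: ((g \o shift z) (h *: 1) - g z)) =
  (fun h : CC R => h^-1 *: (g (h + z) - g z)).
  by apply/funext => h; rewrite /= /GRing.scale /= mulr1.
by move: k; rewrite E.
Qed.

Lemma cderiv_derive1 g z l : cderiv g z l -> derive1 g z = l.
Proof. by move=> /cderiv_cvg /cvg_lim; apply; exact: norm_hausdorff. Qed.

Lemma cderiv_unique g z l l' : cderiv g z l -> cderiv g z l' -> l = l'.
Proof. by move=> /cderiv_derive1 <- /cderiv_derive1 <-. Qed.

Lemma cderiv_contat g z l : cderiv g z l -> contat g z.
Proof.
move=> [phi [cphi _ gphi]].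
have -> : g = (fun w => g z + phi w * (w - z)) by apply/funext.
apply: contatD; first exact: contat_cst.
by apply: contatM => //; apply: contatB; [exact: contat_id|exact: contat_cst].
Qed.

Lemma cderiv_near f g z l (d : R) : 0 < d ->
  (forall w, cmod (w - z) < d -> f w = g w) -> cderiv f z l -> cderiv g z l.
Proof.
move=> d0 fg /cderivP h; apply/cderivP => e e0; have [d' d'0 hd'] := h _ e0.
exists (Num.min d d'); first by rewrite lt_min d0.
move=> w; rewrite lt_min => /andP[wd wd']; rewrite -!fg// ?subrr ?cmod0//.
exact: hd'.
Qed.

Lemma cderiv_cst c z : cderiv (fun=> c) z 0.
Proof. by exists (cst 0); split => //; [exact: contat_cst|move=> w; rewrite mul0r addr0]. Qed.

Lemma cderiv_id z : cderiv id z 1.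
Proof. by exists (cst 1); split => //; [exact: contat_cst|move=> w; rewrite mul1r subrKC]. Qed.

Lemma cderivD f g z l m : cderiv f z l -> cderiv g z m ->
  cderiv (fun w => f w + g w) z (l + m).
Proof.
move=> [p [cp <- fp]] [q [cq <- gq]]; exists (p \+ q); split => //.
  exact: contatD.
by move=> w; rewrite [in LHS]fp [in LHS]gq /= mulrDl addrACA.
Qed.

Lemma cderivM f g z l m : cderiv f z l -> cderiv g z m ->
  cderiv (fun w => f w * g w) z (l * g z + f z * m).
Proof.
move=> cf cg; have cg' := cderiv_contat cg.
case: cf cg => [p [cp <- fp]] [q [cq <- gq]].
exists (fun w => p w * g w + f z * q w); split => //.
  by apply: contatD; apply: contatM => //; exact: contat_cst.
by move=> w; have Eg := gq w; have Ef := fp w; ring: Ef Eg.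
Qed.

Lemma cderivZ c f z l : cderiv f z l -> cderiv (fun w => c * f w) z (c * l).
Proof.
by move=> /(cderivM (cderiv_cst c z)); rewrite mul0r add0r.
Qed.

Lemma cderivN f z l : cderiv f z l -> cderiv (fun w => - f w) z (- l).
Proof.
move=> /(cderivZ (-1)); rewrite mulN1r.
by under eq_fun do rewrite mulN1r.
Qed.

Lemma cderivB f g z l m : cderiv f z l -> cderiv g z m ->
  cderiv (fun w => f w - g w) z (l - m).
Proof. by move=> cf /cderivN; exact: cderivD. Qed.

Lemma cderiv_comp f g z l m : cderiv f z l -> cderiv g (f z) m ->
  cderiv (fun w => g (f w)) z (m * l).
Proof.
move=> cf cg; have cf' := cderiv_contat cf.
case: cf cg => [p [cp <- fp]] [q [cq <- gq]].
exists (fun w => q (f w) * p w); split => //.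
  by apply: contatM => //; exact: contat_comp.
by move=> w; rewrite [in LHS]gq; have Ef := fp w; ring: Ef.
Qed.

Lemma cderivV f z l : f z != 0 -> cderiv f z l ->
  cderiv (fun w => (f w)^-1) z (- l / f z ^+ 2).
Proof.
move=> fz0 cf; have cf' := cderiv_contat cf.
suff : cderiv (fun w => w^-1) (f z) (- (f z ^+ 2)^-1).
  by move=> /(cderiv_comp cf); rewrite mulNr mulrC mulNr.
apply/cderivP => e e0; pose a := cmod (f z).
have a0 : 0 < a by rewrite cmod_gt0.
(* The first bound gives |w| >= a / 2, so the remainder |w - f z|^2 / (|w| a^2) is at most |w - f
   z|^2 * 2 / a^3; the second bound makes this at most e |w - f z|. *)
exists (Num.min (a / 2) (e * (a ^+ 3 / 2))).
  by rewrite lt_min divr_gt0//= mulr_gt0// divr_gt0// exprn_gt0.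
move=> w; rewrite lt_min => /andP[w1 w2].
have wa : a / 2 <= cmod w.
  have := cmod_sub_ge (f z) (f z - w); rewrite subKr cmodB -/a; lra.
have w0 : w != 0.
  by rewrite -cmod_gt0; apply: lt_le_trans wa; rewrite divr_gt0.
have -> : w^-1 - (f z)^-1 - - (f z ^+ 2)^-1 * (w - f z)
   = (w - f z) * (w - f z) * (w^-1 * (f z ^+ 2)^-1).
  by field; rewrite w0 fz0.
rewrite !cmodM !cmodV cmodX -/a [e * _]mulrC -mulrA ler_wpM2l ?cmod_ge0//.
rewrite -invfM ler_pdivrMr ?mulr_gt0 ?exprn_gt0 ?cmod_gt0//.
apply: (le_trans (ltW w2)); rewrite ler_pM2l// exprS mulrAC.
by rewrite ler_wpM2r ?sqr_ge0.
Qed.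

Lemma cderivX z n : cderiv (fun w => w ^+ n) z (n%:R * z ^+ n.-1).
Proof.
elim: n => [|n IH]; first by rewrite mul0r; exact: cderiv_cst.
have := cderivM (cderiv_id z) IH.
under eq_fun do rewrite -exprS.
congr cderiv; case: n {IH} => [|n] /=; first by rewrite !mul0r mulr0 addr0.
by rewrite exprS -[in RHS]natr1; ring.
Qed.

Lemma cderiv_horner (p : {poly CC R}) z : cderiv (fun w => p.[w]) z p^`().[z].
Proof.
elim/poly_ind: p => [|p c IH].
  rewrite deriv0 horner0; under eq_fun do rewrite horner0; exact: cderiv_cst.
under eq_fun do rewrite hornerMXaddC.
have := cderivD (cderivM IH (cderiv_id z)) (cderiv_cst c z).
by congr cderiv; rewrite derivD derivC derivM derivX !hornerE.
Qed.

Lemma cderiv_div f g z l m : g z != 0 -> cderiv f z l -> cderiv g z m ->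
  cderiv (fun w => f w / g w) z ((l * g z - f z * m) / g z ^+ 2).
Proof.
move=> g0 cf cg; have := cderivM cf (cderivV g0 cg).
by congr cderiv; field.
Qed.

End ComplexDerivative.

(** * Mean value and Gronwall estimates along segments *)

Section Segments.
Variable R : realType.
Implicit Types (g : CC R -> CC R) (a b l : CC R) (t : R).

Lemma is_derive_line (L : CC R -> R) g a b l t :
  (forall z w, L (z - w) = L z - L w) -> (forall s z, L (rc s * z) = s * L z) ->
  (forall u : R -> CC R, forall s, contat u s -> contat (fun r => L (u r)) s) ->
  cderiv g (a + rc t * b) l ->
  is_derive t 1 (fun s => L (g (a + rc s * b))) (L (l * b)).
Proof.
move=> LB LZ Lc [p [cp <- gp]]; apply/is_derive1_caratheodory.
exists (fun s => L (p (a + rc s * b) * b)); split => //.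
- move=> s; rewrite -LB [g (a + rc s * b)]gp [g _ + _ - _]addrC addKr.
  by rewrite [RHS]mulrC -LZ rcB; congr (L _); ring.
- apply/contatW/Lc/contatM; last exact: contat_cst.
  apply: (contat_comp (f := fun r : R => a + rc r * b)) => //.
  apply: contatD; first exact: contat_cst.
  by apply: contatM; [exact: contat_rc|exact: contat_cst].
Qed.

Lemma is_derive_line_cre g a b l t : cderiv g (a + rc t * b) l ->
  is_derive t 1 (fun s => cre (g (a + rc s * b))) (cre (l * b)).
Proof.
apply: is_derive_line; first by move=> z w; rewrite creD creN.
  by move=> s z; rewrite creM cre_rc cim_rc mul0r subr0.
by move=> u s; exact: contat_cre.
Qed.

Lemma is_derive_line_cim g a b l t : cderiv g (a + rc t * b) l ->
  is_derive t 1 (fun s => cim (g (a + rc s * b))) (cim (l * b)).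
Proof.
apply: is_derive_line; first by move=> z w; rewrite cimD cimN.
  by move=> s z; rewrite cimM cre_rc cim_rc mul0r addr0.
by move=> u s; exact: contat_cim.
Qed.

(* Projecting on the direction of [g b - g a] reduces to the real mean value theorem. *)
Lemma cderiv_mean_value g g' a b (M : R) :
  (forall t, 0 <= t <= 1 -> cderiv g (a + rc t * (b - a)) (g' (a + rc t * (b - a)))) ->
  (forall t, 0 <= t <= 1 -> cmod (g' (a + rc t * (b - a))) <= M) ->
  cmod (g b - g a) <= M * cmod (b - a).
Proof.
move=> dg gM; pose v := g b - g a.
have [v0|v0] := eqVneq v 0.
  rewrite -/v v0 cmod0 mulr_ge0 ?cmod_ge0//.
  by apply: le_trans (gM 0 _); rewrite ?cmod_ge0 ?lexx ?ler01.
pose u : CC R := cplx (cre v, - cim v).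
have uv : cre (u * v) = cmod v ^+ 2 by rewrite creM sqr_cmod /=; ring.
have cu : cmod u = cmod v by rewrite !cmodE /= sqrrN.
have dug t : 0 <= t <= 1 ->
    is_derive t 1 (fun s => cre (u * g (a + rc s * (b - a))))
      (cre (u * g' (a + rc t * (b - a)) * (b - a))).
  by move=> t01; apply: (@is_derive_line_cre (fun w => u * g w)); apply: cderivZ; exact: dg.
have [||t t01 /=] := @MVT_segment R
   (fun s => cre (u * g (a + rc s * (b - a))))
   (fun t => cre (u * g' (a + rc t * (b - a)) * (b - a))) 0 1 ler01.
- by move=> t; rewrite in_itv /= => /andP[t0 t1]; apply: dug; rewrite !ltW.
- apply: continuous_in_subspaceT => t; rewrite inE /= in_itv /= => t01.
  have [dd _] := dug _ t01; apply: differentiable_continuous.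
  exact/derivable1_diffP.
rewrite rc0 rc1 mul0r addr0 mul1r subrKC subr0 mulr1 -creN -creD -mulrBr uv => e.
rewrite -(@ler_pM2l _ (cmod v)) ?cmod_gt0// -expr2 e.
apply: (le_trans (ler_norm _)); apply: (le_trans (cre_le _)).
rewrite !cmodM cu -mulrA ler_wpM2l ?cmod_ge0// ler_wpM2r ?cmod_ge0//.
by apply: gM; move: t01; rewrite in_itv.
Qed.

(** Along the segment, |g|^2 exp (- 2 L t) with L = K |b - a| has nonpositive derivative. The square
    of the modulus is used because it stays differentiable at zeros of [g]. *)
Lemma cderiv_gronwall g g' a b (K : R) :
  (forall t, 0 <= t <= 1 -> cderiv g (a + rc t * (b - a)) (g' (a + rc t * (b - a)))) ->
  (forall t, 0 <= t <= 1 ->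
     cmod (g' (a + rc t * (b - a))) <= K * cmod (g (a + rc t * (b - a)))) ->
  cmod (g b) <= expR (K * cmod (b - a)) * cmod (g a).
Proof.
move=> dg gK; pose L := K * cmod (b - a).
pose z t := a + rc t * (b - a).
pose x t := cre (g (z t)); pose y t := cim (g (z t)).
pose x' t := cre (g' (z t) * (b - a)); pose y' t := cim (g' (z t) * (b - a)).
pose F t := (x t ^+ 2 + y t ^+ 2) * expR (- (L *+ 2) * t).
pose F' t := (x t * x' t *+ 2 + y t * y' t *+ 2 - L *+ 2 * (x t ^+ 2 + y t ^+ 2)) *
  expR (- (L *+ 2) * t).
have dF t : 0 <= t <= 1 -> is_derive t 1 F (F' t).
  move=> t01; have dx := is_derive_line_cre (dg t t01).
  have dy := is_derive_line_cim (dg t t01).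
  rewrite /F; apply: is_derive_eq.
  rewrite /F' /x /y /x' /y' /z /GRing.scale /=; ring.
have F'0 t : 0 <= t <= 1 -> F' t <= 0.
  move=> t01; rewrite /F' mulr_le0_ge0 ?expR_ge0//.
  have -> : x t * x' t *+ 2 + y t * y' t *+ 2 =
     cre (cplx (x t, - y t) * (g' (z t) * (b - a))) *+ 2.
    by rewrite creM /= -/(x' t) -/(y' t); ring.
  rewrite -sqr_cmod mulrnAl subr_le0 lerMn2r /=.
  apply: (le_trans (ler_norm _)); apply: (le_trans (cre_le _)).
  rewrite !cmodM; have -> : cmod (cplx (x t, - y t)) = cmod (g (z t)).
    by rewrite !cmodE /= sqrrN.
  rewrite /L expr2 mulrACA mulrC; apply: (@le_trans _ _ (cmod (g' (z t)) * (cmod (b - a) * cmod (g (z t))))).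
    by rewrite mulrA.
  rewrite [cmod (b - a) * cmod (g _)]mulrC.
  rewrite !mulrA ler_wpM2r ?cmod_ge0// ler_wpM2r ?cmod_ge0//; exact: gK.
have [||t] := @MVT_segment R F F' 0 1 ler01.
- by move=> t; rewrite in_itv /= => /andP[t0 t1]; apply: dF; rewrite !ltW.
- apply: continuous_in_subspaceT => t; rewrite inE /= in_itv /= => t01.
  have [dd _] := dF _ t01; apply: differentiable_continuous.
  exact/derivable1_diffP.
rewrite in_itv /= subr0 mulr1 => t01 e.
have : F 1 <= F 0 by rewrite -subr_le0 e; exact: F'0.
rewrite /F /x /y /z rc0 rc1 mul0r addr0 mul1r subrKC -!sqr_cmod mulr0 expR0 !mulr1.
rewrite expRN ler_pdivrMr ?expR_gt0// => h.
rewrite -(@ler_pXn2r _ 2) ?nnegrE ?mulr_ge0 ?expR_ge0 ?cmod_ge0//.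
by rewrite exprMn -expRM_natl -/L mulr_natl mulrC.
Qed.

End Segments.

(** * Goursat's theorem for squares *)

Section RealIntegral.
Variable R : realType.
Implicit Types (a b c : R) (u v : R -> R).
Local Notation mu := (@lebesgue_measure R).

Definition rint a b u : R := (\int[mu]_(x in `[a, b]) u x)%R.

Lemma contat_integrable a b u : (forall x, contat u x) ->
  mu.-integrable `[a, b] (EFin \o u).
Proof.
move=> cu; apply: continuous_compact_integrable; first exact: segment_compact.
by apply: continuous_subspaceT => x; exact/contatW/cu.
Qed.

Lemma rintD a b u v : (forall x, contat u x) -> (forall x, contat v x) ->
  rint a b (fun x => u x + v x) = rint a b u + rint a b v.
Proof. by move=> cu cv; rewrite /rint RintegralD//; exact: contat_integrable. Qed.

Lemma rintZ a b c u : (forall x, contat u x) ->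
  rint a b (fun x => c * u x) = c * rint a b u.
Proof. by move=> cu; rewrite /rint RintegralZl//; exact: contat_integrable. Qed.

Lemma rint_cst a b c : a <= b -> rint a b (fun=> c) = c * (b - a).
Proof.
move=> ab; rewrite /rint Rintegral_cst//= lebesgue_measure_itv /= lte_fin.
case: ltP => // ba; have -> : b = a by apply/eqP; rewrite eq_le ab ba.
by rewrite subrr /=.
Qed.

Lemma rint_cat a b c u : a <= b -> b <= c -> (forall x, contat u x) ->
  rint a c u = rint a b u + rint b c u.
Proof.
move=> ab bc cu; rewrite /rint.
have := @Rintegral_itvB R u (BLeft a) (BRight c) b (contat_integrable a c cu).
rewrite bnd_simp ab bnd_simp bc => /(_ isT isT) E.
have -> : (\int[mu]_(x in `[b, c]) u x)%R = (\int[mu]_(x in `]b, c]) u x)%R.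
  apply/esym/Rintegral_itv_obnd_cbnd.
  apply: (@integrableS _ _ _ mu `[b, c]) => //; last first.
    exact: contat_integrable.
  by move=> x /=; rewrite !in_itv /= => /andP[/ltW -> ->].
by rewrite -E addrC subrK.
Qed.

Lemma rint_ext a b u v : (forall x, a <= x <= b -> u x = v x) -> rint a b u = rint a b v.
Proof.
by move=> uv; apply: eq_Rintegral => x /set_mem /=; rewrite in_itv; exact: uv.
Qed.

Lemma ler_rint a b u v : (forall x, contat u x) -> (forall x, contat v x) ->
  (forall x, a <= x <= b -> u x <= v x) -> rint a b u <= rint a b v.
Proof.
move=> cu cv uv; apply: le_Rintegral => //; try exact: contat_integrable.
Qed.

Lemma rint_bound a b u (M : R) : a <= b -> (forall x, contat u x) ->
  (forall x, a <= x <= b -> `|u x| <= M) -> `|rint a b u| <= M * (b - a).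
Proof.
move=> ab cu uM; rewrite ler_norml -mulNr -!rint_cst//.
apply/andP; split; apply: ler_rint => //; try by move=> x; exact: contat_cst.
- by move=> x /uM; rewrite ler_norml => /andP[].
- by move=> x /uM; rewrite ler_norml => /andP[].
Qed.

End RealIntegral.

Section ComplexIntegral.
Variable R : realType.
Implicit Types (a b : R) (c : CC R) (u v : R -> CC R).

Definition cint a b u : CC R :=
  cplx (rint a b (fun x => cre (u x)), rint a b (fun x => cim (u x))).

Lemma cintD a b u v : (forall x, contat u x) -> (forall x, contat v x) ->
  cint a b (fun x => u x + v x) = cint a b u + cint a b v.
Proof.
move=> cu cv; apply: cc_eq; rewrite ?creD ?cimD /=.
  rewrite -rintD; [|by move=> x; exact: contat_cre ..].
  by apply: rint_ext => x _; rewrite creD.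
rewrite -rintD; [|by move=> x; exact: contat_cim ..].
by apply: rint_ext => x _; rewrite cimD.
Qed.

Lemma cintZ a b c u : (forall x, contat u x) ->
  cint a b (fun x => c * u x) = c * cint a b u.
Proof.
move=> cu.
have cr x : contat (fun y => cre (u y)) x by exact: contat_cre.
have ci x : contat (fun y => cim (u y)) x by exact: contat_cim.
have rZ (k : R) w : (forall x, contat w x) -> forall x, contat (fun y => k * w y) x.
  by move=> cw x; apply: contatM => //; exact: contat_cst.
apply: cc_eq; rewrite ?creM ?cimM /=.
  rewrite -mulNr -!rintZ// -rintD; try exact: rZ.
  by apply: rint_ext => x _; rewrite creM mulNr.
rewrite -!rintZ// -rintD; try exact: rZ.
by apply: rint_ext => x _; rewrite cimM.
Qed.

Lemma cintB a b u v : (forall x, contat u x) -> (forall x, contat v x) ->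
  cint a b (fun x => u x - v x) = cint a b u - cint a b v.
Proof.
move=> cu cv; rewrite -mulN1r -cintZ// -cintD//.
  by congr cint; apply/funext => x; rewrite mulN1r.
by move=> x; apply: contatM => //; exact: contat_cst.
Qed.

Lemma cint_cst a b c : a <= b -> cint a b (fun=> c) = c * rc (b - a).
Proof.
by move=> ab; apply: cc_eq; rewrite ?creM ?cimM /= rint_cst// mulr0 ?subr0 ?add0r.
Qed.

Lemma cint_cat a b d u : a <= b -> b <= d -> (forall x, contat u x) ->
  cint a d u = cint a b u + cint b d u.
Proof.
move=> ab bd cu; apply: cc_eq; rewrite ?creD ?cimD /=; apply: rint_cat => // x.
  exact: contat_cre.
exact: contat_cim.
Qed.

Lemma cint_ext a b u v : (forall x, a <= x <= b -> u x = v x) -> cint a b u = cint a b v.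
Proof.
by move=> uv; apply: cc_eq => /=; apply: rint_ext => x xab; rewrite uv.
Qed.

(** The factor 2 comes from bounding real and imaginary parts separately; sharp constants are of no
    use later. *)
Lemma cint_bound a b u (M : R) : a <= b -> (forall x, contat u x) ->
  (forall x, a <= x <= b -> cmod (u x) <= M) -> cmod (cint a b u) <= 2 * M * (b - a).
Proof.
move=> ab cu uM; apply: (le_trans (cmod_le_sum _)) => /=.
rewrite mulrAC mulrDl mulrDl !mul1r ![_ * M]mulrC; apply: lerD; apply: rint_bound => // x.
- exact: contat_cre.
- by move=> /uM; exact/le_trans/cre_le.
- exact: contat_cim.
- by move=> /uM; exact/le_trans/cim_le.
Qed.

End ComplexIntegral.

Section Goursat.
Variable R : realType.
Implicit Types (x y a b : R) (f g : CC R -> CC R).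

Definition pt x y : CC R := cplx (x, y).

Lemma contat_ptx y x : contat (fun s => pt s y) x.
Proof. by apply: contatCC => /=; [exact: contat_id|exact: contat_cst]. Qed.

Lemma contat_pty x y : contat (fun s => pt x s) y.
Proof. by apply: contatCC => /=; [exact: contat_cst|exact: contat_id]. Qed.

(** The counterclockwise contour integral over the boundary of the rectangle; [pt 0 1] is i, from dz
    = i dy on the vertical sides. *)
Definition rectint f x0 x1 y0 y1 : CC R :=
  cint x0 x1 (fun x => f (pt x y0)) - cint x0 x1 (fun x => f (pt x y1)) +
  pt 0 1 * (cint y0 y1 (fun y => f (pt x1 y)) - cint y0 y1 (fun y => f (pt x0 y))).

Section Continuous.
Variable f : CC R -> CC R.
Hypothesis cf : forall z, contat f z.

Lemma contat_lineh y x : contat (fun s => f (pt s y)) x.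
Proof. by apply: contat_comp => //; exact: contat_ptx. Qed.

Lemma contat_linev x y : contat (fun s => f (pt x s)) y.
Proof. by apply: contat_comp => //; exact: contat_pty. Qed.

Lemma rectint_catx x0 x1 x2 y0 y1 : x0 <= x1 -> x1 <= x2 ->
  rectint f x0 x2 y0 y1 = rectint f x0 x1 y0 y1 + rectint f x1 x2 y0 y1.
Proof.
move=> h0 h1; rewrite /rectint !(cint_cat h0 h1); [ring| |]; by move=> x; exact: contat_lineh.
Qed.

Lemma rectint_caty x0 x1 y0 y1 y2 : y0 <= y1 -> y1 <= y2 ->
  rectint f x0 x1 y0 y2 = rectint f x0 x1 y0 y1 + rectint f x0 x1 y1 y2.
Proof.
move=> h0 h1; rewrite /rectint !(cint_cat h0 h1); [ring| |]; by move=> x; exact: contat_linev.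
Qed.

Lemma rectint_bound x0 x1 y0 y1 M : x0 <= x1 -> y0 <= y1 ->
  (forall z, x0 <= cre z <= x1 -> y0 <= cim z <= y1 -> cmod (f z) <= M) ->
  cmod (rectint f x0 x1 y0 y1) <= 4 * M * ((x1 - x0) + (y1 - y0)).
Proof.
move=> hx hy fM.
have b1 y : y0 <= y <= y1 -> cmod (cint x0 x1 (fun x => f (pt x y))) <= 2 * M * (x1 - x0).
  by move=> hy'; apply: cint_bound => // x; [exact: contat_lineh|move=> hx'; exact: fM].
have b2 x : x0 <= x <= x1 -> cmod (cint y0 y1 (fun y => f (pt x y))) <= 2 * M * (y1 - y0).
  by move=> hx'; apply: cint_bound => // y; [exact: contat_linev|move=> hy'; exact: fM].
apply: (le_trans (ler_cmodD _ _)).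
have -> : 4 * M * (x1 - x0 + (y1 - y0)) =
  (2 * M * (x1 - x0) + 2 * M * (x1 - x0)) + (2 * M * (y1 - y0) + 2 * M * (y1 - y0)) by ring.
apply: lerD.
  by apply: (le_trans (ler_cmodD _ _)); rewrite cmodN; apply: lerD; apply: b1; rewrite lexx ?hy.
rewrite cmodM [cmod (pt 0 1)]cmodE /= expr0n add0r expr1n sqrtr1 mul1r.
by apply: (le_trans (ler_cmodD _ _)); rewrite cmodN; apply: lerD; apply: b2; rewrite lexx ?hx.
Qed.

End Continuous.

Lemma rectintB f g x0 x1 y0 y1 : (forall z, contat f z) -> (forall z, contat g z) ->
  rectint (fun z => f z - g z) x0 x1 y0 y1 = rectint f x0 x1 y0 y1 - rectint g x0 x1 y0 y1.
Proof.
move=> cf cg; rewrite /rectint !cintB; try (by move=> x; exact: contat_lineh);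
  try (by move=> x; exact: contat_linev).
ring.
Qed.

(** The horizontal sides contribute [- l] times i times the area and the vertical ones the opposite;
    everything else cancels between opposite sides. *)
Lemma rectint_affine c l x0 x1 y0 y1 : x0 <= x1 -> y0 <= y1 ->
  rectint (fun z => c + l * z) x0 x1 y0 y1 = 0.
Proof.
move=> hx hy.
have E1 y : cint x0 x1 (fun x => c + l * pt x y) =
    (c + l * (pt 0 1 * rc y)) * rc (x1 - x0) + l * cint x0 x1 (@rc R).
  rewrite -cint_cst// -cintZ; last by move=> x; exact: contat_rc.
  rewrite -cintD => [|x|x]; [|exact: contat_cst|]; last first.
    by apply: contatM; [exact: contat_cst|exact: contat_rc].
  apply: cint_ext => x _; rewrite -addrA -mulrDr; congr (_ + l * _).
  by apply: cc_eq; rewrite /= ?creD ?cimD ?creM ?cimM /= ?cre_rc ?cim_rc; ring.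
have E2 x : cint y0 y1 (fun y => c + l * pt x y) =
    (c + l * rc x) * rc (y1 - y0) + l * (pt 0 1 * cint y0 y1 (@rc R)).
  rewrite -cint_cst// -cintZ; last by move=> y; exact: contat_rc.
  have cI y : contat (fun z => pt 0 1 * rc z) y.
    by apply: contatM; [exact: contat_cst|exact: contat_rc].
  rewrite -cintZ// -cintD => [|y|y]; [|exact: contat_cst|]; last first.
    by apply: contatM => //; exact: contat_cst.
  apply: cint_ext => y _; rewrite -addrA -mulrDr; congr (_ + l * _).
  by apply: cc_eq; rewrite /= ?creD ?cimD ?creM ?cimM /= ?cre_rc ?cim_rc; ring.
rewrite /rectint !E1 !E2 !rcB; ring.
Qed.

(** The threshold is quadratic in the side lengths, so halving them divides it by exactly 4, the
    number of quarters: if all four quarters were below their thresholds, the whole rectangle would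
    be too. *)
Lemma rectint_quarter f x y a b e : 0 <= a -> 0 <= b -> (forall z, contat f z) ->
  e * (a + b) ^+ 2 < cmod (rectint f x (x + a) y (y + b)) ->
  exists p : R * R, [/\ x <= p.1, p.1 + a / 2 <= x + a, y <= p.2, p.2 + b / 2 <= y + b &
    e * (a / 2 + b / 2) ^+ 2 < cmod (rectint f p.1 (p.1 + a / 2) p.2 (p.2 + b / 2))].
Proof.
move=> a0 b0 cf big; apply: contrapT => no.
have small p1 p2 : x <= p1 -> p1 + a / 2 <= x + a -> y <= p2 -> p2 + b / 2 <= y + b ->
    cmod (rectint f p1 (p1 + a / 2) p2 (p2 + b / 2)) <= e * (a / 2 + b / 2) ^+ 2.
  by move=> h1 h2 h3 h4; rewrite leNgt; apply/negP => h; apply: no; exists (p1, p2).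
have Ex : x + a = x + a / 2 + a / 2 by field.
have Ey : y + b = y + b / 2 + b / 2 by field.
move: big; rewrite ltNge => /negP; apply.
rewrite (@rectint_catx _ cf x (x + a / 2)); [|lra|lra].
rewrite (@rectint_caty _ cf x (x + a / 2) y (y + b / 2)); [|lra|lra].
rewrite (@rectint_caty _ cf (x + a / 2) (x + a) y (y + b / 2)); [|lra|lra].
have -> : e * (a + b) ^+ 2 = (e * (a / 2 + b / 2) ^+ 2 + e * (a / 2 + b / 2) ^+ 2)
   + (e * (a / 2 + b / 2) ^+ 2 + e * (a / 2 + b / 2) ^+ 2) by field.
rewrite Ex Ey.
by apply: (le_trans (ler_cmodD _ _)); apply: lerD;
  apply: (le_trans (ler_cmodD _ _)); apply: lerD; apply: small; lra.
Qed.

Lemma goursat f x0 x1 y0 y1 : x0 <= x1 -> y0 <= y1 -> (forall z, contat f z) ->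
  (forall z, x0 <= cre z <= x1 -> y0 <= cim z <= y1 -> exists l, cderiv f z l) ->
  rectint f x0 x1 y0 y1 = 0.
Proof.
move=> hx hy cf df; apply/eqP; rewrite -cmod_eq0 eq_le cmod_ge0 andbT leNgt.
apply/negP => I0; pose a := x1 - x0; pose b := y1 - y0.
have a0 : 0 <= a by rewrite subr_ge0.
have b0 : 0 <= b by rewrite subr_ge0.
have x1E : x1 = x0 + a by rewrite subrKC.
have y1E : y1 = y0 + b by rewrite subrKC.
pose bad e n (p : R * R) := e * (a / 2 ^+ n + b / 2 ^+ n) ^+ 2 <
  cmod (rectint f p.1 (p.1 + a / 2 ^+ n) p.2 (p.2 + b / 2 ^+ n)).
(* The added 1 keeps the denominator positive for a degenerate rectangle and makes the inequality
   strict. *)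
have [e e0 he] : exists2 e, 0 < e & bad e 0%N (x0, y0).
  exists (cmod (rectint f x0 x1 y0 y1) / ((a + b) ^+ 2 + 1)).
    by rewrite divr_gt0// ltr_wpDl// sqr_ge0.
  rewrite /bad expr0 !divr1 /= -x1E -y1E -mulrA gtr_pMr// mulrC ltr_pdivrMr.
    by rewrite mul1r ltrDl.
  by rewrite ltr_wpDl// sqr_ge0.
have pw n : 0 < 2 ^+ n :> R by rewrite exprn_gt0.
have half c n : c / 2 ^+ n.+1 = c / 2 ^+ n / 2 :> R by rewrite exprSr invfM mulrA.
have an n : 0 <= a / 2 ^+ n by rewrite divr_ge0// ltW.
have bn n : 0 <= b / 2 ^+ n by rewrite divr_ge0// ltW.
(* The choice of the next corner is made total, with [p] itself as the default at corners that are
   not bad, so that the sequence [s] can be defined by plain recursion. *)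
have step n p : {q : R * R | bad e n p -> [/\ p.1 <= q.1, q.1 + a / 2 ^+ n.+1 <= p.1 + a / 2 ^+ n,
    p.2 <= q.2, q.2 + b / 2 ^+ n.+1 <= p.2 + b / 2 ^+ n & bad e n.+1 q]}.
  apply: cid; have [bp|nb] := pselect (bad e n p); last by exists p.
  have [q] := rectint_quarter (an n) (bn n) cf bp.
  by rewrite -!half => hq; exists q.
pose s := fix s n := if n is k.+1 then sval (step k (s k)) else (x0, y0).
have sbad n : bad e n (s n).
  elim: n => [//|n IH]; rewrite [s n.+1]/=.
  by case: (step n (s n)) => q /= /(_ IH)[].
have sS n := svalP (step n (s n)) (sbad n).
have mono n k : [/\ (s n).1 <= (s (k + n)%N).1,
    (s (k + n)%N).1 + a / 2 ^+ (k + n) <= (s n).1 + a / 2 ^+ n,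
    (s n).2 <= (s (k + n)%N).2 &
    (s (k + n)%N).2 + b / 2 ^+ (k + n) <= (s n).2 + b / 2 ^+ n].
  elim: k => [|k [h1 h2 h3 h4]]; first by rewrite add0n.
  have [k1 k2 k3 k4 _] := sS (k + n)%N; rewrite addSn; split.
  - exact: le_trans k1.
  - exact: le_trans h2.
  - exact: le_trans k3.
  - exact: le_trans h4.
(* The lower left corners increase and stay below every right or upper side, so [(X, Y)] lies in all
   the nested rectangles. *)
pose X := sup (range (fun n => (s n).1)); pose Y := sup (range (fun n => (s n).2)).
have Xub n : ubound (range (fun n => (s n).1)) ((s n).1 + a / 2 ^+ n).
  move=> _ [k _ <-]; have [kn|/ltnW kn] := leqP k n.
    have [h _ _ _] := mono k (n - k)%N; move: h; rewrite subnK// => h.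
    by rewrite ler_wpDr.
  have [_ h _ _] := mono n (k - n)%N; move: h; rewrite subnK//; apply: le_trans.
  by rewrite ler_wpDr.
have Yub n : ubound (range (fun n => (s n).2)) ((s n).2 + b / 2 ^+ n).
  move=> _ [k _ <-]; have [kn|/ltnW kn] := leqP k n.
    have [_ _ h _] := mono k (n - k)%N; move: h; rewrite subnK// => h.
    by rewrite ler_wpDr.
  have [_ _ _ h] := mono n (k - n)%N; move: h; rewrite subnK//; apply: le_trans.
  by rewrite ler_wpDr.
have Xn n : (s n).1 <= X <= (s n).1 + a / 2 ^+ n.
  apply/andP; split; last by apply: ge_sup => //; exists (s 0%N).1, 0%N.
  by apply: ub_le_sup; [exists ((s 0%N).1 + a / 2 ^+ 0) | exists n].
have Yn n : (s n).2 <= Y <= (s n).2 + b / 2 ^+ n.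
  apply/andP; split; last by apply: ge_sup => //; exists (s 0%N).2, 0%N.
  by apply: ub_le_sup; [exists ((s 0%N).2 + b / 2 ^+ 0) | exists n].
pose z := pt X Y.
have [||l dl] := df z.
- by have := Xn 0%N; rewrite expr0 divr1 -x1E.
- by have := Yn 0%N; rewrite expr0 divr1 -y1E.
have e8 : 0 < e / 8 by rewrite divr_gt0.
have [d d0 hd] := (cderivP _ _ _).1 dl _ e8.
pose N := Num.bound ((a + b) / d); pose q := a / 2 ^+ N + b / 2 ^+ N.
have q0 : 0 <= q by rewrite addr_ge0.
have qd : q < d.
  rewrite /q -mulrDl ltr_pdivrMr// mulrC -ltr_pdivrMr//.
  apply: (@lt_trans _ _ N%:R); first by apply: archi_boundP; apply: divr_ge0; [exact: addr_ge0|exact: ltW].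
  by rewrite -natrX ltr_nat ltn_expl.
(* Subtracting the tangent map [A] does not change the integral. The remainder is at most e / 8 * q
   on a rectangle of semiperimeter [q], so the integral is at most e / 2 * q^2, against badness. *)
pose A w := (f z - l * z) + l * w.
have cA w : contat A w.
  apply: contatD; first exact: contat_cst.
  by apply: contatM; [exact: contat_cst|exact: contat_id].
have /andP[X1 X2] := Xn N; have /andP[Y1 Y2] := Yn N.
have := sbad N; rewrite /bad ltNge => /negP; apply.
have aN := an N; have bN := bn N.
have -> : rectint f (s N).1 ((s N).1 + a / 2 ^+ N) (s N).2 ((s N).2 + b / 2 ^+ N) =
    rectint (fun w => f w - A w) (s N).1 ((s N).1 + a / 2 ^+ N) (s N).2 ((s N).2 + b / 2 ^+ N).
  by rewrite rectintB// rectint_affine ?subr0// lerDl.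
apply: (le_trans (@rectint_bound _ _ _ _ _ _ (e / 8 * q) _ _ _)).
- by move=> w; exact: contatB.
- by rewrite lerDl.
- by rewrite lerDl.
- move=> w /andP[w1 w2] /andP[w3 w4].
  have wq : cmod (w - z) <= q.
    apply: (le_trans (cmod_le_sum _)); rewrite creD creN cimD cimN /=.
    by apply: lerD; rewrite ler_norml; lra.
  have := hd _ (le_lt_trans wq qd); rewrite /A.
  have -> : f w - (f z - l * z + l * w) = f w - f z - l * (w - z) by ring.
  by move=> h; apply: (le_trans h); rewrite ler_wpM2l// ltW.
- rewrite ![_ + _ - _]addrC !addKr -/q -subr_ge0.
  have -> : e * q ^+ 2 - 4 * (e / 8 * q) * q = e / 2 * q ^+ 2 by field.
  by rewrite mulr_ge0 ?sqr_ge0// divr_ge0// ltW.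
Qed.

Lemma rectint_xx f x y0 y1 : (forall z, contat f z) -> rectint f x x y0 y1 = 0.
Proof.
move=> cf; have := rectint_catx cf y0 y1 (lexx x) (lexx x).
by move/eqP; rewrite -subr_eq0 opprD addNKr oppr_eq0 => /eqP.
Qed.

Lemma rectint_yy f x0 x1 y : (forall z, contat f z) -> rectint f x0 x1 y y = 0.
Proof.
move=> cf; have := rectint_caty cf x0 x1 (lexx y) (lexx y).
by move/eqP; rewrite -subr_eq0 opprD addNKr oppr_eq0 => /eqP.
Qed.

(** Cutting away rectangles that avoid [p] leaves a small one around it, where continuity bounds
    [f], so the integral is smaller than any [e]. The hypothesis speaks of all subrectangles in
    order that the lemma can be nested to remove two points. *)
Lemma rectint_remove_point f p x0 x1 y0 y1 : x0 <= x1 -> y0 <= y1 ->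
  (forall z, contat f z) ->
  (forall a0 a1 b0 b1, x0 <= a0 -> a0 <= a1 -> a1 <= x1 -> y0 <= b0 -> b0 <= b1 -> b1 <= y1 ->
     ~ (a0 <= cre p <= a1 /\ b0 <= cim p <= b1) -> rectint f a0 a1 b0 b1 = 0) ->
  rectint f x0 x1 y0 y1 = 0.
Proof.
move=> hx hy cf f0; have [|np] := pselect (x0 <= cre p <= x1 /\ y0 <= cim p <= y1); last first.
  exact: f0.
move=> [/andP[px0 px1] /andP[py0 py1]].
(* When [p] is within [d] of a side, the maximum or minimum is that side and the strip to be cut off
   is degenerate; otherwise the strip avoids [p]. *)
have shrink d : 0 < d -> rectint f x0 x1 y0 y1 =
    rectint f (Num.max x0 (cre p - d)) (Num.min x1 (cre p + d))
              (Num.max y0 (cim p - d)) (Num.min y1 (cim p + d)).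
  move=> d0; set u := Num.max x0 _; set v := Num.min x1 _.
  set u' := Num.max y0 _; set v' := Num.min y1 _.
  have x0u : x0 <= u by rewrite le_max lexx.
  have y0u : y0 <= u' by rewrite le_max lexx.
  have vx1 : v <= x1 by rewrite ge_min lexx.
  have vy1 : v' <= y1 by rewrite ge_min lexx.
  have up : u <= cre p by rewrite ge_max px0 lerBlDr lerDl ltW.
  have up' : u' <= cim p by rewrite ge_max py0 lerBlDr lerDl ltW.
  have pv : cre p <= v by rewrite le_min px1 lerDl ltW.
  have pv' : cim p <= v' by rewrite le_min py1 lerDl ltW.
  have uv := le_trans up pv; have uv' := le_trans up' pv'.
  rewrite (rectint_catx cf y0 y1 x0u (le_trans uv vx1)) (rectint_catx cf y0 y1 uv vx1).
  rewrite (rectint_caty cf u v y0u (le_trans uv' vy1)) (rectint_caty cf u v uv' vy1).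
  have -> : rectint f x0 u y0 y1 = 0.
    rewrite /u; case: (leP x0 (cre p - d)) => h; last exact: rectint_xx.
    by apply: f0 => //; [lra|move=> [/andP[_ k] _]; lra].
  have -> : rectint f v x1 y0 y1 = 0.
    rewrite /v; case: (leP x1 (cre p + d)) => h; first exact: rectint_xx.
    by apply: f0 => //; [lra|exact: ltW|move=> [/andP[k _] _]; lra].
  have -> : rectint f u v y0 u' = 0.
    rewrite /u'; case: (leP y0 (cim p - d)) => h; last exact: rectint_yy.
    by apply: f0 => //; [lra|move=> [_ /andP[_ k]]; lra].
  have -> : rectint f u v v' y1 = 0.
    rewrite /v'; case: (leP y1 (cim p + d)) => h; first exact: rectint_yy.
    by apply: f0 => //; [lra|exact: ltW|move=> [_ /andP[k _]]; lra].
  by rewrite !add0r !addr0.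
have [d d0 hd] := (contatCCP _ _).1 (cf p) 1 ltr01.
pose M := cmod (f p) + 1; have M0 : 0 < M by rewrite ltr_wpDl// cmod_ge0.
apply/eqP; rewrite -cmod_eq0 eq_le cmod_ge0 andbT; apply/ler_addgt0Pl => e e0.
rewrite addr0; pose r := Num.min (d / 4) (e / (16 * M)).
have r0 : 0 < r by rewrite lt_min !divr_gt0// mulr_gt0.
have rd : r <= d / 4 by rewrite ge_min lexx.
have re : r <= e / (16 * M) by rewrite ge_min lexx orbT.
rewrite (shrink _ r0); set u := Num.max x0 _; set v := Num.min x1 _.
set u' := Num.max y0 _; set v' := Num.min y1 _.
have up : u <= cre p by rewrite ge_max px0 lerBlDr lerDl ltW.
have up' : u' <= cim p by rewrite ge_max py0 lerBlDr lerDl ltW.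
have pv : cre p <= v by rewrite le_min px1 lerDl ltW.
have pv' : cim p <= v' by rewrite le_min py1 lerDl ltW.
have ur : cre p - r <= u by rewrite le_max lexx orbT.
have ur' : cim p - r <= u' by rewrite le_max lexx orbT.
have vr : v <= cre p + r by rewrite ge_min lexx orbT.
have vr' : v' <= cim p + r by rewrite ge_min lexx orbT.
apply: (le_trans (@rectint_bound _ cf _ _ _ _ M _ _ _)); [exact: le_trans pv|exact: le_trans pv'| |].
  move=> w /andP[w1 w2] /andP[w3 w4]; rewrite /M -lerBlDl.
  apply: (le_trans (cmod_sub_ge _ _)); apply/ltW/hd.
  apply: (le_lt_trans (cmod_le_sum _)); rewrite creD creN cimD cimN.
  have : `|cre w - cre p| <= d / 4 by rewrite ler_norml; lra.
  have : `|cim w - cim p| <= d / 4 by rewrite ler_norml; lra.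
  lra.
apply: (@le_trans _ _ (4 * M * (4 * r))).
  apply: ler_wpM2l; [apply: mulr_ge0; [by []|exact: ltW]|].
  by clear -ur ur' vr vr'; lra.
move: re; rewrite ler_pdivlMr ?mulr_gt0// => h; apply: le_trans h; rewrite le_eqVlt.
by apply/orP; left; apply/eqP; ring.
Qed.

End Goursat.

(** * Cauchy's formula on the square *)

Section CauchyTransform.
Variable R : realType.
Implicit Types (f g : CC R -> CC R) (a z w : CC R).

(** The full lines carrying the sides of the square: the integration lemmas ask for integrands that
    are continuous on all of [R], not only on the interval of integration. *)
Definition onlines (z : CC R) := `|cre z| = 1 \/ `|cim z| = 1.

Definition bint f := rectint f (-1) 1 (-1) 1.

Lemma onlines_pt (s : R) : [/\ onlines (pt s (-1)), onlines (pt s 1),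
  onlines (pt (-1) s) & onlines (pt 1 s)].
Proof. by split; [right|right|left|left] => /=; rewrite ?normrN normr1. Qed.

Section Lines.
Variable f : CC R -> CC R.
Hypothesis cf : forall z, onlines z -> contat f z.

Lemma contat_bottom (s : R) : contat (fun x => f (pt x (-1))) s.
Proof.
apply: (contat_comp (f := fun x : R => pt x (-1)) (contat_ptx _ _)); apply: cf.
by case: (onlines_pt s).
Qed.

Lemma contat_top (s : R) : contat (fun x => f (pt x 1)) s.
Proof.
apply: (contat_comp (f := fun x : R => pt x 1) (contat_ptx _ _)); apply: cf.
by case: (onlines_pt s).
Qed.

Lemma contat_left (s : R) : contat (fun x => f (pt (-1) x)) s.
Proof.
apply: (contat_comp (f := fun x : R => pt (-1) x) (contat_pty _ _)); apply: cf.
by case: (onlines_pt s).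
Qed.

Lemma contat_right (s : R) : contat (fun x => f (pt 1 x)) s.
Proof.
apply: (contat_comp (f := fun x : R => pt 1 x) (contat_pty _ _)); apply: cf.
by case: (onlines_pt s).
Qed.

End Lines.

Lemma N11 : -1 <= 1 :> R. Proof. lra. Qed.

Lemma bintB f g : (forall z, onlines z -> contat f z) -> (forall z, onlines z -> contat g z) ->
  bint (fun z => f z - g z) = bint f - bint g.
Proof.
move=> cf cg; rewrite /bint /rectint.
rewrite (cintB _ _ (contat_bottom cf) (contat_bottom cg)).
rewrite (cintB _ _ (contat_top cf) (contat_top cg)).
rewrite (cintB _ _ (contat_left cf) (contat_left cg)).
rewrite (cintB _ _ (contat_right cf) (contat_right cg)).
ring.
Qed.

Lemma bintZ c f : (forall z, onlines z -> contat f z) ->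
  bint (fun z => c * f z) = c * bint f.
Proof.
move=> cf; rewrite /bint /rectint.
rewrite (cintZ _ _ _ (contat_bottom cf)) (cintZ _ _ _ (contat_top cf)).
rewrite (cintZ _ _ _ (contat_left cf)) (cintZ _ _ _ (contat_right cf)).
ring.
Qed.

Lemma bint_ext f g : (forall z, onlines z -> f z = g z) -> bint f = bint g.
Proof.
move=> fg; rewrite /bint /rectint; congr (_ - _ + _ * (_ - _)); apply: cint_ext => s _;
  by apply: fg; case: (onlines_pt s).
Qed.

Definition onsquare z := onlines z /\ cmod z <= 2.

Lemma bint_bound f (M : R) : (forall z, onlines z -> contat f z) ->
  (forall z, onsquare z -> cmod (f z) <= M) -> cmod (bint f) <= 16 * M.
Proof.
move=> cf fM.
have le2 (x y : R) : -1 <= x <= 1 -> -1 <= y <= 1 -> cmod (pt x y) <= 2.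
  move=> hx hy; apply: (le_trans (cmod_le_sum _)) => /=.
  have : `|x| <= 1 by rewrite ler_norml.
  have : `|y| <= 1 by rewrite ler_norml.
  lra.
have t1 : -1 <= (-1 : R) <= 1 by rewrite lexx N11.
have t2 : -1 <= (1 : R) <= 1 by rewrite lexx N11.
have b (u : R -> CC R) : (forall x, contat u x) ->
    (forall x, -1 <= x <= 1 -> cmod (u x) <= M) -> cmod (cint (-1) 1 u) <= 4 * M.
  move=> cu uM; apply: (le_trans (cint_bound N11 cu uM)).
  by rewrite le_eqVlt; apply/orP; left; apply/eqP; ring.
have b1 := b _ (contat_bottom cf); have b2 := b _ (contat_top cf).
have b3 := b _ (contat_left cf); have b4 := b _ (contat_right cf).
apply: (le_trans (ler_cmodD _ _)).
have -> : 16 * M = (4 * M + 4 * M) + (4 * M + 4 * M) by ring.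
apply: lerD; last rewrite cmodM [cmod (pt 0 1)]cmodE /= expr0n add0r expr1n sqrtr1 mul1r.
  apply: (le_trans (ler_cmodD _ _)); rewrite cmodN; apply: lerD; [apply: b1|apply: b2] => x hx;
  by apply: fM; split; [case: (onlines_pt x)|apply: le2].
apply: (le_trans (@ler_cmodD _ _ (- _))); rewrite cmodN; apply: lerD; [apply: b4|apply: b3] => x hx;
by apply: fM; split; [case: (onlines_pt x)|apply: le2].
Qed.

Lemma onlines_dist z a : onlines z -> 1 - cmod a <= cmod (z - a).
Proof.
move=> [] h.
  apply: (le_trans _ (cre_le _)); rewrite creD creN -h.
  apply: (le_trans _ (lerB_dist _ _)); rewrite lerB//; exact: cre_le.
apply: (le_trans _ (cim_le _)); rewrite cimD cimN -h.
apply: (le_trans _ (lerB_dist _ _)); rewrite lerB//; exact: cim_le.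
Qed.

(** The Cauchy transform: for holomorphic [f] and j >= 1 it is the derivative of order j - 1 at [a],
    up to the factor 2 pi i / (j - 1)!. *)
Definition ctrans f j a := bint (fun z => f z * (z - a)^-1 ^+ j).

Lemma onlines_neq0 z a : cmod a < 1 -> onlines z -> z - a != 0.
Proof.
move=> a1 /(onlines_dist a) h; rewrite -cmod_gt0; apply: lt_le_trans h.
by rewrite subr_gt0.
Qed.

Lemma contat_kernel f j a : cmod a < 1 -> (forall z, onlines z -> contat f z) ->
  forall z, onlines z -> contat (fun z => f z * (z - a)^-1 ^+ j) z.
Proof.
move=> a1 cf z zl; apply: contatM; first exact: cf.
apply: contatX; apply: contatV; first exact: onlines_neq0.
by apply: contatB; [exact: contat_id|exact: contat_cst].
Qed.

Lemma ctrans_bound f j a (M : R) : (forall z, onlines z -> contat f z) -> 0 <= M ->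
  (forall z, onsquare z -> cmod (f z) <= M) -> cmod a <= 1 / 2 ->
  cmod (ctrans f j a) <= 16 * (M * 2 ^+ j).
Proof.
move=> cf M0 fM a2; have a1 : cmod a < 1 by apply: (le_lt_trans a2); lra.
apply: bint_bound => [|z zs]; first exact: contat_kernel.
rewrite cmodM; apply: ler_pM; rewrite ?cmod_ge0//; first exact: fM.
rewrite cmodX; apply: lerXn2r; rewrite ?nnegrE ?cmod_ge0// cmodV.
have := onlines_dist a (proj1 zs) => h.
rewrite -[X in _ <= X]invrK lef_pV2 ?posrE ?invr_gt0//; first by apply: le_trans h; lra.
by apply: lt_le_trans h; lra.
Qed.

(** Differentiation under the integral sign: the first-order Taylor remainder of the kernel is
    quadratic in [w - a], uniformly on the square, and is integrated against [f]. *)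
Lemma cderiv_ctrans f j a (M C : R) :
  (forall z, onlines z -> contat f z) -> 0 <= M ->
  (forall z, onsquare z -> cmod (f z) <= M) -> cmod a < 1 / 2 -> 0 < C ->
  (forall z w, onsquare z -> cmod (w - a) < 1 / 4 ->
     cmod ((z - w)^-1 ^+ j - (z - a)^-1 ^+ j - j%:R * (z - a)^-1 ^+ j.+1 * (w - a)) <=
      C * cmod (w - a) ^+ 2) ->
  cderiv (ctrans f j) a (j%:R * ctrans f j.+1 a).
Proof.
move=> cf M0 fM a2 C0 hC; apply/cderivP => e e0.
have a1 : cmod a < 1 by lra.
have MC : 0 < 16 * (M + 1) * C by rewrite !mulr_gt0// ltr_wpDl.
exists (Num.min (1 / 4) (e / (16 * (M + 1) * C))).
  by rewrite lt_min !divr_gt0.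
move=> w; rewrite lt_min => /andP[w1 w2].
have w3 : cmod w < 1.
  have := ler_cmodD (w - a) a; rewrite subrK; lra.
have k1 := contat_kernel j w3 cf; have k2 := contat_kernel j a1 cf.
have k3 := contat_kernel j.+1 a1 cf.
rewrite -mulrAC /ctrans -bintB// -bintZ// -bintB; last first.
- by move=> z zl; apply: contatM; [exact: contat_cst|exact: k3].
- by move=> z zl; apply: contatB; [exact: k1|exact: k2].
apply: (@le_trans _ _ (16 * (M * (C * cmod (w - a) ^+ 2)))).
  apply: bint_bound => [z zl|z zs].
    apply: contatB; first by apply: contatB; [exact: k1|exact: k2].
    by apply: contatM; [exact: contat_cst|exact: k3].
  set X := (X in cmod X).
  have -> : X = f z * ((z - w)^-1 ^+ j - (z - a)^-1 ^+ j - j%:R * (z - a)^-1 ^+ j.+1 * (w - a)).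
    by rewrite /X; ring.
  by rewrite cmodM; apply: ler_pM; rewrite ?cmod_ge0//; [exact: fM|exact: hC].
rewrite expr2 !mulrA ler_wpM2r ?cmod_ge0//.
apply: (@le_trans _ _ (16 * (M + 1) * C * cmod (w - a))).
  rewrite ler_wpM2r ?cmod_ge0// ler_wpM2r ?(ltW C0)//; lra.
by move: w2; rewrite ltr_pdivlMr// mulrC => /ltW.
Qed.

Lemma onsquare_dist z w a : onsquare z -> cmod a < 1 / 2 -> cmod (w - a) < 1 / 4 ->
  [/\ 1 / 4 <= cmod (z - w), 1 / 4 <= cmod (z - a) & cmod (z - a) <= 3].
Proof.
move=> [zl z2] a2 w1.
have h1 := onlines_dist a zl; have h2 := onlines_dist w zl.
have h3 := ler_cmodD (w - a) a; rewrite subrK in h3.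
have h4 := ler_cmodD z (- a); rewrite cmodN in h4.
by split; lra.
Qed.

Lemma cmodV_le4 z : 1 / 4 <= cmod z -> cmod z^-1 <= 4.
Proof.
move=> h; rewrite cmodV -[X in _ <= X]invrK lef_pV2 ?posrE ?invr_gt0//; lra.
Qed.

Section Derivatives.
Variables (f : CC R -> CC R) (M : R).
Hypothesis cf : forall z, onlines z -> contat f z.
Hypothesis M0 : 0 <= M.
Hypothesis fM : forall z, onsquare z -> cmod (f z) <= M.

Lemma cderiv_ctrans1 a : cmod a < 1 / 2 -> cderiv (ctrans f 1) a (ctrans f 2 a).
Proof.
move=> a2; rewrite -[ctrans f 2 a]mul1r.
apply: (@cderiv_ctrans f 1 a M 64) => // z w zs wa.
have [h1 h2 _] := onsquare_dist zs a2 wa.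
have z1 : z - w != 0 by rewrite -cmod_gt0; lra.
have z2 : z - a != 0 by rewrite -cmod_gt0; lra.
have -> : (z - w)^-1 ^+ 1 - (z - a)^-1 ^+ 1 - 1%:R * (z - a)^-1 ^+ 2 * (w - a) =
   ((z - a)^-1 * (z - a)^-1 * (z - w)^-1) * (w - a) ^+ 2.
  by rewrite !expr2 expr1; field; rewrite z1 z2.
rewrite cmodM cmodX ler_wpM2r ?sqr_ge0// !cmodM.
have -> : 64 = 4 * 4 * 4 :> R by ring.
by apply: ler_pM; rewrite ?mulr_ge0 ?cmod_ge0 ?cmodV_le4//; apply: ler_pM; rewrite ?cmod_ge0 ?cmodV_le4.
Qed.

Lemma cderiv_ctrans2 a : cmod a < 1 / 2 -> cderiv (ctrans f 2) a (2 * ctrans f 3 a).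
Proof.
(* In the exact remainder each of the five inverse factors is at most 4, and 3 (z - a) - 2 (w - a)
   has modulus at most 9 + 1 / 2 <= 11. *)
move=> a2; apply: (@cderiv_ctrans f 2 a M (4 ^+ 5 * 11)) => // z w zs wa.
have [h1 h2 h3] := onsquare_dist zs a2 wa.
have z1 : z - w != 0 by rewrite -cmod_gt0; lra.
have z2 : z - a != 0 by rewrite -cmod_gt0; lra.
have -> : (z - w)^-1 ^+ 2 - (z - a)^-1 ^+ 2 - 2%:R * (z - a)^-1 ^+ 3 * (w - a) =
   (((z - a)^-1 ^+ 3 * (z - w)^-1 ^+ 2) * (3 * (z - a) - 2 * (w - a))) * (w - a) ^+ 2.
  by field; rewrite z1 z2.
rewrite cmodM cmodX ler_wpM2r ?sqr_ge0// cmodM.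
apply: ler_pM; rewrite ?cmod_ge0//.
  have -> : 4 ^+ 5 = 4 ^+ 3 * 4 ^+ 2 :> R by rewrite -exprD.
  rewrite cmodM !cmodX; apply: ler_pM; rewrite ?exprn_ge0 ?cmod_ge0//;
  by apply: lerXn2r; rewrite ?nnegrE ?cmod_ge0//; exact: cmodV_le4.
apply: (le_trans (ler_cmodD _ _)); rewrite cmodN !cmodM !cmod_nat; lra.
Qed.

End Derivatives.

(* The value [2 pi i] is never needed: Cauchy's formula is used as [f a = ctrans f 1 a / wind a]. *)
Definition wind a := ctrans (fun=> 1) 1 a.

Lemma cre_inv z : cre z^-1 = cre z / cmod z ^+ 2.
Proof. by rewrite sqr_cmod; case: z. Qed.

Lemma cim_inv z : cim z^-1 = - cim z / cmod z ^+ 2.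
Proof. by rewrite sqr_cmod; case: z => x y /=; rewrite mulNr. Qed.

(** All four sides contribute to the imaginary part with the same sign: the relevant coordinate of
    [z - a] is at least 1 / 2 and |z - a|^2 <= 9, so a side of length 2 gives at least 2 / 18. *)
Lemma wind_ge a : cmod a <= 1 / 2 -> 4 / 9 <= cmod (wind a).
Proof.
move=> a2; apply: le_trans (cim_le _); apply: le_trans (ler_norm _).
have a1 : cmod a < 1 by lra.
have are := le_trans (cre_le a) a2; have aim := le_trans (cim_le a) a2.
have ck z : onlines z -> contat (fun z => 1 * (z - a)^-1 ^+ 1) z.
  by apply: contat_kernel => // ? _; exact: contat_cst.
have E1 z : 1 * z ^+ 1 = z by rewrite mul1r expr1.
have ge (u : R -> R) : (forall x, contat u x) -> (forall x, -1 <= x <= 1 -> 1 / 18 <= u x) ->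
    1 / 9 <= rint (-1) 1 u.
  move=> cu hu; have := @ler_rint R (-1) 1 (fun=> 1/18) u (fun=> contat_cst _ _) cu hu.
  rewrite rint_cst ?N11//; lra.
have le (u : R -> R) : (forall x, contat u x) -> (forall x, -1 <= x <= 1 -> u x <= - (1 / 18)) ->
    rint (-1) 1 u <= - (1 / 9).
  move=> cu hu; have := @ler_rint R (-1) 1 u (fun=> - (1/18)) cu (fun=> contat_cst _ _) hu.
  rewrite rint_cst ?N11//; lra.
have sq z : onlines z -> -1 <= cre z <= 1 -> -1 <= cim z <= 1 -> 0 < cmod (z - a) ^+ 2 <= 9.
  move=> zl hx hy; rewrite exprn_gt0 ?cmod_gt0 ?onlines_neq0//=.
  have -> : 9 = 3 ^+ 2 :> R by ring.
  apply: lerXn2r; rewrite ?nnegrE ?cmod_ge0//.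
  apply: (le_trans (ler_cmodD _ _)); rewrite cmodN.
  have := cmod_le_sum z.
  have : `|cre z| <= 1 by rewrite ler_norml.
  have : `|cim z| <= 1 by rewrite ler_norml.
  lra.
have pos (x y : R) : 1 / 2 <= x -> 0 < y <= 9 -> 1 / 18 <= x / y.
  move=> hx /andP[y0 y9]; rewrite ler_pdivlMr//; lra.
have neg (x y : R) : x <= - (1 / 2) -> 0 < y <= 9 -> x / y <= - (1 / 18).
  move=> hx /andP[y0 y9]; rewrite ler_pdivrMr//; lra.
have -> : cim (wind a) =
  rint (-1) 1 (fun x => cim (1 * (pt x (-1) - a)^-1 ^+ 1))
  - rint (-1) 1 (fun x => cim (1 * (pt x 1 - a)^-1 ^+ 1))
  + (rint (-1) 1 (fun x => cre (1 * (pt 1 x - a)^-1 ^+ 1))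
  - rint (-1) 1 (fun x => cre (1 * (pt (-1) x - a)^-1 ^+ 1))).
  by rewrite /wind /ctrans /bint /rectint !(cimD, cimN, cimM, creD, creN) /=; ring.
have t1 : -1 <= (-1 : R) <= 1 by rewrite lexx N11.
have t2 : -1 <= (1 : R) <= 1 by rewrite lexx N11.
move: are aim; rewrite !ler_norml => /andP[ar1 ar2] /andP[ai1 ai2].
have h1 : 1 / 9 <= rint (-1) 1 (fun x => cim (1 * (pt x (-1) - a)^-1 ^+ 1)).
  apply: ge => [x|x hx]; first by apply: contat_cim; exact: (contat_bottom ck).
  rewrite E1 cim_inv cimD cimN; apply: pos => /=; first lra.
  by apply: sq => //; case: (onlines_pt x).
have h2 : rint (-1) 1 (fun x => cim (1 * (pt x 1 - a)^-1 ^+ 1)) <= - (1 / 9).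
  apply: le => [x|x hx]; first by apply: contat_cim; exact: (contat_top ck).
  rewrite E1 cim_inv cimD cimN; apply: neg => /=; first lra.
  by apply: sq => //; case: (onlines_pt x).
have h3 : 1 / 9 <= rint (-1) 1 (fun x => cre (1 * (pt 1 x - a)^-1 ^+ 1)).
  apply: ge => [x|x hx]; first by apply: contat_cre; exact: (contat_right ck).
  rewrite E1 cre_inv creD creN; apply: pos => /=; first lra.
  by apply: sq => //; case: (onlines_pt x).
have h4 : rint (-1) 1 (fun x => cre (1 * (pt (-1) x - a)^-1 ^+ 1)) <= - (1 / 9).
  apply: le => [x|x hx]; first by apply: contat_cre; exact: (contat_left ck).
  rewrite E1 cre_inv creD creN; apply: neg => /=; first lra.
  by apply: sq => //; case: (onlines_pt x).
lra.
Qed.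

(** The quotient rule for [ctrans f 1 / wind] has a numerator of size at most 64 * 64 * M and a
    denominator of size at least (4 / 9)^2. *)
Definition cauchyK : R := 64 * 64 * (9 / 4) ^+ 2.

(** The slope function [k] of [f] at [a] is continuous, and holomorphic on the square off [a] and 0,
    so its boundary integral vanishes once both points are removed. Differentiability is not asked
    for at 0, in view of removable singularities. *)
Lemma cauchy_formula f a : (forall z, contat f z) -> a != 0 -> cmod a < 1 ->
  (forall z, z != 0 -> `|cre z| <= 1 -> `|cim z| <= 1 -> exists l, cderiv f z l) ->
  ctrans f 1 a = f a * wind a.
Proof.
move=> cf a0 a1 df; have [||l dl] := df a a0.
- by have := cre_le a; lra.
- by have := cim_le a; lra.
have [k [ck kl fk]] := dl.
have kE z : z != a -> k z = (f z - f a) / (z - a).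
  by move=> za; rewrite (fk z); field; rewrite subr_eq0.
have kc z : contat k z.
  have [->//|za] := eqVneq z a.
  apply/contatCCP => e e0.
  have /contatCCP/(_ _ e0)[d d0 hd] : contat (fun z => (f z - f a) / (z - a)) z.
    apply: contatM; first by apply: contatB => //; exact: contat_cst.
    apply: contatV; first by rewrite subr_eq0.
    by apply: contatB; [exact: contat_id|exact: contat_cst].
  exists (Num.min d (cmod (z - a))); first by rewrite lt_min d0 cmod_gt0 subr_eq0.
  move=> w; rewrite lt_min => /andP[wd wz].
  have wa : w != a by apply: contraTneq wz => ->; rewrite cmodB ltxx.
  by rewrite (kE w)// (kE z)//; exact: hd.
have kd z : z != a -> z != 0 -> `|cre z| <= 1 -> `|cim z| <= 1 -> exists l, cderiv k z l.
  move=> za z0 z3 z4; have [l' dl'] := df z z0 z3 z4.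
  have d1 : cderiv (fun z => (f z - f a) / (z - a)) z
     (((l' - 0) * (z - a) - (f z - f a) * (1 - 0)) / (z - a) ^+ 2).
    apply: cderiv_div; first by rewrite subr_eq0.
      exact: cderivB dl' (cderiv_cst _ _).
    exact: cderivB (cderiv_id _) (cderiv_cst _ _).
  eexists; apply: (cderiv_near (d := cmod (z - a)) _ _ d1).
    by rewrite cmod_gt0 subr_eq0.
  move=> w wz; apply/esym/kE; apply: contraTneq wz => ->.
  by rewrite cmodB ltxx.
have I0 : bint k = 0.
  apply: (@rectint_remove_point R k a) => [||//|x0 x1 y0 y1 h1 h2 h3 h4 h5 h6 na].
  - exact: N11.
  - exact: N11.
  apply: (@rectint_remove_point R k 0) => // a0' a1' b0 b1 k1 k2 k3 k4 k5 k6 n0.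
  apply: goursat => // z /andP[z1 z2] /andP[z3 z4]; apply: kd.
  - by apply/eqP => E; apply: na; rewrite -E; split; lra.
  - by apply/eqP => E; apply: n0; rewrite -E; split; lra.
  - by rewrite ler_norml; lra.
  - by rewrite ler_norml; lra.
have c1 z : onlines z -> contat (fun z => f z * (z - a)^-1 ^+ 1) z.
  by apply: contat_kernel.
have c2 z : onlines z -> contat (fun z => 1 * (z - a)^-1 ^+ 1) z.
  by apply: contat_kernel => // ? _; exact: contat_cst.
rewrite /wind /ctrans -bintZ//; apply/eqP; rewrite -subr_eq0 -bintB//; last first.
  by move=> z zl; apply: contatM; [exact: contat_cst|exact: c2].
rewrite -[X in _ == X]I0; apply/eqP/bint_ext => z zl.
have za : z != a by rewrite -subr_eq0; exact: onlines_neq0.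
by rewrite (kE z za) expr1 mul1r mulrBl.
Qed.

(** Near 0, [f] equals [ctrans f 1 / wind]: off 0 by Cauchy's formula, at 0 because both sides are
    continuous. The quotient rule then yields two derivatives, also at 0. That [wind] is constant is
    never shown, so its derivative stays in the formula for [h1]. *)
Lemma holomorphic_unit f : (forall z, contat f z) ->
  (forall z, z != 0 -> `|cre z| <= 1 -> `|cim z| <= 1 -> exists l, cderiv f z l) ->
  exists h1 h2, forall a, cmod a < 1 / 2 ->
    [/\ cderiv f a (h1 a), cderiv h1 a (h2 a) &
      forall M, (forall z, cmod z <= 2 -> cmod (f z) <= M) -> cmod (h1 a) <= cauchyK * M].
Proof.
move=> cf df.
have cf' z : onlines z -> contat f z by [].
have c1 z : onlines z -> contat (fun=> 1 : CC R) z by move=> _; exact: contat_cst.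
have [M M0 fM] : exists2 M, 0 <= M & forall z, cmod z <= 2 -> cmod (f z) <= M.
  pose A := [set z : CC R | -2 <= cre z <= 2 /\ -2 <= cim z <= 2].
  have [||c _ hc] := @square_EVT_max R A (-2) 2 (-2) 2 (fun z => cmod (f z)) _ erefl.
  - by exists 0; split => /=; lra.
  - by move=> z _; exact: contat_cmod.
  exists (cmod (f c)); first exact: cmod_ge0.
  move=> z z2; apply: hc.
  by have := le_trans (cre_le z) z2; have := le_trans (cim_le z) z2; rewrite !ler_norml.
have fM' z : onsquare z -> cmod (f z) <= M by move=> [_ /fM].
have oM z : onsquare z -> cmod (1 : CC R) <= 1 by move=> _; rewrite cmod1.
have wn0 a : cmod a < 1 / 2 -> wind a != 0.
  by move=> /ltW /wind_ge h; rewrite -cmod_gt0; apply: lt_le_trans h; rewrite divr_gt0.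
pose G a := ctrans f 1 a / wind a.
have dT1 a := cderiv_ctrans1 cf' M0 fM' (a := a).
have dT2 a := cderiv_ctrans2 cf' M0 fM' (a := a).
have dc1 a := cderiv_ctrans1 c1 ler01 oM (a := a).
have dc2 a := cderiv_ctrans2 c1 ler01 oM (a := a).
have dG a : cmod a < 1 / 2 -> cderiv G a
    ((ctrans f 2 a * wind a - ctrans f 1 a * ctrans (fun=> 1) 2 a) / wind a ^+ 2).
  move=> a2; apply: cderiv_div; [exact: wn0|exact: dT1|exact: dc1].
have fG a : cmod a < 1 / 2 -> f a = G a.
  have fG' b : b != 0 -> cmod b < 1 / 2 -> f b = G b.
    move=> b0 b2; rewrite /G cauchy_formula//; last lra.
    by rewrite mulfK// wn0.
  have [->|a0] := eqVneq a 0; last exact: fG'.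
  move=> h0; apply/eqP; rewrite -subr_eq0 -cmod_eq0 eq_le cmod_ge0 andbT.
  apply/ler_addgt0Pl => e e0; rewrite addr0.
  have e2 : 0 < e / 2 by rewrite divr_gt0.
  have [d d0 hd] := (contatCCP _ _).1 (cf 0) _ e2.
  have [d' d'0 hd'] := (contatCCP _ _).1 (cderiv_contat (dG _ h0)) _ e2.
  pose r := Num.min (1 / 4) (Num.min (d / 2) (d' / 2)).
  have r0 : 0 < r by rewrite !lt_min !divr_gt0.
  have r4 : r <= 1 / 4 by rewrite ge_min lexx.
  have rd : r <= d / 2 by rewrite !ge_min lexx orbT.
  have rd' : r <= d' / 2 by rewrite !ge_min lexx !orbT.
  have [b [b0 br]] : exists b : CC R, b != 0 /\ cmod b = r.
    by exists (rc r); rewrite rc_eq0 gt_eqF// cmod_rc gtr0_norm.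
  have hb := hd b; have hb' := hd' b; rewrite subr0 br in hb hb'.
  have hb2 : cmod (f 0 - G b) < e / 2.
    rewrite cmodB -(fG' b b0); last by rewrite br; lra.
    by apply: hb; lra.
  have {hb'} : cmod (G b - G 0) < e / 2 by apply: hb'; lra.
  have := cmod_triangle (G b) (f 0) (G 0).
  by move: (cmod (f 0 - G 0)) (cmod (G b - G 0)) hb2 => x y; move: (cmod _) => t; lra.
exists (fun a => (ctrans f 2 a * wind a - ctrans f 1 a * ctrans (fun=> 1) 2 a) / wind a ^+ 2).
eexists => a a2; split.
- apply: (@cderiv_near _ G _ _ _ (1 / 2 - cmod a)); [lra| |exact: dG].
  move=> w wa; rewrite fG//; have := ler_cmodD (w - a) a; rewrite subrK; lra.
- apply: cderiv_div; first by rewrite expf_neq0// wn0.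
    apply: cderivB; first by apply: cderivM; [exact: dT2|exact: dc1].
    by apply: cderivM; [exact: dT1|exact: dc2].
  apply: (@cderiv_comp _ _ (fun w => w ^+ 2)); first exact: dc1.
  exact: cderivX.
- move=> M' fM2; have M'0 : 0 <= M'.
    by apply: (le_trans (cmod_ge0 (f 0))); apply: fM2; rewrite cmod0.
  have fM2' z : onsquare z -> cmod (f z) <= M' by move=> [_ /fM2].
  have a2' := ltW a2.
  have b1 := ctrans_bound 1 cf' M'0 fM2' a2'; have b2 := ctrans_bound 2 cf' M'0 fM2' a2'.
  have b3 := ctrans_bound 1 c1 ler01 oM a2'; have b4 := ctrans_bound 2 c1 ler01 oM a2'.
  have b5 := wind_ge a2'.
  rewrite cmodM cmodV cmodX ler_pdivrMr; last by rewrite exprn_gt0// cmod_gt0 wn0.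
  apply: (@le_trans _ _ (64 * 64 * M')).
    apply: (le_trans (ler_cmodD _ _)); rewrite cmodN !cmodM.
    have -> : 64 * 64 * M' = 16 * (M' * 2 ^+ 2) * (16 * (1 * 2 ^+ 1)) +
       16 * (M' * 2 ^+ 1) * (16 * (1 * 2 ^+ 2)) by ring.
    by apply: lerD; apply: ler_pM; rewrite ?cmod_ge0.
  have -> : 64 * 64 * M' = cauchyK * M' * (4 / 9) ^+ 2 by rewrite /cauchyK; field.
  rewrite ler_wpM2l//; first by rewrite !mulr_ge0// sqr_ge0.
  by apply: lerXn2r; rewrite ?nnegrE ?cmod_ge0.
Qed.

(* Composition with [clamp] makes a function given near the square continuous on the whole plane,
   which the integrals over its sides require. *)
Definition clamp1 (x : R) : R := (`|x + 21 / 20| - `|x - 21 / 20|) / 2.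

Lemma clamp1_id x : `|x| <= 21 / 20 -> clamp1 x = x.
Proof.
rewrite ler_norml => /andP[h1 h2]; rewrite /clamp1 ger0_norm; last lra.
by rewrite ler0_norm; [field|lra].
Qed.

Lemma clamp1_le x : `|clamp1 x| <= 21 / 20.
Proof.
rewrite /clamp1 normrM [X in _ * X]ger0_norm ?invr_ge0// ler_pdivrMr//.
apply: (le_trans (ler_dist_dist _ _)).
have -> : x + 21 / 20 - (x - 21 / 20) = 21 / 20 * 2 by field.
by rewrite ger0_norm.
Qed.

Lemma contat_clamp1 (x : R) : contat clamp1 x.
Proof.
have cn (y : R) : contat (fun z : R => `|z|) y by constructor; exact: norm_continuous.
apply: contatM; last exact: contat_cst.
apply: contatB; (apply: contat_comp; last exact: cn).
  by apply: contatD; [exact: contat_id|exact: contat_cst].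
by apply: contatB; [exact: contat_id|exact: contat_cst].
Qed.

Definition clamp z := pt (clamp1 (cre z)) (clamp1 (cim z)).

Lemma contat_clamp z : contat clamp z.
Proof.
apply: contatCC => /=; (apply: contat_comp; last exact: contat_clamp1).
  exact/contat_cre/contat_id.
exact/contat_cim/contat_id.
Qed.

Lemma clamp_id z : `|cre z| <= 21 / 20 -> `|cim z| <= 21 / 20 -> clamp z = z.
Proof. by move=> hx hy; apply: cc_eq => /=; rewrite clamp1_id. Qed.

Lemma cmod_clamp z : cmod (clamp z) < 2.
Proof.
rewrite -(@ltr_pXn2r _ 2) ?nnegrE ?cmod_ge0// sqr_cmod /=.
have q (x : R) : clamp1 x ^+ 2 <= 21 / 20 * (21 / 20).
  by rewrite -real_normK ?num_real// expr2; apply: ler_pM => //; exact: clamp1_le.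
have -> : 2 ^+ 2 = 4 :> R by rewrite expr2 -natrM.
by have := q (cre z); have := q (cim z); lra.
Qed.

Lemma holomorphic_smooth f p (r : R) : 0 < r ->
  (forall z, 0 < cmod (z - p) < r -> exists l, cderiv f z l) -> contat f p ->
  exists h1 h2, forall a, cmod (a - p) < r / 4 ->
    [/\ cderiv f a (h1 a), cderiv h1 a (h2 a) &
      forall M, (forall z, cmod (z - p) < r -> cmod (f z) <= M) ->
        cmod (h1 a) <= 2 * cauchyK * M / r].
Proof.
(* With the scale r / 2, clamped arguments, of modulus below 2, are sent into the disc of radius [r]
   around [p], and the disc of radius r / 4 corresponds to radius 1 / 2. *)
move=> r0 df cf; pose s := rc (r / 2).
have s0 : s != 0 by rewrite rc_eq0 gt_eqF// divr_gt0.
have cs : cmod s = r / 2 by rewrite cmod_rc gtr0_norm ?divr_gt0.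
pose g z := f (p + s * z); pose G z := g (clamp z).
have sp z : p + s * z - p = s * z by rewrite addrC addKr.
have dg z : z != 0 -> cmod z < 2 -> exists l, cderiv g z l.
  move=> z0 z2; have [|l dl] := df (p + s * z).
    rewrite sp cmodM cs mulr_gt0 ?cmod_gt0 ?divr_gt0//=.
    by rewrite mulrAC ltr_pdivrMr// ltr_pM2l.
  exists (l * (0 + s * 1)); apply: (cderiv_comp (f := fun z => p + s * z)) => //.
  by apply: cderivD; [exact: cderiv_cst|apply: cderivZ; exact: cderiv_id].
have cg z : cmod z < 2 -> contat g z.
  have [->|z0 z2] := eqVneq z 0; last by have [l /cderiv_contat] := dg z z0 z2.
  move=> _; apply: (contat_comp (f := fun z => p + s * z)).
    apply: contatD; first exact: contat_cst.
    by apply: contatM; [exact: contat_cst|exact: contat_id].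
  by rewrite mulr0 addr0.
have cG z : contat G z.
  by apply: contat_comp; [exact: contat_clamp|exact/cg/cmod_clamp].
have Gg z : cmod z < 21 / 20 -> G z = g z.
  move=> z2; rewrite /G clamp_id//; apply/ltW; apply: le_lt_trans z2; [exact: cre_le|exact: cim_le].
(* The margin 21 / 20 of the clamp makes [G] agree with [g] on a neighbourhood of each point of the
   closed square, so derivatives transfer even on its sides. *)
have Ggn z : `|cre z| <= 1 -> `|cim z| <= 1 -> forall w, cmod (w - z) < 1 / 20 -> G w = g w.
  move=> z1 z2 w wz; rewrite /G clamp_id//.
    have := cre_le (w - z); rewrite creD creN.
    have := lerB_dist (cre w) (cre z); lra.
  have := cim_le (w - z); rewrite cimD cimN.
  have := lerB_dist (cim w) (cim z); lra.
have [z z0 z1 z2|h1 [h2 hh]] := holomorphic_unit cG.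
  have [|l dl] := dg z z0.
    have -> : z = clamp z by rewrite clamp_id//; lra.
    exact: cmod_clamp.
  exists l; apply: (cderiv_near (d := 1 / 20) _ _ dl) => [|w wz]; first lra.
  by rewrite (Ggn z).
have pull h a l : cderiv h ((a - p) / s) l -> cderiv (fun a => h ((a - p) / s)) a (l / s).
  move=> dh; apply: (cderiv_comp (f := fun a => (a - p) / s)) => //.
  have := cderivM (cderivB (cderiv_id a) (cderiv_cst p a)) (cderiv_cst s^-1 a).
  by rewrite subr0 mul1r mulr0 addr0.
exists (fun a => h1 ((a - p) / s) / s), (fun a => h2 ((a - p) / s) / s / s) => a ar.
have a2 : cmod ((a - p) / s) < 1 / 2.
  rewrite cmodM cmodV cs ltr_pdivrMr ?divr_gt0//; lra.
have [d1 d2 d3] := hh _ a2; split.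
- have := pull _ _ _ d1.
  apply: (@cderiv_near _ _ _ _ _ (r / 4 - cmod (a - p))); first lra.
  move=> w wa; rewrite Gg; last first.
    have := ler_cmodD (w - a) (a - p); rewrite addrA subrK => k.
    rewrite cmodM cmodV cs ltr_pdivrMr ?divr_gt0//; lra.
  by rewrite /g mulrC divfK// addrC subrK.
- have := cderivM (pull _ _ _ d2) (cderiv_cst s^-1 a).
  by rewrite mulr0 addr0.
- move=> M fM; have := d3 M _; rewrite cmodM cmodV cs => k.
  rewrite ler_pdivrMr ?divr_gt0//.
  have -> : 2 * cauchyK * M / r * (r / 2) = cauchyK * M by field; rewrite gt_eqF.
  apply: k => z _; apply: fM; rewrite sp cmodM cs.
  by rewrite mulrAC ltr_pdivrMr// ltr_pM2l// cmod_clamp.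
Qed.

End CauchyTransform.

(** * Holomorphic functions *)

Section Holomorphic.
Variable R : realType.
Implicit Types (f g : CC R -> CC R) (a z w p : CC R) (r M : R).

Lemma ball_convex a b p r t : cmod (a - p) < r -> cmod (b - p) < r -> 0 <= t <= 1 ->
  cmod (a + rc t * (b - a) - p) < r.
Proof.
move=> ha hb /andP[t0 t1].
have -> : a + rc t * (b - a) - p = rc (1 - t) * (a - p) + rc t * (b - p).
  by rewrite rcB rc1; ring.
apply: (le_lt_trans (ler_cmodD _ _)); rewrite !cmodM !cmod_rc !ger0_norm ?subr_ge0//.
have [->|tn0] := eqVneq t 0; first by rewrite subr0 mul1r mul0r addr0.
have tp : 0 < t by rewrite lt_neqAle eq_sym tn0.
have h1 : (1 - t) * cmod (a - p) <= (1 - t) * r by rewrite ler_wpM2l ?subr_ge0// ltW.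
have h2 : t * cmod (b - p) < t * r by rewrite ltr_pM2l.
lra.
Qed.

Lemma ball_mean_value g g' p r M a b :
  (forall z, cmod (z - p) < r -> cderiv g z (g' z)) ->
  (forall z, cmod (z - p) < r -> cmod (g' z) <= M) ->
  cmod (a - p) < r -> cmod (b - p) < r -> cmod (g b - g a) <= M * cmod (b - a).
Proof.
move=> dg gM ha hb; apply: (@cderiv_mean_value R g g') => t t01; [apply: dg|apply: gM];
  exact: ball_convex.
Qed.

Lemma ball_gronwall g g' p r K a b :
  (forall z, cmod (z - p) < r -> cderiv g z (g' z)) ->
  (forall z, cmod (z - p) < r -> cmod (g' z) <= K * cmod (g z)) ->
  cmod (a - p) < r -> cmod (b - p) < r ->
  cmod (g b) <= expR (K * cmod (b - a)) * cmod (g a).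
Proof.
move=> dg gM ha hb; apply: (@cderiv_gronwall R g g') => t t01; [apply: dg|apply: gM];
  exact: ball_convex.
Qed.

Definition holo f p r := forall z, cmod (z - p) < r -> exists l, cderiv f z l.

Lemma holo_cderiv f p r z : holo f p r -> cmod (z - p) < r -> cderiv f z (derive1 f z).
Proof. by move=> hf /hf[l dl]; rewrite (cderiv_derive1 dl). Qed.

Lemma holo_ball f p r q s : holo f p r -> cmod (q - p) + s <= r -> holo f q s.
Proof.
move=> hf h z zq; apply: hf.
have := cmod_triangle q z p; lra.
Qed.

Lemma holo_derive1_center f p r : 0 < r -> holo f p r ->
  (exists l, cderiv (derive1 f) p l) /\
  forall M, (forall z, cmod (z - p) < r -> cmod (f z) <= M) ->
    cmod (derive1 f p) <= 2 * cauchyK R * M / r.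
Proof.
move=> r0 hf; have pp : cmod (p - p) < r by rewrite subrr cmod0.
have [|h1 [h2 h]] := @holomorphic_smooth R f p r r0 _ (cderiv_contat (holo_cderiv hf pp)).
  by move=> z /andP[_ /hf].
have r4 : 0 < r / 4 by rewrite divr_gt0.
have [|d1 d2 d3] := h p; first by rewrite subrr cmod0.
split; last by move=> M /d3; rewrite (cderiv_derive1 d1).
exists (h2 p); apply: cderiv_near d2; [exact: r4|].
by move=> w /h[dw _ _]; rewrite (cderiv_derive1 dw).
Qed.

Lemma holo_derive1 f p r : holo f p r -> holo (derive1 f) p r.
Proof.
move=> hf z zp; have [||//] := @holo_derive1_center f z (r - cmod (z - p)).
  by rewrite subr_gt0.
by apply: holo_ball hf _; rewrite subrKC.
Qed.

Lemma holo_removable f p r : 0 < r -> (forall z, 0 < cmod (z - p) < r -> exists l, cderiv f z l) ->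
  contat f p -> holo f p r.
Proof.
move=> r0 df cf z zp; have [zz|zz] := eqVneq z p.
  have [h1 [h2 h]] := holomorphic_smooth r0 df cf.
  have [|d1 _ _] := h z; first by rewrite zz subrr cmod0 divr_gt0.
  by exists (h1 z).
by apply: df; rewrite zp cmod_gt0 subr_eq0 zz.
Qed.

(* Dividing by [z] costs a factor [C / r] in the sup norm, uniformly in the function, so a
   function vanishing to infinite order is [O ((C |z| / r) ^ k)] for every [k]. *)
Lemma accumulating_zeros0 f r M : 0 < r -> holo f 0 r ->
  (forall z, cmod z < r -> cmod (f z) <= M) ->
  (forall e, 0 < e -> exists z, [/\ z != 0, cmod z < e & f z = 0]) ->
  exists2 s, 0 < s & forall z, cmod z < s -> f z = 0.
Proof.
(* Division by [z] costs 8 / r where |z| >= r / 8. Closer to 0 the quotient is controlled by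
   [derive1 g], for which the Cauchy estimate on radius r / 2 gives 4 * cauchyK / r. *)
move=> r0; pose C : R := 8 + 8 * cauchyK R.
have K0 : 0 <= cauchyK R by rewrite /cauchyK !mulr_ge0// sqr_ge0.
have C8 : 8 <= C by rewrite lerDl mulr_ge0.
have div g N : holo g 0 r -> (forall z, cmod z < r -> cmod (g z) <= N) ->
  (forall e, 0 < e -> exists z, [/\ z != 0, cmod z < e & g z = 0]) ->
  exists k : CC R -> CC R, [/\ holo k 0 r, (forall z, cmod z < r -> cmod (k z) <= C / r * N),
    (forall e, 0 < e -> exists z, [/\ z != 0, cmod z < e & k z = 0]) &
    forall z, g z = z * k z].
  move=> hg gN zg; have N0 : 0 <= N.
    by apply: (le_trans (cmod_ge0 (g 0))); apply: gN; rewrite cmod0.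
  have [|l dl] := hg 0; first by rewrite subrr cmod0.
  have g0 : g 0 = 0.
    apply/eqP; rewrite -cmod_eq0 eq_le cmod_ge0 andbT; apply/ler_addgt0Pl => e e0.
    have [d d0 hd] := (contatCCP _ _).1 (cderiv_contat dl) _ e0.
    have [z [_ zd gz]] := zg d d0; have := hd z; rewrite subr0 gz sub0r cmodN.
    by move=> /(_ zd) /ltW; rewrite addr0.
  case: dl => k [ck kl gk]; exists k.
  have gE z : g z = z * k z by rewrite gk g0 add0r subr0 mulrC.
  have hk : holo k 0 r.
    apply: holo_removable => // z; rewrite subr0 cmod_gt0 => /andP[z0 zr].
    have [|l' dl'] := hg z; first by rewrite subr0.
    eexists; apply: (cderiv_near (d := cmod z) _ _ (cderiv_div z0 dl' (cderiv_id z))).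
      by rewrite cmod_gt0.
    move=> w wz; have w0 : w != 0 by apply: contraTneq wz => ->; rewrite sub0r cmodN ltxx.
    by rewrite gE mulrC mulKf.
  split => //; last first.
    move=> e /zg[z [z0 ze gz]]; exists z; split => //.
    by move: gz; rewrite gE => /eqP; rewrite mulf_eq0 (negPf z0) => /eqP.
  move=> z zr; have [z8|z8] := leP (r / 8) (cmod z).
    have z0 : 0 < cmod z by apply: lt_le_trans z8; rewrite divr_gt0.
    have -> : cmod (k z) = cmod (g z) / cmod z by rewrite gE cmodM mulrAC mulfV ?mul1r ?gt_eqF.
    rewrite ler_pdivrMr//; apply: (le_trans (gN _ zr)).
    rewrite mulrAC -[X in X <= _]mul1r ler_wpM2r// mulrAC ler_pdivlMr// mul1r.
    apply: (@le_trans _ _ (8 * cmod z)); first lra.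
    by rewrite ler_wpM2r ?cmod_ge0.
  have gd y : cmod (y - 0) < r / 4 -> cderiv g y (derive1 g y).
    by rewrite subr0 => y4; apply: (holo_cderiv hg); rewrite subr0; lra.
  have gb y : cmod (y - 0) < r / 4 -> cmod (derive1 g y) <= C / r * N.
    rewrite subr0 => y4.
    have [||_ /(_ N)] := @holo_derive1_center g y (r / 2); first by rewrite divr_gt0.
      by apply: holo_ball hg _; rewrite subr0; lra.
    move=> H; apply: (le_trans (H _)).
      by move=> w wy; apply: gN; have := cmod_triangle y w 0; rewrite !subr0; lra.
    have -> : C / r * N = 2 * cauchyK R * N / (r / 2) + (8 + 4 * cauchyK R) * N / r.
      by rewrite /C; field; rewrite gt_eqF.
    by rewrite lerDl divr_ge0 ?(ltW r0)// mulr_ge0// addr_ge0// mulr_ge0.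
  have [->|z0] := eqVneq z 0.
    have [|l' dl'] := hg 0; first by rewrite subrr cmod0.
    have -> : k 0 = derive1 g 0.
      by apply/esym/cderiv_derive1; exists k; split => // w; rewrite gE g0 add0r subr0 mulrC.
    by apply: gb; rewrite subrr cmod0 divr_gt0.
  have := @ball_mean_value g (derive1 g) 0 (r / 4) (C / r * N) 0 z gd gb.
  rewrite subrr cmod0 subr0 divr_gt0// => /(_ isT) H.
  have {H} : cmod (g z - g 0) <= C / r * N * cmod z by apply: H; lra.
  by rewrite g0 subr0 gE cmodM [X in X <= _]mulrC ler_pM2r ?cmod_gt0.
have pow n : forall g N, holo g 0 r -> (forall z, cmod z < r -> cmod (g z) <= N) ->
  (forall e, 0 < e -> exists z, [/\ z != 0, cmod z < e & g z = 0]) ->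
  forall z, cmod z < r -> cmod (g z) <= N * (C / r * cmod z) ^+ n.
  elim: n => [|n IH] g N hg gN zg z zr; first by rewrite expr0 mulr1; exact: gN.
  have [k [hk kN zk gk]] := div g N hg gN zg.
  rewrite gk cmodM; apply: (le_trans (ler_wpM2l (cmod_ge0 z) (IH _ _ hk kN zk z zr))).
  by rewrite exprS le_eqVlt; apply/orP; left; apply/eqP; ring.
move=> hf fM zf; have C0 : 0 < C by apply: lt_le_trans C8.
exists (r / (2 * C)); first by rewrite divr_gt0// mulr_gt0.
move=> z zs; apply/eqP; rewrite -cmod_eq0 eq_le cmod_ge0 andbT; apply/ler_addgt0Pl => e e0.
rewrite addr0; have M0 : 0 <= M.
  by apply: (le_trans (cmod_ge0 (f 0))); apply: fM; rewrite cmod0.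
have zr : cmod z < r.
  apply: (lt_le_trans zs); rewrite ler_pdivrMr ?mulr_gt0// -[X in X <= _]mulr1.
  by rewrite ler_pM2l//; lra.
have q2 : C / r * cmod z <= 1 / 2.
  move: zs; rewrite ltr_pdivlMr ?mulr_gt0// => zs.
  rewrite mulrAC ler_pdivrMr//; lra.
pose n := Num.bound (M / e).
apply: (le_trans (pow n f M hf fM zf z zr)).
apply: (@le_trans _ _ (M * (1 / 2) ^+ n)).
  by rewrite ler_wpM2l//; apply: lerXn2r; rewrite ?nnegrE// mulr_ge0 ?cmod_ge0// divr_ge0 ?ltW.
rewrite expr_div_n expr1n mul1r ler_pdivrMr ?exprn_gt0// mulrC -ler_pdivrMr//.
apply: (@le_trans _ _ n%:R); first by apply/ltW/archi_boundP; exact: divr_ge0 (ltW e0).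
by rewrite -natrX ler_nat ltnW// ltn_expl.
Qed.

(** [g] minus the linear map with slope [m] is Lipschitz with constant |m| / 2, so [g] keeps at
    least half of the expansion of that map. *)
Lemma ball_expanding g g' c r (m : CC R) a b :
  (forall z, cmod (z - c) < r -> cderiv g z (g' z)) ->
  (forall z, cmod (z - c) < r -> cmod (g' z - m) <= cmod m / 2) ->
  cmod (a - c) < r -> cmod (b - c) < r ->
  cmod m / 2 * cmod (b - a) <= cmod (g b - g a).
Proof.
move=> dg gm ha hb.
have dgm z : cmod (z - c) < r -> cderiv (fun y => g y - m * y) z (g' z - m).
  move=> zc; apply: cderivB; first exact: dg.
  by have := cderivZ m (cderiv_id z); rewrite mulr1.
have := ball_mean_value dgm gm ha hb.
have -> : g b - m * b - (g a - m * a) = (g b - g a) - m * (b - a) by ring.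
have := cmod_sub_ge (m * (b - a)) (m * (b - a) - (g b - g a)).
rewrite subKr [cmod (_ * _ - _)]cmodB cmodM; lra.
Qed.

(* The minimum of [|g - w|] on the square is interior, and there a Newton step would decrease it. *)
Lemma local_surjection g g' c r (m w : CC R) : 0 < r -> m != 0 ->
  (forall z, cmod (z - c) < 2 * r -> cderiv g z (g' z)) ->
  (forall z, cmod (z - c) < 2 * r -> cmod (g' z - m) <= cmod m / 2) ->
  cmod (w - g c) < cmod m * r / 4 ->
  exists2 z, cmod (z - c) < 2 * r & g z = w.
Proof.
move=> r0 m0 dg gm wc; have mp : 0 < cmod m by rewrite cmod_gt0.
pose A := [set z : CC R | cre c - r <= cre z <= cre c + r /\ cim c - r <= cim z <= cim c + r].
have Ar z : A z -> cmod (z - c) < 2 * r.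
  move=> [hx hy]; rewrite -(@ltr_pXn2r _ 2) ?nnegrE ?cmod_ge0 ?mulr_ge0 ?ltW// sqr_cmod.
  rewrite creD creN cimD cimN exprMn.
  have k (x : R) : - r <= x -> x <= r -> x ^+ 2 <= r ^+ 2.
    move=> k1 k2; rewrite -[x ^+ 2]real_normK ?num_real//; apply: lerXn2r; rewrite ?nnegrE ?(ltW r0)//.
    by rewrite ler_norml k1.
  have k1 := k (cre z - cre c); have k2 := k (cim z - cim c).
  have /k1{k1} k1 : - r <= cre z - cre c by lra.
  have {k1} k1 : (cre z - cre c) ^+ 2 <= r ^+ 2 by apply: k1; lra.
  have /k2{k2} k2 : - r <= cim z - cim c by lra.
  have {k2} k2 : (cim z - cim c) ^+ 2 <= r ^+ 2 by apply: k2; lra.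
  have r2 : 0 < r ^+ 2 by rewrite exprn_gt0.
  have -> : 2 ^+ 2 = 4 :> R by rewrite expr2 -natrM.
  lra.
have cA : A c by split; lra.
have cg z : A z -> contat (fun z => - cmod (g z - w)) z.
  move=> /Ar /dg /cderiv_contat h; apply: contatN; apply: contat_cmod.
  by apply: contatB => //; exact: contat_cst.
have [|z Az zmin] := @square_EVT_max R A _ _ _ _ _ _ erefl cg; first by exists c.
exists z; first exact: Ar.
have {}zmin y : A y -> cmod (g z - w) <= cmod (g y - w) by move=> /zmin; rewrite lerN2.
have cc2 : cmod (c - c) < 2 * r by rewrite subrr cmod0 mulr_gt0.
have lin y : A y -> cmod m / 2 * cmod (y - c) <= cmod (g y - g c).
  by move=> Ay; apply: (ball_expanding dg gm) => //; exact: Ar.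
(* If |z - c| >= r, expansion gives |g z - g c| >= |m| r / 2, whereas minimality against [c] gives
   |g z - g c| <= 2 |w - g c| < |m| r / 2. *)
have zr : cmod (z - c) < r.
  rewrite ltNge; apply/negP => rz; have := lin z Az; have := zmin c cA.
  have := cmod_triangle w (g z) (g c); rewrite (cmodB (g c)).
  have : cmod m / 2 * r <= cmod m / 2 * cmod (z - c) by rewrite ler_pM2l// divr_gt0.
  lra.
apply/eqP; rewrite -subr_eq0; apply/negPn/negP => gz0.
pose d := g' z; have dm : cmod m / 2 <= cmod d.
  have := gm z (Ar _ Az); have := cmod_sub_ge m (m - d).
  by rewrite subKr (cmodB m); rewrite -/d; lra.
have d0 : d != 0 by rewrite -cmod_gt0; apply: lt_le_trans dm; rewrite divr_gt0.
have dp : 0 < cmod d by rewrite cmod_gt0.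
have [e e0 he] := (cderivP _ _ _).1 (dg z (Ar _ Az)) _ (divr_gt0 dp (ltr0Sn R 1)).
pose v := (w - g z) / d; have v0 : 0 < cmod v.
  by rewrite cmod_gt0 mulf_neq0 ?invr_eq0// -opprB oppr_eq0.
(* A fraction [t] of the Newton step [v], short enough to stay in the square and in the range of the
   linearization. The error is at most half of the gain, so the distance to [w] drops by the factor
   1 - t / 2. *)
pose t := Num.min (1 / 2) (Num.min (e / 2 / cmod v) ((r - cmod (z - c)) / cmod v)).
have t0 : 0 < t by rewrite !lt_min !divr_gt0// subr_gt0.
have t1 : t <= 1 / 2 by rewrite ge_min lexx.
have te : t <= e / 2 / cmod v by rewrite !ge_min lexx orbT.
have tr : t <= (r - cmod (z - c)) / cmod v by rewrite !ge_min lexx !orbT.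
move: te tr; rewrite !ler_pdivlMr// => te tr.
pose y := z + rc t * v; have yz : y - z = rc t * v by rewrite /y addrC addKr.
have cyz : cmod (y - z) = t * cmod v by rewrite yz cmodM cmod_rc gtr0_norm.
have Ay : A y.
  have yc : cmod (y - c) <= r by have := cmod_triangle z y c; lra.
  have := le_trans (cre_le _) yc; have := le_trans (cim_le _) yc.
  by rewrite creD creN cimD cimN !ler_norml => /andP[? ?] /andP[? ?]; split; lra.
have := zmin y Ay; rewrite leNgt => /negP; apply.
have {he} := he y; rewrite cyz => /(_ ltac:(lra)).
rewrite yz -/d; have -> : d * (rc t * v) = rc t * (w - g z) by rewrite /v; field.
have -> : g y - w = (g y - g z - rc t * (w - g z)) + rc (1 - t) * (g z - w).
  by rewrite rcB rc1; ring.
move=> h; apply: (le_lt_trans (ler_cmodD _ _)).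
rewrite [cmod (rc _ * _)]cmodM cmod_rc ger0_norm; last lra.
have vE : cmod d * cmod v = cmod (g z - w).
  by rewrite /v cmodM cmodV mulrCA mulfV ?mulr1 ?gt_eqF// cmodB.
have : cmod d / 2 * (t * cmod v) = t / 2 * cmod (g z - w) by rewrite -vE; ring.
have : 0 < t * cmod (g z - w) by rewrite mulr_gt0// cmod_gt0.
lra.
Qed.

(** [G] is only a left inverse, with no continuity assumed. Local surjectivity writes every point
    near [g c] as [g z] with [z] near [c], and expansion turns errors measured in [z - c] into
    errors measured in [g z - g c]. *)
Lemma cderiv_inverse g g' G c r : 0 < r ->
  (forall z, cmod (z - c) < r -> cderiv g z (g' z)) -> contat g' c -> g' c != 0 ->
  (forall z, cmod (z - c) < r -> G (g z) = z) -> cderiv G (g c) (g' c)^-1.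
Proof.
move=> r0 dg cg' m0 Gg; set m := g' c in m0 *; have mp : 0 < cmod m by rewrite cmod_gt0.
have [d d0 hd] := (contatCCP _ _).1 cg' _ (divr_gt0 mp (ltr0Sn R 1)).
pose s := Num.min r d.
have s0 : 0 < s by rewrite lt_min r0.
have sr : s <= r by rewrite ge_min lexx.
have sd : s <= d by rewrite ge_min lexx orbT.
have onto e w : 0 < e -> e <= s -> cmod (w - g c) < cmod m * e / 8 ->
    exists2 z, cmod (z - c) < e & g z = w.
  move=> e0 es we; have e2 : 2 * (e / 2) = e by field.
  have [|||||z] := @local_surjection g g' c (e / 2) m w; rewrite ?e2.
  - by rewrite divr_gt0.
  - exact: m0.
  - by move=> z zc; apply: dg; lra.
  - by move=> z zc; apply/ltW/hd; lra.
  - lra.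
  by move=> zc gz; exists z.
apply/cderivP => e e0.
have cs : cmod (c - c) < s by rewrite subrr cmod0.
have cr : cmod (c - c) < r by rewrite subrr cmod0.
have em : 0 < e * (cmod m ^+ 2 / 2) by rewrite mulr_gt0// divr_gt0// exprn_gt0.
have [t t0 ht] := (cderivP _ _ _).1 (dg c cr) _ em.
pose u := Num.min s t; have u0 : 0 < u by rewrite lt_min s0.
have us : u <= s by rewrite ge_min lexx.
have ut : u <= t by rewrite ge_min lexx orbT.
exists (cmod m * u / 8); first by rewrite divr_gt0// mulr_gt0.
move=> w /(onto u w u0 us)[z zu <-]; rewrite !Gg//; last lra.
have zs : cmod (z - c) < s by lra.
have lin : cmod m / 2 * cmod (z - c) <= cmod (g z - g c).
  apply: (@ball_expanding g g' c s) => //.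
    by move=> y yc; apply: dg; lra.
  by move=> y yc; apply/ltW/hd; lra.
have {ht} := ht z _; rewrite -/m => /(_ ltac:(lra)) hz.
have -> : z - c - m^-1 * (g z - g c) = - m^-1 * (g z - g c - m * (z - c)) by field.
rewrite cmodM cmodN cmodV mulrC ler_pdivrMr//.
apply: (le_trans hz).
have := ler_wpM2l (mulr_ge0 (ltW e0) (ltW mp)) lin.
have -> : e * cmod m * (cmod m / 2 * cmod (z - c)) = e * (cmod m ^+ 2 / 2) * cmod (z - c) by ring.
by rewrite [e * cmod m * _]mulrAC.
Qed.

(** * The complex exponential *)

Definition cexp z : CC R := cplx (expR (cre z) * cos (cim z), expR (cre z) * sin (cim z)).

Lemma cexpD z w : cexp (z + w) = cexp z * cexp w.
Proof.
by apply: cc_eq; rewrite ?creM ?cimM /= creD cimD expRD ?cosD ?sinD; ring.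
Qed.

Lemma cexp0 : cexp 0 = 1.
Proof. by apply: cc_eq; rewrite /= expR0 ?cos0 ?sin0 mul1r. Qed.

Lemma cexp_2pi : cexp (pt 0 (2 * pi)) = 1.
Proof.
apply: cc_eq; rewrite /= expR0 mul1r.
  by rewrite mulr_natl cos2pi.
by rewrite mulr_natl sin2pi.
Qed.

Lemma cmod_cexp_le z : cmod (cexp z) <= expR (cmod z).
Proof.
have -> : cexp z = rc (expR (cre z)) * cplx (cos (cim z), sin (cim z)).
  by apply: cc_eq; rewrite ?creM ?cimM /=; ring.
rewrite cmodM cmod_rc ger0_norm ?expR_ge0// cmodE /= cos2Dsin2 sqrtr1 mulr1.
by rewrite ler_expR; apply: le_trans (ler_norm _) (cre_le z).
Qed.

Lemma cderiv_cexp0 : cderiv cexp 0 1.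
Proof.
have [a [aE /Contat ca a1]] := (is_derive1_caratheodory _ _ _).1 (is_derive_expR (0 : R)).
have [b [bE /Contat cb b1]] := (is_derive1_caratheodory _ _ _).1 (is_derive_cos (0 : R)).
have [s [sE /Contat cs s1]] := (is_derive1_caratheodory _ _ _).1 (is_derive_sin (0 : R)).
rewrite expR0 in a1 aE; rewrite sin0 oppr0 in b1; rewrite cos0 in s1 bE; rewrite sin0 in sE.
have cn (u : CC R -> R) : contat u 0 -> contat (fun z => `|u z|) 0.
  by move=> cu; apply: (contat_comp cu); constructor; exact: norm_continuous.
have cr (u : R -> R) : contat u 0 -> contat (fun z => u (cre z)) (0 : CC R).
  by move=> cu; apply: (contat_comp (f := @cre R)) => //; exact/contat_cre/contat_id.
have ci (u : R -> R) : contat u 0 -> contat (fun z => u (cim z)) (0 : CC R).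
  by move=> cu; apply: (contat_comp (f := @cim R)) => //; exact/contat_cim/contat_id.
have ce : contat (fun z => expR (cre z)) (0 : CC R).
  by apply: cr; constructor; exact: continuous_expR.
(* [a], [b] and [s] are the Carathéodory slopes of exp, cos and sin at 0. [T] collects the relative
   errors of the real and imaginary parts of [cexp w - 1 - w], and vanishes at 0. *)
pose T (z : CC R) : R := `|a (cre z) - 1| + `|expR (cre z) * b (cim z)|
  + `|expR (cre z) * s (cim z) - 1|.
have cT : contat T 0.
  apply: contatD; [apply: contatD|]; apply: cn.
  - by apply: contatB; [exact: cr|exact: contat_cst].
  - by apply: contatM => //; exact: ci.
  - apply: contatB; last exact: contat_cst.
    by apply: contatM => //; exact: ci.
have T0 : T 0 = 0 by rewrite /T /= a1 b1 s1 expR0 mulr0 mul1r subrr normr0 !addr0.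
apply/cderivP => e e0; have [d d0 hd] := (contatCRP _ _).1 cT e e0.
exists d => // w /hd; rewrite T0 subr0 => Tw.
rewrite subr0 cexp0 mul1r; set x := cre w; set y := cim w.
have Ex : expR x = 1 + a x * x by have := aE x; rewrite subr0 => <-; rewrite addrC subrK.
have Ey : cos y = 1 + b y * y by have := bE y; rewrite subr0 => <-; rewrite addrC subrK.
have Es : sin y = s y * y by have := sE y; rewrite !subr0.
have -> : cexp w - 1 - w =
    cplx (expR x * b y * y + (a x - 1) * x, (expR x * s y - 1) * y).
  apply: cc_eq; rewrite !(creD, cimD, creN, cimN) /= -/x -/y ?Ey ?Es; last by ring.
  by rewrite mulrDr mulr1 {1}Ex; ring.
apply: (le_trans (cmod_le_sum _)) => /=.
have xw := cre_le w; have yw := cim_le w; rewrite -/x -/y in xw yw.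
apply: (@le_trans _ _ (T w * cmod w)); last first.
  by rewrite ler_wpM2r ?cmod_ge0// ltW//; apply: le_lt_trans Tw; exact: ler_norm.
rewrite /T -/x -/y [X in _ <= X]mulrDl [X in _ <= X + _]mulrDl; apply: lerD.
  rewrite addrC; apply: (le_trans (ler_normD _ _)).
  by apply: lerD; rewrite normrM ler_wpM2l.
by rewrite normrM ler_wpM2l.
Qed.

Lemma cderiv_cexp z : cderiv cexp z (cexp z).
Proof.
have d0 : cderiv cexp (z - z) 1 by rewrite subrr; exact: cderiv_cexp0.
have := cderiv_comp (f := fun w => w - z) (cderivB (cderiv_id z) (cderiv_cst z z)) d0.
move=> /(cderivZ (cexp z)); rewrite subr0 !mulr1.
by under eq_fun do rewrite -cexpD subrKC.
Qed.

End Holomorphic.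

(** * Distortion of injective holomorphic functions *)

Section Distortion.
Variable R : realType.
Implicit Types (g : CC R -> CC R) (z w p : CC R) (r : R).

(* [exp - 1] vanishes at [0] and at [2 pi i], and the second zero survives the perturbation. *)
Lemma almost_exp_not_injective : exists2 e0 : R, 0 < e0 &
  forall G G' d : CC R -> CC R,
  (forall z, cmod z < 16 -> cderiv G z (G' z)) ->
  (forall z, cmod z < 16 -> cderiv G' z ((1 + d z) * G' z)) ->
  (forall z, cmod z < 16 -> cmod (d z) <= e0) -> G 0 = 0 -> G' 0 = 1 ->
  exists z, [/\ z != 0, cmod z < 16 & G z = 0].
Proof.
pose c : CC R := pt 0 (2 * pi).
have c1 : cexp c = 1 by exact: cexp_2pi.
have pi2 := pi_ge2 R; have [/andP[_ pi4] _] := pihalf_02_cos_pihalf R.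
have cc : cmod c = 2 * pi.
  by rewrite cmodE /= expr0n add0r sqrtr_sqr ger0_norm// mulr_ge0// pi_ge0.
have e4 : 0 < 1 / 4 :> R by rewrite divr_gt0.
have [t t0 ht] := (contatCCP _ _).1 (cderiv_contat (cderiv_cexp c)) _ e4.
pose rho := Num.min (t / 2) (1 / 4).
have r0 : 0 < rho by rewrite lt_min !divr_gt0.
have rt : rho <= t / 2 by rewrite ge_min lexx.
have r4 : rho <= 1 / 4 by rewrite ge_min lexx orbT.
pose A := expR (16 : R); have A0 : 0 < A by exact: expR_gt0.
have A1 : 1 <= A by rewrite -expR0 ler_expR.
(* [A] bounds both [q] and the exponential on the disc of radius 16. The constant gives |G c| <= rho
   / 8, below the threshold rho / 4 of [local_surjection], and keeps [G'] within 1 / 2 of 1 near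
   [c]. *)
pose e0 := rho / (16 * 16 * 8 * A ^+ 2).
have AA : 0 < 16 * 16 * 8 * A ^+ 2 by rewrite !mulr_gt0// exprn_gt0.
have e00 : 0 < e0 by rewrite divr_gt0.
have e0E : 16 * 16 * 8 * A ^+ 2 * e0 = rho by rewrite mulrCA mulfV ?mulr1// gt_eqF.
have e01 : e0 <= 1.
  rewrite ler_pdivrMr// mul1r; apply: (le_trans r4).
  by have := exprn_ege1 2 A1; lra.
clearbody e0.
exists e0 => // G G' d dG dG' hd G0 G'0.
have in16 z : (cmod (z - 0) < 16) = (cmod z < 16) by rewrite subr0.
have z16 : cmod (0 - 0 : CC R) < 16 by rewrite subrr cmod0.
(* The equation for [G'] becomes q' = d q: Gronwall bounds [q], the mean value inequality then puts
   it close to 1, and integrating once more compares [G] with [cexp - 1]. *)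
pose q z := G' z * cexp (- z).
have dq z : cmod (z - 0) < 16 -> cderiv q z (d z * q z).
  rewrite in16 => hz.
  have dE : cderiv (fun y => cexp (- y)) z (cexp (- z) * - 1).
    exact: (cderiv_comp (f := fun y => - y) (cderivN (cderiv_id z)) (cderiv_cexp _)).
  by have := cderivM (dG' z hz) dE; congr cderiv; rewrite /q; ring.
have q0 : q 0 = 1 by rewrite /q G'0 oppr0 cexp0 mulr1.
have qb z : cmod (z - 0) < 16 -> cmod (q z) <= A.
  move=> hz; have := @ball_gronwall R q (fun z => d z * q z) 0 16 e0 0 z dq _ z16 hz.
  rewrite q0 cmod1 mulr1 subr0 => H; apply: (le_trans (H _)).
    by move=> y hy; rewrite cmodM ler_wpM2r ?cmod_ge0// hd// -in16.
  rewrite ler_expR; rewrite subr0 in hz.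
  have := ler_wpM2r (cmod_ge0 z) e01; rewrite mul1r => /le_trans; apply; exact: ltW.
have q1 z : cmod (z - 0) < 16 -> cmod (q z - 1) <= 16 * (e0 * A).
  move=> hz; have := @ball_mean_value R q (fun z => d z * q z) 0 16 (e0 * A) 0 z dq _ z16 hz.
  rewrite q0 subr0 => H; apply: (le_trans (H _)).
    by move=> y hy; rewrite cmodM; apply: ler_pM; rewrite ?cmod_ge0 ?qb// hd// -in16.
  rewrite mulrC ler_wpM2r ?mulr_ge0 ?(ltW e00) ?(ltW A0)//.
  by move: hz; rewrite subr0 => /ltW.
have G'E z : cmod (z - 0) < 16 -> cmod (G' z - cexp z) <= 16 * (e0 * A) * A.
  move=> hz; have -> : G' z - cexp z = (q z - 1) * cexp z.
    by rewrite mulrBl mul1r /q -mulrA -cexpD addNr cexp0 mulr1.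
  rewrite cmodM; apply: ler_pM; rewrite ?cmod_ge0 ?q1//.
  apply: (le_trans (cmod_cexp_le _)); rewrite ler_expR.
  by move: hz; rewrite subr0 => /ltW.
have Gc : cmod (G c) <= 16 * (16 * (e0 * A) * A).
  have hc : cmod (c - 0) < 16 by rewrite subr0 cc; lra.
  have := @ball_mean_value R (fun z => G z - cexp z) (fun z => G' z - cexp z) 0 16 _ 0 c _ G'E z16 hc.
  rewrite c1 G0 cexp0 subr0.
  have -> : G c - 1 - (0 - 1) = G c by ring.
  move=> H; apply: (le_trans (H _)).
    by move=> z; rewrite in16 => hz; apply: cderivB; [exact: dG|exact: cderiv_cexp].
  rewrite [X in _ <= X]mulrC; apply: ler_wpM2l; last by rewrite cc; lra.
  by apply: mulr_ge0 (ltW A0); apply: mulr_ge0 => //; exact: mulr_ge0 (ltW e00) (ltW A0).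
have b16 z : cmod (z - c) < 2 * rho -> cmod z < 16.
  by move=> hz; have := ler_cmodD (z - c) c; rewrite subrK; lra.
have [|z zc|z zc||z zc Gz] := @local_surjection R G G' c rho 1 0 r0.
- by rewrite oner_neq0.
- by apply: dG; exact: b16.
- rewrite cmod1; have h1 := G'E z; rewrite in16 in h1; have {}h1 := h1 (b16 z zc).
  have h2 : cmod (cexp z - cexp c) < 1 / 4 by apply: ht; lra.
  rewrite c1 in h2; have := cmod_triangle (cexp z) (G' z) 1.
  have h3 : 8 * (16 * (e0 * A) * A) <= rho.
    rewrite -e0E -subr_ge0.
    have -> : 16 * 16 * 8 * A ^+ 2 * e0 - 8 * (16 * (e0 * A) * A) = 16 * 15 * 8 * A ^+ 2 * e0 by ring.
    by rewrite !mulr_ge0 ?sqr_ge0// ltW.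
  lra.
- rewrite sub0r cmodN cmod1 mul1r; apply: (le_lt_trans Gc).
  have -> : 16 * (16 * (e0 * A) * A) = rho / 8 by rewrite -e0E; field.
  lra.
exists z; split => //; last exact: b16.
apply/eqP => z0; move: zc; rewrite z0 sub0r cmodN cc; lra.
Qed.

(* Point picking: near a well-chosen point the function is almost at its maximum on a disc
   that is large at the scale [1 / cmod (P b)]. *)
Lemma point_picking (P : CC R -> CC R) p r L : 0 < r -> 0 < L ->
  (forall z, cmod (z - p) < r -> contat P z) -> L < cmod (P p) * r ->
  exists b s, [/\ 0 < s, cmod (b - p) + s < r, L / 4 < cmod (P b) * s &
    forall z, cmod (z - b) < s -> cmod (P z) <= 2 * cmod (P b)].
Proof.
move=> r0 L0 cP big; pose h := r / 2.
pose A := [set z : CC R | cre p - h <= cre z <= cre p + h /\ cim p - h <= cim z <= cim p + h].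
have Ar z : A z -> cmod (z - p) < r.
  move=> [/andP[x1 x2] /andP[y1 y2]].
  rewrite -(@ltr_pXn2r _ 2) ?nnegrE ?cmod_ge0 ?ltW// sqr_cmod creD creN cimD cimN.
  have k (x : R) : - h <= x -> x <= h -> x ^+ 2 <= r ^+ 2 / 4.
    move=> k1 k2; have -> : r ^+ 2 / 4 = h ^+ 2 by rewrite /h; field.
    rewrite -[x ^+ 2]real_normK ?num_real//; apply: lerXn2r; rewrite ?nnegrE ?divr_ge0 ?(ltW r0)//.
    by rewrite ler_norml k1.
  have k1 : (cre z - cre p) ^+ 2 <= r ^+ 2 / 4 by apply: k; lra.
  have k2 : (cim z - cim p) ^+ 2 <= r ^+ 2 / 4 by apply: k; lra.
  have : 0 < r ^+ 2 by rewrite exprn_gt0.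
  lra.
have diskA z : cmod (z - p) <= h -> A z.
  move=> hz; have := le_trans (cre_le _) hz; have := le_trans (cim_le _) hz.
  by rewrite creD creN cimD cimN !ler_norml => /andP[? ?] /andP[? ?]; split; lra.
have h0 : 0 < h by rewrite divr_gt0.
have pA : A p by apply: diskA; rewrite subrr cmod0 ltW.
(* The weight forces the maximum inside the disc of radius [h]. With [s] half of the distance left,
   the weight is still at least [s] on the disc of radius [s] around [b], whence the factor 2. *)
pose psi (z : CC R) : R := (h - cmod (z - p)) * cmod (P z).
have cpsi z : A z -> contat psi z.
  move=> Az; apply: contatM; last by apply: contat_cmod; apply: cP; exact: Ar.
  apply: contatB; first exact: contat_cst.
  by apply: contat_cmod; apply: contatB; [exact: contat_id|exact: contat_cst].
have [|b Ab bmax] := @square_EVT_max R A _ _ _ _ psi _ erefl cpsi; first by exists p.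
have psib : L / 2 < psi b.
  apply: lt_le_trans (bmax p pA); rewrite /psi subrr cmod0 subr0 /h.
  by move: big; rewrite mulrC; lra.
have Pb : 0 < cmod (P b).
  rewrite lt_neqAle cmod_ge0 andbT; apply/eqP => E; move: psib.
  by rewrite /psi -E mulr0; lra.
pose s := (h - cmod (b - p)) / 2.
have sb : 2 * s = h - cmod (b - p) by rewrite /s; field.
have psE : psi b = 2 * s * cmod (P b) by rewrite sb.
have s0 : 0 < s.
  have : 0 < 2 * s * cmod (P b) by rewrite -psE; lra.
  by rewrite pmulr_lgt0// pmulr_rgt0.
have hr : h < r by rewrite /h; lra.
exists b, s; split => //.
- lra.
- rewrite psE in psib; lra.
- move=> z zb; have zp := cmod_triangle b z p.
  have Az : A z by apply: diskA; lra.
  have := bmax z Az; rewrite psE.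
  have : s * cmod (P z) <= psi z by rewrite ler_wpM2r ?cmod_ge0//; lra.
  move=> k1 k2; rewrite -(ler_pM2l s0); lra.
Qed.

(** If P = g'' / g' were too large at [p], then at the picked point [b], with k = P b, the rescaled
    function z -> g (b + z / k) would satisfy G'' = (1 + d) G' with small [d] on radius 16, because
    the Cauchy estimate makes [P] nearly constant at that scale. The second zero of [G] contradicts
    injectivity. *)
Lemma koebe_distortion : exists2 L : R, 0 < L & forall g p r, 0 < r -> holo g p r ->
  (forall z, cmod (z - p) < r -> derive1 g z != 0) ->
  (forall z w, cmod (z - p) < r -> cmod (w - p) < r -> g z = g w -> z = w) ->
  cmod (derive1 (derive1 g) p) <= L / r * cmod (derive1 g p).
Proof.
have [e0 e00 noinj] := almost_exp_not_injective.
pose K := cauchyK R.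
have K0 : 0 <= K by rewrite /K /cauchyK !mulr_ge0// sqr_ge0.
(* Since mu * s > L / 4, the first summand gives 16 / mu < s / 2, so the rescaled disc fits. The
   second makes the oscillation 8 * K * 16 / (mu * s) of [P / k] at most [e0]. *)
pose L := 4 * 32 + 16 * 32 * K / e0.
have L128 : 4 * 32 <= L.
  by rewrite lerDl; apply: divr_ge0 (ltW e00); apply: mulr_ge0 K0; rewrite mulr_ge0.
have L0 : 0 < L by apply: lt_le_trans L128; rewrite mulr_gt0.
have LK : 16 * 32 * K <= L * e0.
  have -> : L * e0 = 4 * 32 * e0 + 16 * 32 * K by rewrite /L; field; rewrite gt_eqF.
  by rewrite lerDr; apply: mulr_ge0 (ltW e00); rewrite mulr_ge0.
clearbody L; exists L => // g p r r0 hg g0 ginj.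
rewrite leNgt; apply/negP => big.
have hg' := holo_derive1 hg; have hg'' := holo_derive1 hg'.
have dg z (hz : cmod (z - p) < r) := holo_cderiv hg hz.
have dg' z (hz : cmod (z - p) < r) := holo_cderiv hg' hz.
have dg'' z (hz : cmod (z - p) < r) := holo_cderiv hg'' hz.
move: g0 big hg' hg'' dg dg' dg''; move: (derive1 g : CC R -> CC R) => g'.
move: (derive1 g' : CC R -> CC R) => g'' g0 big hg' hg'' dg dg' dg''.
pose P z := g'' z / g' z.
have hP : holo P p r.
  by move=> z hz; eexists; apply: cderiv_div; [exact: g0|exact: dg''|exact: dg'].
have pp : cmod (p - p) < r by rewrite subrr cmod0.
have [z hz||b [s [s0 bs mus Pb]]] := @point_picking P p r L r0 L0.
- by have [l /cderiv_contat] := hP z hz.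
- rewrite cmodM cmodV mulrAC ltr_pdivlMr ?cmod_gt0 ?g0//.
  by move: big; rewrite mulrAC ltr_pdivrMr.
have inb z : cmod (z - b) < s -> cmod (z - p) < r.
  by move=> hz; have := cmod_triangle b z p; lra.
set k := P b in mus Pb; pose mu := cmod k; rewrite -/mu in mus Pb.
have mu0 : 0 < mu by rewrite -(pmulr_lgt0 _ s0); apply: lt_trans mus; apply: divr_gt0.
have k0 : k != 0 by rewrite -cmod_gt0.
have hPb : holo P b s by apply: holo_ball hP _; lra.
have P'b z : cmod (z - b) < s / 2 -> cmod (derive1 P z) <= 8 * K * mu / s.
  move=> hz; have [||_ H] := @holo_derive1_center R P z (s / 2).
  - by rewrite divr_gt0.
  - by apply: holo_ball hPb _; lra.
  apply: (le_trans (H (2 * mu) _)).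
    by move=> w hw; apply: Pb; have := cmod_triangle z w b; lra.
  by rewrite le_eqVlt; apply/orP; left; apply/eqP; rewrite /K; field; rewrite gt_eqF.
have Plip z : cmod (z - b) < s / 2 -> cmod (P z - k) <= 8 * K * mu / s * cmod (z - b).
  move=> hz; apply: (@ball_mean_value R P (derive1 P) b (s / 2)) => //.
    by move=> y hy; apply: (holo_cderiv hPb); lra.
  by rewrite subrr cmod0 divr_gt0.
have g'b0 : g' b != 0 by apply: g0; apply: inb; rewrite subrr cmod0.
pose x z := b + z / k.
have xb z : cmod z < 16 -> cmod (x z - b) < s / 2.
  move=> hz; rewrite /x addrC addKr cmodM cmodV ltr_pdivrMr//.
  by rewrite -/mu; lra.
have xr z : cmod z < 16 -> cmod (x z - p) < r by move=> /xb hz; apply: inb; lra.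
have dx z : cderiv x z k^-1.
  have := cderivD (cderiv_cst b z) (cderivM (cderiv_id z) (cderiv_cst k^-1 z)).
  by rewrite mul1r mulr0 addr0 add0r.
pose G z := (g (x z) - g b) * (k / g' b).
pose G' z := g' (x z) / g' b.
pose d z := P (x z) / k - 1.
have [z hz|z hz|z hz|||z [z0 z16 Gz]] := noinj G G' d.
- have dgx := cderiv_comp (dx z) (dg _ (xr z hz)).
  have := cderivM (cderivB dgx (cderiv_cst (g b) z)) (cderiv_cst (k / g' b) z).
  by congr cderiv; rewrite /G'; field; rewrite k0 g'b0.
- have dgx := cderiv_comp (dx z) (dg' _ (xr z hz)).
  have := cderivM dgx (cderiv_cst (g' b)^-1 z).
  by congr cderiv; rewrite /G' /d /P; field; rewrite k0 g'b0 g0//; exact: xr.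
- have -> : d z = (P (x z) - k) / k by rewrite /d; field.
  rewrite cmodM cmodV ler_pdivrMr//; apply: (le_trans (Plip _ (xb z hz))).
  rewrite {1}/x [b + _]addrC addrK cmodM cmodV -/mu.
  have -> : 8 * K * mu / s * (cmod z / mu) = 8 * K * cmod z / s by field; rewrite !gt_eqF.
  rewrite ler_pdivrMr//; apply: (@le_trans _ _ (8 * K * 16)).
    by rewrite ler_wpM2l ?mulr_ge0// ltW.
  have : L / 4 * e0 <= mu * s * e0 by rewrite ler_wpM2r ?ltW.
  have -> : e0 * mu * s = mu * s * e0 by ring.
  lra.
- by rewrite /G /x mul0r addr0 subrr mul0r.
- by rewrite /G' /x mul0r addr0 mulfV.
have : g (x z) = g b.
  apply/eqP; move/eqP: Gz; rewrite mulf_eq0 subr_eq0 => /orP[//|].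
  by rewrite mulf_eq0 invr_eq0 (negPf k0) (negPf g'b0).
move=> /ginj H; have {H} : x z = b.
  by apply: H; [exact: xr|apply: inb; rewrite subrr cmod0].
move=> E; have : x z - b = z / k by rewrite /x addrC addKr.
by rewrite E subrr => /esym/eqP; rewrite mulf_eq0 invr_eq0 (negPf k0) (negPf z0).
Qed.

End Distortion.

(** * Integrals over covers by squares *)

Section Covering.
Import measurable_realfun.
Local Open Scope ereal_scope.
Context d (T : measurableType d) (R : realType) (mu : {measure set T -> \bar R}).

Lemma ge0_le_integral_nomeas (f g : T -> \bar R) :
  (forall x, 0 <= f x) -> (forall x, f x <= g x) -> \int[mu]_x f x <= \int[mu]_x g x.
Proof.
move=> f0 fg; rewrite !ge0_integralTE//; last by move=> x; exact: le_trans (fg x).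
apply: ereal_sup_le => _ [h hf <-]; exists h => //= x.
exact: le_trans (hf x) (fg x).
Qed.

(* No measurability is required of [f] or [D]: the integral of a nonnegative function is a
   supremum over the simple functions below it, hence monotone. *)
Lemma integral_le_cover (D : set T) (f : T -> \bar R) (I : eqType)
  (s : nat -> seq I) (Q : nat -> I -> set T) (w : nat -> I -> R) :
  (forall x, D x -> 0 <= f x) -> (forall n i, measurable (Q n i)) ->
  (forall n i, 0 <= w n i)%R ->
  (forall x, D x -> exists n i, [/\ i \in s n, Q n i x & f x <= (w n i)%:E]) ->
  \int[mu]_(x in D) f x <= \sum_(0 <= n <oo) \sum_(i <- s n) (w n i)%:E * mu (Q n i).
Proof.
move=> f0 mQ w0 cov.
pose t n i x : \bar R := (w n i)%:E * (\1_(Q n i) x)%:E.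
have mI n i : measurable_fun [set: T] (fun x => (\1_(Q n i) x : R)%:E).
  by apply/measurable_EFinP; exact: measurable_indic.
have t0 n i x : 0 <= t n i x by rewrite mule_ge0// lee_fin.
have mt n i : measurable_fun [set: T] (t n i).
  by apply: emeasurable_funM => //; exact: measurable_cst.
pose g x : \bar R := \sum_(0 <= n <oo) \sum_(i <- s n) t n i x.
have s0 n x : 0 <= \sum_(i <- s n) t n i x by apply: sume_ge0.
rewrite integral_mkcond; apply: (@le_trans _ _ (\int[mu]_x g x)).
  apply: ge0_le_integral_nomeas => x; rewrite /patch; case: ifPn => // Dx.
  - exact/f0/set_mem.
  - have {}Dx := set_mem Dx.
    have [n [i [si Qx fx]]] := cov x Dx; apply: (le_trans fx).
    apply: (@le_trans _ _ (\sum_(i <- s n) t n i x)).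
      rewrite (big_rem i si) /=; apply: (@le_trans _ _ (t n i x)).
        by rewrite /t indicE mem_set// mule1.
      by rewrite leeDl// sume_ge0.
    apply: le_trans (nneseries_lim_ge n.+1 _); last by move=> k _ _; exact: s0.
    by rewrite big_nat_recr//= leeDr// sume_ge0.
  - by apply: nneseries_ge0 => n _ _; exact: s0.
rewrite /g integral_nneseries//; last first.
  by move=> n; apply: emeasurable_sum => i; exact: mt.
rewrite le_eqVlt; apply/orP; left; apply/eqP; apply: eq_eseriesr => n _.
rewrite ge0_integral_sum//; apply: eq_bigr => i _.
by rewrite /t ge0_integralZl_EFin// integral_indic// setIT.
Qed.

End Covering.

Section CoveringPlane.
Variable R : realType.

Definition csquare (p : CC R) (h : R) : set (R * R) :=
  `[cre p - h, cre p + h]%classic `*` `[cim p - h, cim p + h]%classic.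

Lemma area_csquare p h : 0 <= h -> @area R (csquare p h) = ((2 * h) ^+ 2)%:E.
Proof.
move=> h0; rewrite /csquare /area product_measure1E//= !lebesgue_measure_itv /= !lte_fin.
have E (x : R) : (if x - h < x + h then ((x + h)%:E + - (x - h)%:E)%E else 0%E) = (2 * h)%:E.
  case: ifPn => hh; first by rewrite -EFinB; congr EFin; ring.
  have -> : h = 0 by move: hh; rewrite -leNgt; lra.
  by rewrite mulr0.
rewrite !E -EFinM expr2//.
Qed.

Lemma area_integral_le_cover (D : set (R * R)) (f : R * R -> \bar R) (I : eqType)
  (s : nat -> seq I) (p : I -> CC R) (h w : nat -> I -> R) :
  (forall x, D x -> 0 <= f x)%E -> (forall n i, 0 <= h n i) -> (forall n i, 0 <= w n i) ->
  (forall x, D x -> exists n i, [/\ i \in s n, csquare (p i) (h n i) x & (f x <= (w n i)%:E)%E]) ->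
  (\int[@area R]_(x in D) f x <=
   \sum_(0 <= n <oo) (\sum_(i <- s n) w n i * (2 * h n i) ^+ 2)%:E)%E.
Proof.
move=> f0 h0 w0 cov.
apply: (le_trans (@integral_le_cover _ _ _ (@area R) D f I s
  (fun n i => csquare (p i) (h n i)) w f0 _ w0 cov)).
  by move=> n i; exact: measurableX.
rewrite le_eqVlt; apply/orP; left; apply/eqP; apply: eq_eseriesr => n _.
by rewrite -sumEFin; apply: eq_bigr => i _; rewrite EFinM; congr (_ * _)%E; exact: area_csquare.
Qed.

End CoveringPlane.

(** * Roots and powers *)

Section Roots.
Variable R : realType.
Implicit Types (z u v y : CC R) (x t r : R).

Lemma exists_root y N : (0 < N)%N -> exists u : CC R, u ^+ N = y.
Proof.
move=> N0.
have [u hu] := @solve_monicpoly (R[i] : closedFieldType) N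
  (fun i => if i == 0%N then (y : R[i]) else 0) N0.
exists u; rewrite -[RHS](mulr1 y); case: N N0 hu => // N _ hu.
apply: (etrans hu); rewrite big_ord_recl /= big1 ?addr0 ?expr0//.
by move=> i _; rewrite mul0r.
Qed.

Lemma root_seq y N : (0 < N)%N -> exists s : seq (CC R),
  [/\ uniq s, (size s <= N)%N & forall u, (u \in s) = (u ^+ N == y)].
Proof.
move=> N0; pose P := 'X^N - y%:P.
have sP : size P = N.+1 by rewrite size_XnsubC.
have P0 : P != 0 by rewrite -size_poly_eq0 sP.
have rP u : root P u = (u ^+ N == y) by rewrite rootE !hornerE ?hornerXn subr_eq0.
have [r Pr] := @closed_field_poly_normal (R[i] : closedFieldType) (P : {poly R[i]}).
have [s us hs] : exists2 s : seq (CC R), uniq s & forall u, (u \in s) = root P u.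
  exists (undup r); first exact: undup_uniq.
  move=> u; rewrite mem_undup; rewrite /root.
  have -> : P.[u] = (lead_coef P *: \prod_(z <- r) ('X - z%:P)).[u] by rewrite -Pr.
  rewrite hornerZ mulf_eq0 lead_coef_eq0 (negPf P0) /=.
  exact: (esym (@root_prod_XsubC (R[i] : idomainType) r u)).
exists s; split => //; last by move=> u; rewrite hs rP.
by rewrite -ltnS -sP; apply: max_poly_roots => //; apply/allP => u; rewrite hs.
Qed.

Lemma unit_polar v : cmod v = 1 -> exists2 t : R, `|t| <= 4 & v = cexp (pt 0 t).
Proof.
move=> v1; have hx : -1 <= cre v <= 1 by rewrite -ler_norml -v1 cre_le.
have sq : cre v ^+ 2 + cim v ^+ 2 = 1 by rewrite -sqr_cmod v1 expr1n.
have [/andP[a0 api] ca] := acos_def hx.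
have [/andP[_ pi4] _] := pihalf_02_cos_pihalf R.
have sa : sin (acos (cre v)) = `|cim v|.
  by rewrite sin_acos// -sq addrC addKr sqrtr_sqr.
have [y0|y0] := leP 0 (cim v).
  exists (acos (cre v)); first by rewrite ger0_norm//; lra.
  by apply: cc_eq; rewrite /= expR0 mul1r ?ca// sa ger0_norm.
exists (- acos (cre v)); first by rewrite normrN ger0_norm//; lra.
by apply: cc_eq; rewrite /= expR0 mul1r ?cosN ?ca// sinN sa ltr0_norm// opprK.
Qed.

Lemma cmod_cexp_pt t : cmod (cexp (pt 0 t)) = 1.
Proof. by rewrite cmodE /= expR0 !mul1r cos2Dsin2 sqrtr1. Qed.

Lemma cexp_pt_dist t : cmod (cexp (pt 0 t) - 1) <= `|t|.
Proof.
have -> : `|t| = 1 * cmod (pt 0 t - 0).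
  by rewrite mul1r subr0 cmodE /= expr0n add0r sqrtr_sqr.
rewrite -cexp0; apply: (@cderiv_mean_value R (@cexp R) (@cexp R)) => s _; first exact: cderiv_cexp.
have -> : 0 + rc s * (pt 0 t - 0) = pt 0 (s * t).
  by apply: cc_eq; rewrite add0r subr0 ?creM ?cimM /=; ring.
by rewrite cmod_cexp_pt.
Qed.

Lemma cexp_ptX t N : cexp (pt 0 t) ^+ N = cexp (pt 0 (t *+ N)).
Proof.
elim: N => [|N IH]; first by rewrite expr0 mulr0n -cexp0; congr cexp; apply: cc_eq.
by rewrite exprS IH -cexpD mulrS; congr cexp; apply: cc_eq; rewrite ?creD ?cimD /= ?addr0.
Qed.

(** Take any root [u0] and let [v] be the quotient of the directions of [u0] and [z]. Only [v ^+ N]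
    matters: it is cexp (i t) with |t| <= 4, so turning the direction of [z] by t / N and giving it
    the modulus of [u0] yields a root. *)
Lemma near_root z y N : (0 < N)%N -> z != 0 -> y != 0 -> exists u,
  [/\ u ^+ N = y & cmod (z - u) <= `|cmod u - cmod z| + 4 * cmod u / N%:R].
Proof.
move=> N0 z0 y0; have Np : 0 < N%:R :> R by rewrite ltr0n.
have [u0 u0N] := exists_root y N0.
have cz : 0 < cmod z by rewrite cmod_gt0.
have cu : 0 < cmod u0.
  by rewrite cmod_gt0; apply: contraNneq y0 => u00; rewrite -u0N u00 expr0n gtn_eqF.
pose v := u0 / rc (cmod u0) * (rc (cmod z) / z).
have v1 : cmod v = 1.
  rewrite !cmodM !cmodV !cmod_rc !ger0_norm ?cmod_ge0// divff ?mul1r ?gt_eqF//.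
  by rewrite divff// gt_eqF.
have vN1 : cmod (v ^+ N) = 1 by rewrite cmodX v1 expr1n.
have [t t4 vt] := unit_polar vN1.
pose s := cexp (pt 0 (t / N%:R)).
have sN : s ^+ N = v ^+ N.
  have E : t / N%:R *+ N = t by rewrite -mulr_natr divfK// gt_eqF.
  by rewrite cexp_ptX E.
have s1 : cmod s = 1 by exact: cmod_cexp_pt.
have sd : cmod (s - 1) <= 4 / N%:R.
  apply: (le_trans (cexp_pt_dist _)); rewrite normrM normfV [`|N%:R|]ger0_norm//.
  by rewrite ler_pM2r// invr_gt0.
have rz : rc (cmod z) != 0 by rewrite rc_eq0 gt_eqF.
have ru : rc (cmod u0) != 0 by rewrite rc_eq0 gt_eqF.
pose u := z / rc (cmod z) * (rc (cmod u0) * s).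
have cuE : cmod u = cmod u0.
  rewrite !cmodM s1 cmodV !cmod_rc !ger0_norm ?cmod_ge0// mulr1 divff ?mul1r//.
  by rewrite gt_eqF.
exists u; rewrite cuE; split.
  rewrite /u exprMn [X in _ * X]exprMn sN -!exprMn -u0N; congr (_ ^+ N).
  by rewrite /v; field; rewrite z0 rz ru.
have -> : z - u = z / rc (cmod z) * (rc (cmod z - cmod u0) - rc (cmod u0) * (s - 1)).
  by rewrite rcB /u; field.
rewrite cmodM cmodM cmodV cmod_rc [`|cmod z|]ger0_norm ?cmod_ge0// divff ?mul1r; last first.
  by rewrite gt_eqF.
apply: (le_trans (ler_cmodD _ _)); rewrite cmodN cmod_rc distrC cmodM cmod_rc; apply: lerD => //.
rewrite ger0_norm ?cmod_ge0// [4 * _]mulrC -mulrA ler_wpM2l ?cmod_ge0//.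
Qed.

End Roots.

(** * Elementary real inequalities *)

Section RealEstimates.
Variable R : realType.
Implicit Types (x a p : R).

Lemma bernoulli_ge x n : 0 <= x -> 1 + n%:R * x <= (1 + x) ^+ n.
Proof.
move=> x0; elim: n => [|n IH]; first by rewrite mul0r addr0 expr0.
rewrite exprS; have := ler_wpM2l (addr_ge0 ler01 x0) IH.
apply: le_trans; rewrite -natr1 -subr_ge0.
have -> : (1 + x) * (1 + n%:R * x) - (1 + (n%:R + 1) * x) = n%:R * x ^+ 2 by ring.
by rewrite mulr_ge0// sqr_ge0.
Qed.

Lemma one_sub_pow_le x n : 0 <= x -> x <= 1 -> 1 - x ^+ n <= n%:R * (1 - x).
Proof.
move=> x0 x1; elim: n => [|n IH]; first by rewrite expr0 mul0r subrr.
rewrite exprS -natr1; have := ler_wpM2l x0 IH.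
have : x * (n%:R * (1 - x)) <= 1 * (n%:R * (1 - x)).
  by rewrite ler_wpM2r// mulr_ge0// subr_ge0.
rewrite mulrBr mulr1 mul1r mulrDl mul1r; lra.
Qed.

(** Bernoulli gives 1 + n (1 - x) <= (2 - x)^n, and (2 - x) x <= 1 bounds the right-hand side by
    x^-n <= 1 / a. *)
Lemma one_sub_root_le x a n : (0 < n)%N -> 0 < x -> x <= 1 -> 0 < a -> a <= x ^+ n ->
  1 - x <= (a^-1 - 1) / n%:R.
Proof.
move=> n0 x0 x1 a0 ax; have np : 0 < n%:R :> R by rewrite ltr0n.
have h := @bernoulli_ge (1 - x) n; rewrite subr_ge0 in h; have {}h := h x1.
have k : (1 + (1 - x)) ^+ n * x ^+ n <= 1.
  rewrite -exprMn; apply: exprn_ile1.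
    by apply: mulr_ge0; lra.
  rewrite -subr_ge0; have -> : 1 - (1 + (1 - x)) * x = (1 - x) ^+ 2 by ring.
  exact: sqr_ge0.
rewrite ler_pdivlMr// lerBrDl mulrC -[X in _ <= X]mul1r ler_pdivlMr//.
apply: le_trans k; apply: ler_pM => //; last exact: ltW.
by rewrite addr_ge0// mulr_ge0// subr_ge0.
Qed.

(** This is where the dependence on [p] is lost: the exponent 2 dominates for x <= 1, the exponent 4
    for x > 1. *)
Lemma powR_le_sum x p : 0 <= x -> 2 <= p <= 4 -> x `^ p <= x ^+ 2 + x ^+ 4.
Proof.
move=> x0 /andP[p2 p4]; have [->|xn0] := eqVneq x 0.
  by rewrite powR0 ?addr_ge0 ?exprn_ge0// gt_eqF//; lra.
have xp : 0 < x by rewrite lt_neqAle eq_sym xn0.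
rewrite -!powR_mulrn//; have [x1|x1] := leP x 1.
  apply: (@le_trans _ _ (x `^ 2)); last by rewrite lerDl powR_ge0.
  by apply: ger_powR => //; rewrite xp.
apply: (@le_trans _ _ (x `^ 4)); last by rewrite lerDr powR_ge0.
by apply: ler_powR => //; exact: ltW.
Qed.

Lemma exists_pow_le x e : 0 < e -> 0 <= x -> x < 1 -> exists n, x ^+ n <= e.
Proof.
move=> e0 x0 x1.
have /cvgrPdist_le /(_ e e0) [N _ hN] : (fun n => x ^+ n) @ \oo --> (0 : R).
  by apply: cvg_expr; rewrite ger0_norm.
exists N; have := hN N (leqnn N); rewrite /= sub0r normrN.
by apply: le_trans; exact: ler_norm.
Qed.

End RealEstimates.

(** * The uniformization *)

Section Polynomials.
Variable R : realType.
Implicit Types (p : {poly CC R}).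

Lemma poly_growth p M : (1 < size p)%N -> exists B : R, forall w, B <= cmod w -> M <= cmod p.[w].
Proof.
elim/poly_ind: p M => [|q c IH] M; first by rewrite size_poly0.
move=> sp; have q0 : q != 0.
  by apply: contraTneq sp => ->; rewrite mul0r add0r -leqNgt size_polyC leq_b1.
have low w : cmod q.[w] * cmod w - cmod c <= cmod (q * 'X + c%:P).[w].
  rewrite hornerMXaddC -cmodM; have := cmod_sub_ge (q.[w] * w) (- c).
  by rewrite cmodN opprK.
have [q1|q1] := leqP (size q) 1.
  have [a qa] : exists a, q = a%:P by exists q`_0; exact: size1_polyC.
  have a0 : 0 < cmod a by rewrite cmod_gt0 -polyC_eq0 -qa.
  exists ((M + cmod c) / cmod a) => w; rewrite ler_pdivrMr// => h.
  by apply: le_trans (low w); rewrite qa hornerC mulrC; lra.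
have [B hB] := IH (`|M| + cmod c) q1.
exists (Num.max B 1) => w; rewrite ge_max => /andP[/hB h1 h2].
apply: le_trans (low w); have := ler_pM _ ler01 h1 h2.
rewrite addr_ge0 ?cmod_ge0// mulr1 => /(_ isT).
have := ler_norm M; lra.
Qed.

Lemma size_deriv_gt1 p : (1 < (size p).-1)%N -> (1 < size p^`())%N.
Proof.
move=> sp; rewrite ltnNge; apply/negP => h.
have lp : lead_coef p != 0 by rewrite lead_coef_eq0; apply: contraTneq sp => ->; rewrite size_poly0.
have := coef_deriv p (size p).-2.
rewrite nth_default; last first.
  by apply: (leq_trans h); move: sp; case: (size p) => [|[|[|]]].
have -> : (size p).-2.+1 = (size p).-1 by move: sp; case: (size p) => [|[|]].
move=> /esym/eqP; rewrite mulrn_eq0 -lead_coefE (negPf lp) orbF => /eqP E.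
by move: sp; rewrite E.
Qed.

Lemma horner_iter_poly p n w : (iter_poly p n).[w] = iter n (fun x => p.[x]) w.
Proof. by elim: n => [|n IH]; rewrite /= ?hornerX// horner_comp IH. Qed.

End Polynomials.

Section Uniformization.
Variables (R : realType) (f : {poly CC R}) (Rm F : CC R -> CC R).
Let m := (size f).-1.
Hypothesis m2 : (2 <= m)%N.
Hypothesis Rinj : forall z1 z2, pdisc z1 -> pdisc z2 -> Rm z1 = Rm z2 -> z1 = z2.
Hypothesis Rder : forall z, pdisc z -> derivable Rm z 1.
Hypothesis Rpole : cmod (Rm z) @[z --> (0 : CC R)^'] --> +oo.
Hypothesis Rfunc : forall z, pdisc z -> f.[Rm z] = Rm (z ^+ m).
Hypothesis FR : forall z, pdisc z -> F (Rm z) = z.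
Implicit Types (z w u : CC R) (r : R).

Definition dbd z : R := Num.min (cmod z) (1 - cmod z).
Let R' : CC R -> CC R := derive1 Rm.
Let R'' : CC R -> CC R := derive1 R'.

Lemma pdiscP z : pdisc z <-> z != 0 /\ cmod z < 1.
Proof.
by rewrite /pdisc /= cmod_gt0; split => [/andP[]|[-> ->]].
Qed.

Lemma dbd_gt0 z : pdisc z -> 0 < dbd z.
Proof. by move=> /andP[z0 z1]; rewrite lt_min z0 subr_gt0. Qed.

Lemma ball_pdisc z w : cmod (w - z) < dbd z -> pdisc w.
Proof.
rewrite lt_min => /andP[h1 h2]; rewrite /pdisc /=.
have := cmod_sub_ge z (z - w); rewrite subKr cmodB.
have := ler_cmodD (w - z) z; rewrite subrK => k1 k2.
by apply/andP; split; lra.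
Qed.

Lemma pdiscX z n : (0 < n)%N -> pdisc z -> pdisc (z ^+ n).
Proof.
move=> n0 /andP[z0 z1]; rewrite /pdisc /= cmodX exprn_gt0//=.
by rewrite exprn_ilt1 ?cmod_ge0// -lt0n.
Qed.

Lemma holoR z r : r <= dbd z -> holo Rm z r.
Proof.
move=> rz w wz; have pw : pdisc w by apply: ball_pdisc; exact: lt_le_trans rz.
by exists (derive1 Rm w); apply: derivable_cderiv; exact: Rder.
Qed.

Lemma dR z : pdisc z -> cderiv Rm z (R' z).
Proof. by move=> pz; apply: derivable_cderiv; exact: Rder. Qed.

Lemma dR' z : pdisc z -> cderiv R' z (R'' z).
Proof.
move=> pz; apply: (holo_cderiv (p := z) (r := dbd z)).
  by apply: holo_derive1; exact: holoR.
by rewrite subrr cmod0 dbd_gt0.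
Qed.

Lemma m_gt0 : (0 < m)%N. Proof. exact: ltn_trans m2. Qed.

Lemma iter_f n z : pdisc z -> iter n (fun x => f.[x]) (Rm z) = Rm (z ^+ (m ^ n)).
Proof.
move=> pz; elim: n => [|n IH]; first by rewrite expn0 expr1.
rewrite iterS IH Rfunc; first by rewrite -exprM expnSr.
by apply: pdiscX => //; rewrite expn_gt0 m_gt0.
Qed.

Lemma deriv_conjugacy n z : pdisc z ->
  (iter_poly f n)^`().[Rm z] * R' z = R' (z ^+ (m ^ n)) * ((m ^ n)%:R * z ^+ (m ^ n).-1).
Proof.
move=> pz; have N0 : (0 < m ^ n)%N by rewrite expn_gt0 m_gt0.
have d1 := cderiv_comp (dR pz) (cderiv_horner (iter_poly f n) (Rm z)).
have d2 := cderiv_comp (cderivX z (m ^ n)) (dR (pdiscX N0 pz)).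
apply: cderiv_unique d2; apply: cderiv_near d1; first exact: dbd_gt0 pz.
by move=> w /ball_pdisc pw; rewrite horner_iter_poly iter_f.
Qed.

Lemma deriv_conjugacy1 z : pdisc z ->
  f^`().[Rm z] * R' z = R' (z ^+ m) * (m%:R * z ^+ m.-1).
Proof.
move=> pz; have := deriv_conjugacy 1 pz.
by rewrite /iter_poly /= comp_polyXr expn1.
Qed.

Lemma pole_ge M : exists2 d : R, 0 < d & forall z, z != 0 -> cmod z < d -> M <= cmod (Rm z).
Proof.
have /(_ _ (nbhs_pinfty_ge (num_real M))) := Rpole.
rewrite /= /nbhs /= /dnbhs /within /= => /nbhsCCP[d d0 hd].
by exists d => // z z0 zd; apply: hd => //; rewrite subr0.
Qed.

(* A zero [a] of [R'] propagates to [a ^ (m ^ n)], so the derivative of [1 / Rm], extended by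
   [0] at the origin, would vanish to infinite order there. *)
Lemma R'_neq0 a : pdisc a -> R' a != 0.
Proof.
move=> pa; apply/eqP => R'a.
have an n : pdisc (a ^+ (m ^ n)) by apply: pdiscX => //; rewrite expn_gt0 m_gt0.
have R'an n : R' (a ^+ (m ^ n)) = 0.
  elim: n => [|n IH]; first by rewrite expn0 expr1.
  have := deriv_conjugacy1 (an n); rewrite IH mulr0 -exprM -expnSr => /esym/eqP.
  have mz : (m%:R : CC R) != 0 by rewrite -cmod_gt0 cmod_nat ltr0n m_gt0.
  have az : a ^+ (m ^ n) != 0 by rewrite -cmod_gt0; case/andP: (an n).
  by rewrite mulf_eq0 (negPf (mulf_neq0 mz (expf_neq0 _ az))) orbF => /eqP.
have [d d0 hd] := pole_ge 1.
pose e := Num.min d 1; have e0 : 0 < e by rewrite lt_min d0 ltr01.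
have ed : e <= d by rewrite ge_min lexx.
have e1 : e <= 1 by rewrite ge_min lexx orbT.
pose h z : CC R := if z == 0 then 0 else (Rm z)^-1.
have pe z : z != 0 -> cmod z < e -> pdisc z by move=> z0 ze; apply/pdiscP; split=> //; lra.
have R1 z : z != 0 -> cmod z < e -> 1 <= cmod (Rm z) by move=> z0 ze; apply: hd => //; lra.
have Rn0 z : z != 0 -> cmod z < e -> Rm z != 0.
  by move=> z0 ze; rewrite -cmod_gt0; apply: lt_le_trans (R1 z z0 ze).
have dh z : z != 0 -> cmod z < e -> cderiv h z (- R' z / Rm z ^+ 2).
  move=> z0 ze; apply: (cderiv_near (d := cmod z) _ _ (cderivV (Rn0 z z0 ze) (dR (pe z z0 ze)))).
    by rewrite cmod_gt0.
  move=> w wz; rewrite /h ifN//; apply: contraTneq wz => ->.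
  by rewrite sub0r cmodN ltxx.
have h0 : contat h 0.
  apply/contatCCP => t t0; have [s s0 hs] := pole_ge (t^-1 + 1).
  exists s => // w; rewrite subr0 => ws; rewrite /h eqxx subr0.
  case: eqVneq => [_|w0]; first by rewrite cmod0.
  have k := hs w w0 ws; have tp : 0 < t^-1 by rewrite invr_gt0.
  have kp : 0 < cmod (Rm w) by lra.
  by rewrite cmodV -[t]invrK ltf_pV2 ?posrE//; lra.
have hh : holo h 0 e.
  apply: holo_removable => // z; rewrite subr0 cmod_gt0 => /andP[z0 ze].
  by eexists; exact: dh.
have hb z : cmod z < e -> cmod (h z) <= 1.
  move=> ze; rewrite /h; case: eqVneq => [_|z0]; first by rewrite cmod0.
  by rewrite cmodV invf_le1 ?R1//; apply: lt_le_trans (R1 z z0 ze).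
have hh' := holo_derive1 hh.
have [||z ze|t t0|s s0 hs] := @accumulating_zeros0 R (derive1 h) (e / 2)
  (2 * cauchyK R * 1 / (e / 2)).
- by rewrite divr_gt0.
- by apply: holo_ball hh' _; rewrite subrr cmod0; lra.
- have [||_] := @holo_derive1_center R h z (e / 2); first by rewrite divr_gt0.
    by apply: holo_ball hh _; rewrite subr0; lra.
  by apply => w wz; apply: hb; have := cmod_triangle z w 0; rewrite !subr0; lra.
- pose q := Num.min t e / 2; have q0 : 0 < q by rewrite divr_gt0// lt_min t0.
  have k1 : Num.min t e <= t by rewrite ge_min lexx.
  have k2 : Num.min t e <= e by rewrite ge_min lexx orbT.
  have qt : q < t by move: q0; rewrite /q; lra.
  have qe : q < e by move: q0; rewrite /q; lra.
  have /andP[a0 a1] := pa; have [n an_le] := exists_pow_le q0 (ltW a0) a1.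
  have cn : cmod (a ^+ (m ^ n)) <= q.
    rewrite cmodX; apply: le_trans an_le; apply: ler_wiXn2l; rewrite ?cmod_ge0 ?ltW//.
    by rewrite ltnW// ltn_expl.
  have an0 : a ^+ (m ^ n) != 0 by rewrite -cmod_gt0; case/andP: (an n).
  exists (a ^+ (m ^ n)); split; [exact: an0|exact: le_lt_trans cn qt|].
  rewrite (cderiv_derive1 (dh _ an0 (le_lt_trans cn qe))) R'an oppr0.
  exact: mul0r.
(* The derivative of [h] now vanishes near 0, so [h] is constantly h 0 = 0 there, whereas 1 / Rm is
   never 0. *)
pose k := Num.min s e; have k0 : 0 < k by rewrite lt_min s0.
have ks : k <= s by rewrite ge_min lexx.
have ke : k <= e by rewrite ge_min lexx orbT.
have ck : cmod (rc (k / 2)) = k / 2 by rewrite cmod_rc ger0_norm// divr_ge0// ltW.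
have hz : h 0 = 0 by rewrite /h eqxx.
have := @ball_mean_value R h (derive1 h) 0 k 0 0 (rc (k / 2)).
rewrite hz !subr0 ck mul0r cmod0 => H.
have {H} : cmod (h (rc (k / 2))) <= 0.
  apply: H => //; last lra.
    by move=> z; rewrite subr0 => zk; apply: (holo_cderiv hh); rewrite subr0; lra.
  by move=> z; rewrite subr0 => zk; rewrite hs ?cmod0//; lra.
have r0 : rc (k / 2) != 0 by rewrite rc_eq0 gt_eqF// divr_gt0.
rewrite /h (negPf r0) cmodV => H.
have : 0 < (cmod (Rm (rc (k / 2))))^-1.
  by rewrite invr_gt0 cmod_gt0; apply: Rn0 => //; rewrite ck; lra.
by rewrite ltNge H.
Qed.

Lemma derive1_F z : pdisc z -> derive1 F (Rm z) = (R' z)^-1.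
Proof.
move=> pz; apply: cderiv_derive1.
apply: (@cderiv_inverse R Rm R' F z (dbd z)).
- exact: dbd_gt0.
- by move=> w /ball_pdisc; exact: dR.
- exact: cderiv_contat (dR' pz).
- exact: R'_neq0.
- by move=> w /ball_pdisc; exact: FR.
Qed.

Lemma R''_le : exists2 L : R, 0 < L & forall z, pdisc z ->
  cmod (R'' z) <= L / dbd z * cmod (R' z).
Proof.
have [L L0 hL] := koebe_distortion R; exists L => // z pz.
apply: hL; [exact: dbd_gt0|exact: holoR| |].
- by move=> w /ball_pdisc; exact: R'_neq0.
- by move=> w v /ball_pdisc pw /ball_pdisc pv; exact: Rinj.
Qed.

(** On the segment |R''| <= (L / d) |R'|, and its length is at most C d, so Gronwall gives the
    factor exp (L C), free of [d]. The second bound is the first on the reversed segment; the third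
    integrates the bound of [R'] by [R' u]. *)
Lemma R'_comparable C : 0 <= C -> exists2 A : R, 1 <= A & forall u z d, 0 < d ->
  (forall t, 0 <= t <= 1 -> d <= dbd (u + rc t * (z - u))) -> cmod (z - u) <= C * d ->
  [/\ cmod (R' z) <= A * cmod (R' u), cmod (R' u) <= A * cmod (R' z) &
      cmod (Rm z - Rm u) <= A * cmod (R' u) * cmod (z - u)].
Proof.
move=> C0; have [L L0 hL] := R''_le.
exists (expR (L * C)); first by rewrite -expR0 ler_expR mulr_ge0// ltW.
have one u z d : 0 < d ->
    (forall t, 0 <= t <= 1 -> d <= dbd (u + rc t * (z - u))) -> cmod (z - u) <= C * d ->
    cmod (R' z) <= expR (L * C) * cmod (R' u).
  move=> d0 hd zu.
  have pt' t : 0 <= t <= 1 -> pdisc (u + rc t * (z - u)).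
    by move=> t01; apply: (@ball_pdisc (u + rc t * (z - u))); rewrite subrr cmod0; apply: lt_le_trans (hd t t01).
  apply: (le_trans (@cderiv_gronwall R R' R'' u z (L / d) _ _)).
  - by move=> t t01; apply: dR'; exact: pt'.
  - move=> t t01; apply: (le_trans (hL _ (pt' t t01))); rewrite ler_wpM2r ?cmod_ge0//.
    apply: ler_wpM2l; first exact: ltW.
    rewrite lef_pV2 ?posrE//; first exact: hd.
    exact: lt_le_trans (hd t t01).
  rewrite ler_wpM2r ?cmod_ge0// ler_expR mulrAC ler_pdivrMr// -mulrA.
  by apply: ler_wpM2l => //; exact: ltW.
move=> u z d d0 hd zu; split; first exact: one d0 hd zu.
- apply: one d0 _ _; last by rewrite cmodB.
  move=> t /andP[t0 t1]; have -> : z + rc t * (u - z) = u + rc (1 - t) * (z - u).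
    by rewrite rcB rc1; ring.
  by apply: hd; apply/andP; split; lra.
- have pt' t : 0 <= t <= 1 -> pdisc (u + rc t * (z - u)).
    by move=> t01; apply: (@ball_pdisc (u + rc t * (z - u))); rewrite subrr cmod0; apply: lt_le_trans (hd t t01).
  apply: (@cderiv_mean_value R Rm R'); first by move=> t t01; apply: dR; exact: pt'.
  move=> t /andP[t0 t1]; apply: one d0 _ _.
    move=> s /andP[s0 s1].
    have -> : u + rc s * (u + rc t * (z - u) - u) = u + rc (s * t) * (z - u).
      by rewrite rcM; ring.
    by apply: hd; rewrite mulr_ge0//= mulr_ile1.
  apply: le_trans zu; rewrite addrC addKr cmodM cmod_rc ger0_norm//.
  by rewrite ler_piMl ?cmod_ge0.
Qed.

(** 1 / |g| is maximized over a whole square after multiplication by a cutoff [chi] that vanishes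
    near 0 and near and beyond the unit circle, where nothing is known about [g]. On the annulus
    [chi] is at least a (1 - b). *)
Lemma annulus_lower_bound (g : CC R -> CC R) (a b : R) : 0 < a -> b < 1 ->
  (forall z, pdisc z -> contat g z /\ g z != 0) ->
  exists2 c : R, 0 < c & forall z, a <= cmod z <= b -> c <= cmod (g z).
Proof.
move=> a0 b1 hg; pose relu (x : R) : R := `|x| + x.
have relu0 x : x <= 0 -> relu x = 0 by move=> x0; rewrite /relu ler0_norm// addNr.
have relup x : 0 <= x -> relu x = 2 * x by move=> x0; rewrite /relu ger0_norm//; ring.
have relu_ge0 x : 0 <= relu x by rewrite /relu -lerBlDr sub0r -normrN ler_norm.
have crelu (u : CC R -> R) z : contat u z -> contat (fun y => relu (u y)) z.
  move=> cu; apply: contatD => //; apply: (contat_comp cu); constructor; exact: norm_continuous.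
pose b' := (1 + b) / 2.
pose chi z := relu (cmod z - a / 2) * relu (b' - cmod z).
have cchi z : contat chi z.
  apply: contatM; apply: crelu; apply: contatB; try exact: contat_cst;
    exact/contat_cmod/contat_id.
pose u z := chi z * cmod (g z)^-1.
pose A := [set z : CC R | -1 <= cre z <= 1 /\ -1 <= cim z <= 1].
have cu z : A z -> contat u z.
  move=> _; have [pz|npz] := pselect (pdisc z).
    have [cg g0] := hg z pz; apply: contatM => //; apply: contat_cmod.
    exact: contatV.
  have near0 w : cmod (w - z) < Num.min (a / 2) (1 - b') -> u w = 0.
    rewrite lt_min => /andP[w1 w2]; rewrite /u /chi.
    have [zz|z0] := eqVneq z 0.
      by rewrite relu0 ?mul0r//; rewrite zz subr0 in w1; lra.
    case: (ltP (cmod z) 1) => z1; first by exfalso; apply: npz; apply/pdiscP.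
    have := cmod_sub_ge z (z - w); rewrite subKr cmodB => h.
    by rewrite [relu (b' - _)]relu0 ?mulr0 ?mul0r//; rewrite /b' in w2 *; lra.
  apply/contatCRP => e e0; exists (Num.min (a / 2) (1 - b')).
    by rewrite lt_min divr_gt0//= /b'; lra.
  move=> w wz; rewrite !near0 ?subrr ?normr0//.
  by rewrite cmod0 lt_min divr_gt0//= /b'; lra.
have [|c Ac umax] := @square_EVT_max R A _ _ _ _ u _ erefl cu.
  by exists 0; split => /=; lra.
pose k := a * (1 - b); have k0 : 0 < k by rewrite mulr_gt0// subr_gt0.
have uc0 : 0 <= u c by rewrite mulr_ge0 ?cmod_ge0// mulr_ge0.
exists (k / (u c + 1)); first by rewrite divr_gt0// ltr_wpDl.
move=> z /andP[za zb].
have pz : pdisc z by apply/andP; split; lra.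
have gp : 0 < cmod (g z) by rewrite cmod_gt0; case: (hg z pz).
have Az : A z.
  have := cre_le z; have := cim_le z; rewrite !ler_norml => /andP[? ?] /andP[? ?].
  by split; lra.
have := umax z Az; rewrite /u cmodV /chi relup; last lra.
rewrite relup; last by rewrite /b'; lra.
rewrite ler_pdivrMr// => h.
rewrite ler_pdivrMr ?ltr_wpDl//; apply: (@le_trans _ _ (u c * cmod (g z))).
  apply: le_trans h; rewrite /k.
  have h1 : a <= 2 * (cmod z - a / 2) by lra.
  have h2 : 1 - b <= 2 * (b' - cmod z) by rewrite /b'; lra.
  by apply: ler_pM => //; [exact: ltW|rewrite subr_ge0 ltW].
by rewrite mulrC ler_wpM2l ?cmod_ge0// lerDl.
Qed.

(* Near the pole [f^`() (Rm z)] is large, so that [cmod (R' z) <= cmod (R' (z ^+ m))] there. *)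
Lemma R'_lower_bound (b : R) : 0 < b -> b < 1 -> exists2 c : R, 0 < c &
  forall z, z != 0 -> cmod z <= b -> c <= cmod (R' z).
Proof.
move=> b0 b1.
have [B hB] := poly_growth (m%:R : R) (size_deriv_gt1 m2).
have [d d0 hd] := pole_ge B.
pose r := Num.min (d / 2) b.
have r0 : 0 < r by rewrite lt_min divr_gt0.
have rb : r <= b by rewrite ge_min lexx orbT.
have rd2 : r <= d / 2 by rewrite ge_min lexx.
have rd : r < d by lra.
have r1 : r < 1 by lra.
have hR' z : pdisc z -> contat R' z /\ R' z != 0.
  by move=> pz; split; [exact: cderiv_contat (dR' pz)|exact: R'_neq0].
have [c c0 hc] := @annulus_lower_bound R' (r ^+ m) b (exprn_gt0 m r0) b1 hR'.
exists c => //.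
have grow z : z != 0 -> cmod z <= r -> cmod (R' z) <= cmod (R' (z ^+ m)).
  move=> z0 zr; have pz : pdisc z by apply/pdiscP; split => //; lra.
  have mp : 0 < m%:R :> R by rewrite ltr0n m_gt0.
  have := congr1 (@cmod R) (deriv_conjugacy1 pz); rewrite !cmodM cmod_nat => E.
  have h1 := hB _ (hd _ z0 (le_lt_trans zr rd)).
  have h2 : m%:R * cmod (R' z) <= cmod (R' (z ^+ m)) * (m%:R * cmod (z ^+ m.-1)).
    by rewrite -E ler_wpM2r ?cmod_ge0.
  have h3 : cmod (z ^+ m.-1) <= 1 by rewrite cmodX; apply: exprn_ile1; [exact: cmod_ge0|exact: le_trans zr (ltW r1)].
  rewrite -(ler_pM2l mp); apply: (le_trans h2); rewrite mulrCA ler_pM2l//.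
  by rewrite ler_piMr ?cmod_ge0.
(* A point below the fundamental annulus r^m <= |z| <= b has an [m]-th root one level closer to it,
   and [grow] carries the bound from the root down to the point. *)
have step n : forall z, z != 0 -> r ^+ (m ^ n.+1) <= cmod z -> cmod z <= r -> c <= cmod (R' z).
  elim: n => [|n IH] z z0 zn zr.
    by apply: hc; rewrite expn1 in zn; rewrite zn (le_trans zr).
  have [zm|/ltW zm] := leP (r ^+ m) (cmod z); first by apply: hc; rewrite zm (le_trans zr).
  have [u uz] := exists_root z m_gt0.
  have u0 : u != 0.
    by apply: contraNneq z0 => u0; rewrite -uz u0 expr0n gtn_eqF ?m_gt0.
  have ur : cmod u <= r.
    by rewrite -(@ler_pXn2r _ m) ?m_gt0 ?nnegrE ?cmod_ge0 ?(ltW r0)// -cmodX uz.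
  rewrite -uz; apply: le_trans (grow u u0 ur); apply: IH => //.
  rewrite -(@ler_pXn2r _ m) ?m_gt0 ?nnegrE ?cmod_ge0 ?exprn_ge0 ?(ltW r0)//.
  by rewrite -exprM -expnSr -cmodX uz.
move=> z z0 zb; have [zr|/ltW zr] := leP (cmod z) r; last first.
  apply: hc; rewrite zb andbT; apply: le_trans zr.
  by rewrite -[X in _ <= X]expr1; apply: ler_wiXn2l; rewrite ?m_gt0 ?(ltW r0)// ltW.
have cz : 0 < cmod z by rewrite cmod_gt0.
have [n hn] := exists_pow_le cz (ltW r0) r1.
apply: (step n) => //; apply: le_trans hn; apply: ler_wiXn2l; rewrite ?(ltW r0)//; first exact: ltW.
by rewrite ltnW// (leq_trans (ltn_expl n m2))// leq_exp2l.
Qed.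

End Uniformization.

(** * Covers of the basin *)

Lemma inv_sqr_le (R : realType) (d x y a M : R) : 0 < x -> 0 < y -> 0 < a -> 0 < M ->
  (y * (M * a)) ^+ 2 <= (d * x) ^+ 2 ->
  (x ^+ 2)^-1 <= (a ^+ 2 * y ^+ 2)^-1 * ((M ^+ 2)^-1 * d ^+ 2).
Proof.
move=> x0 y0 a0 M0 h; rewrite mulrA -invfM mulrC ler_pdivlMr; last first.
  by rewrite !mulr_gt0// exprn_gt0.
rewrite ler_pdivrMl ?exprn_gt0//.
have -> : x ^+ 2 * d ^+ 2 = (d * x) ^+ 2 by ring.
apply: le_trans h.
by rewrite le_eqVlt; apply/orP; left; apply/eqP; ring.
Qed.

Lemma cmod_root_rc (R : realType) (u : CC R) (x : R) K : 0 < x -> (0 < K)%N ->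
  u ^+ K = rc x ^+ K -> cmod u = x.
Proof.
move=> x0 K0 uK; apply: (@pexpIrn _ K) => //; rewrite ?nnegrE ?cmod_ge0 ?(ltW x0)//.
by rewrite -cmodX uK cmodX cmod_rc gtr0_norm.
Qed.

Lemma root_pdisc (R : realType) (z0 u : CC R) N : 0 < cmod z0 < 1 -> (0 < N)%N ->
  u ^+ N = z0 -> pdisc u.
Proof.
move=> /andP[r0 r1] N0 uN.
have cuN : cmod u ^+ N = cmod z0 by rewrite -cmodX uN.
apply/pdiscP; split.
  by apply: contraTneq r0 => u0; rewrite -cuN u0 cmod0 expr0n gtn_eqF// ltxx.
rewrite ltNge; apply/negP => h; move: r1; rewrite -cuN ltNge => /negP; apply.
exact: exprn_ege1.
Qed.

Section Covers.
Variables (R : realType) (f : {poly CC R}) (Rm : CC R -> CC R) (z0 : CC R).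
Let m := (size f).-1.
Hypothesis m2 : (2 <= m)%N.
Hypothesis Rinj : forall z1 z2, pdisc z1 -> pdisc z2 -> Rm z1 = Rm z2 -> z1 = z2.
Hypothesis Rder : forall z, pdisc z -> derivable Rm z 1.
Hypothesis Rpole : cmod (Rm z) @[z --> (0 : CC R)^'] --> +oo.
Hypothesis Rfunc : forall z, pdisc z -> f.[Rm z] = Rm (z ^+ m).
Hypothesis hz0 : 0 < cmod z0 < 1.
Implicit Types (z w u : CC R).
Let R' : CC R -> CC R := derive1 Rm.
Let comparable := R'_comparable m2 Rinj Rder Rpole Rfunc.

Lemma dbd_segment u z t : 0 <= t <= 1 ->
  Num.min (cmod u - cmod (z - u)) (1 - Num.max (cmod u) (cmod z)) <= dbd (u + rc t * (z - u)).
Proof.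
move=> /andP[t0 t1]; set x := u + _.
have ct : cmod (rc t * (z - u)) <= cmod (z - u).
  by rewrite cmodM cmod_rc ger0_norm// ler_piMl ?cmod_ge0.
have h1 : cmod u - cmod (z - u) <= cmod x.
  have := cmod_sub_ge u (- (rc t * (z - u))); rewrite cmodN opprK -/x; lra.
have h2 : cmod x <= Num.max (cmod u) (cmod z).
  have -> : x = rc (1 - t) * u + rc t * z by rewrite /x rcB rc1; ring.
  apply: (le_trans (ler_cmodD _ _)); rewrite !cmodM !cmod_rc !ger0_norm ?subr_ge0//.
  have -> : Num.max (cmod u) (cmod z) =
      (1 - t) * Num.max (cmod u) (cmod z) + t * Num.max (cmod u) (cmod z) by ring.
  by apply: lerD; apply: ler_wpM2l; rewrite ?subr_ge0// le_max lexx ?orbT.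
by rewrite /dbd le_min !ge_min h1 /= lerD2l lerN2 h2 orbT.
Qed.

(** On the circle of radius b q^j the [K] equidistant points form a mesh proportional to the radius,
    so one [K] serves every [j], and the squares shrink geometrically. *)
Lemma inner_cover (b : R) : 0 < b -> b < 1 -> exists A q (K : nat),
  [/\ 1 <= A, 0 < q, q < 1, (0 < K)%N & forall z, z != 0 -> cmod z <= b ->
   exists j u, [/\ u ^+ K = rc (b * q ^+ j) ^+ K, cmod (R' u) <= A * cmod (R' z) &
     cmod (Rm z - Rm u) <= A * cmod (R' u) * q ^+ j]].
Proof.
move=> b0 b1; have [A A1 hA] := comparable ler01; have A0 := le_trans ler01 A1.
(* The radial gap and, by the choice of [K], the angular gap are each at most (1 - b) / 4 times the
   radius; their sum [e] does not exceed the distance of the segment to the boundary. *)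
pose q := 1 - (1 - b) / 4.
have q0 : 0 < q by rewrite /q; lra.
have q1 : q < 1 by rewrite /q; lra.
pose K := (Num.bound (16 / (1 - b))).+1.
have K0 : 0 < K%:R :> R by rewrite ltr0n.
have b1' : 0 < 1 - b by rewrite subr_gt0.
have K4 : 4 / K%:R <= (1 - b) / 4.
  have h : 16 / (1 - b) <= K%:R.
    apply: (@le_trans _ _ (Num.bound (16 / (1 - b)))%:R); last by rewrite ler_nat.
    by apply/ltW/archi_boundP; apply: divr_ge0 => //; exact: ltW.
  move: h; rewrite ler_pdivrMr// => h; rewrite ler_pdivrMr//.
  by rewrite mulrAC; lra.
exists A, q, K; split => // z z0' zb.
have cz : 0 < cmod z by rewrite cmod_gt0.
have zb0 : 0 < cmod z / b by rewrite divr_gt0.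
have qn (n : nat) : 0 < q ^+ n by rewrite exprn_gt0.
have ex : exists j, b * q ^+ j.+1 < cmod z.
  have [n hn] := exists_pow_le zb0 (ltW q0) q1; exists n.
  have h : b * q ^+ n <= cmod z by move: hn; rewrite ler_pdivlMr// mulrC.
  by apply: lt_le_trans h; rewrite exprSr mulrA gtr_pMr// mulr_gt0.
have [j jz jmin] := ex_minnP ex.
have zj : cmod z <= b * q ^+ j.
  case: j jz jmin => [|j] jz jmin; first by rewrite expr0 mulr1.
  by rewrite leNgt; apply/negP => /jmin; rewrite ltnn.
pose rho := b * q ^+ j; have r0 : 0 < rho by rewrite mulr_gt0.
have rb : rho <= b.
  by rewrite /rho ler_piMr ?(ltW b0)// exprn_ile1// ltW.
have rq : rho <= q ^+ j by rewrite /rho ler_piMl ?(ltW (qn j))// ltW.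
have rcr : rc rho != 0 by rewrite rc_eq0 gt_eqF.
have [u [uK zu]] := near_root (N := K) isT z0' (expf_neq0 K rcr).
have cu : cmod u = rho by exact: cmod_root_rc uK.
exists j, u.
pose e := rho * ((1 - b) / 2).
have zue : cmod (z - u) <= e.
  apply: (le_trans zu); rewrite cu.
  have -> : e = rho * ((1 - b) / 4) + rho * ((1 - b) / 4) by rewrite /e; field.
  apply: lerD; last first.
    have -> : 4 * rho / K%:R = rho * (4 / K%:R) by ring.
    by rewrite ler_pM2l.
  have h : q * rho <= cmod z.
    have -> : q * rho = b * q ^+ j.+1 by rewrite /rho exprS; ring.
    exact: ltW.
  rewrite ger0_norm ?subr_ge0//.
  have -> : rho * ((1 - b) / 4) = rho - q * rho by rewrite /q; field.
  lra.
have e0 : 0 < e by rewrite mulr_gt0// divr_gt0.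
have e1 : e <= rho / 2.
  by rewrite /e -subr_ge0; have -> : rho / 2 - rho * ((1 - b) / 2) = rho * b / 2 by [field|]; rewrite divr_ge0// mulr_ge0 ?ltW.
have e2 : e <= (1 - b) / 2.
  by rewrite /e ler_piMl ?divr_ge0 ?(ltW b1')//; lra.
have seg t : 0 <= t <= 1 -> e <= dbd (u + rc t * (z - u)).
  move=> t01; apply: le_trans (dbd_segment u z t01).
  rewrite le_min cu; apply/andP; split; first lra.
  have : Num.max rho (cmod z) <= b by rewrite ge_max rb zb.
  lra.
have zu1 : cmod (z - u) <= 1 * e by rewrite mul1r.
have [_ h2 h3] := hA u z e e0 seg zu1.
split; [exact: uK|exact: h2|].
apply: (le_trans h3); apply: ler_wpM2l.
  exact: mulr_ge0 A0 (cmod_ge0 _).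
by clear h2 h3; lra.
Qed.

Lemma outer_cover : exists A C n0, [/\ 1 <= A, 0 <= C & forall n z, (n0 <= n)%N ->
   pdisc z -> cmod z0 ^+ m < cmod z ^+ (m ^ n) -> cmod z ^+ (m ^ n) <= cmod z0 ->
   exists u, [/\ u ^+ (m ^ n) = z0, cmod (R' u) <= A * cmod (R' z) &
     cmod (Rm z - Rm u) <= A * cmod (R' u) * (C / (m ^ n)%:R)]].
Proof.
pose r := cmod z0; have /andP[r0 r1] := hz0; rewrite -/r in r0 r1 *.
pose a := r ^+ m; have a0 : 0 < a by rewrite exprn_gt0.
have m0 : (0 < m)%N by exact: ltn_trans m2.
have ar : a <= r by rewrite -[X in _ <= X]expr1; apply: ler_wiXn2l; rewrite ?m0 ?(ltW r0)// ltW.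
have a1 : 1 <= a^-1 by rewrite invf_ge1// (le_trans ar) ?ltW.
(* a^-1 - 1 accounts for the radial gap between [z] and the root, 4 for the angular one. *)
pose Cc := a^-1 - 1 + 4; have Cc0 : 0 < Cc by rewrite /Cc; lra.
pose c := (1 - r) * (r / 2).
have r1' : 0 < 1 - r by rewrite subr_gt0.
have c0 : 0 < c by rewrite mulr_gt0// divr_gt0.
have c1 : c <= 1 - r by rewrite /c ler_piMr ?(ltW r1')//; lra.
have c2 : c <= r / 2 by rewrite /c ler_piMl ?divr_ge0 ?(ltW r0)//; lra.
have CC0 : 0 <= Cc / c by rewrite divr_ge0 ?ltW.
have [A A1 hA] := comparable CC0; have A0 := le_trans ler01 A1.
(* From this level on, |z - u| <= r / 2 while |u| >= r, so the segment stays at distance r / 2 from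
   0; the unit circle is then the only boundary at scale 1 / N. *)
pose n0 := Num.bound (2 * Cc / r).
exists A, Cc, n0; split => //; first exact: ltW.
move=> n z nn pz za zr; set N := (m ^ n)%N in za zr *.
have N0 : (0 < N)%N by rewrite expn_gt0 m0.
have Np : 0 < N%:R :> R by rewrite ltr0n.
have N1 : 1 <= N%:R :> R by rewrite ler1n.
have Nbig : Cc / N%:R <= r / 2.
  have h : 2 * Cc / r <= N%:R.
    apply: (@le_trans _ _ n0%:R).
      by apply/ltW/archi_boundP; apply: divr_ge0 (ltW r0); apply: mulr_ge0 (ltW Cc0).
    by rewrite ler_nat (leq_trans nn)// ltnW// ltn_expl.
  move: h; rewrite ler_pdivrMr// => h; rewrite ler_pdivrMr//; lra.
have /andP[zp z1] := pz.
have zn0 : z != 0 by rewrite -cmod_gt0.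
have z00 : z0 != 0 by rewrite -cmod_gt0.
have [u [uN zu]] := near_root N0 zn0 z00.
have cuN : cmod u ^+ N = r by rewrite -cmodX uN.
have /andP[up u1] := root_pdisc hz0 N0 uN.
have ur : r <= cmod u.
  rewrite -cuN -[X in _ <= X]expr1; apply: ler_wiXn2l; rewrite ?(ltW up) ?(ltW u1)//.
have hz1 : 1 - cmod z <= (a^-1 - 1) / N%:R.
  by apply: one_sub_root_le => //; exact: ltW.
have hu1 : 1 - cmod u <= (a^-1 - 1) / N%:R.
  by apply: one_sub_root_le => //; [exact: ltW|rewrite cuN].
have hz2 : c / N%:R <= 1 - cmod z.
  rewrite ler_pdivrMr//; apply: (le_trans c1); rewrite mulrC.
  have := one_sub_pow_le N (ltW zp) (ltW z1); lra.
have hu2 : c / N%:R <= 1 - cmod u.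
  rewrite ler_pdivrMr//; apply: (le_trans c1); rewrite mulrC.
  have := one_sub_pow_le N (ltW up) (ltW u1); rewrite cuN; lra.
have zuC : cmod (z - u) <= Cc / N%:R.
  apply: (le_trans zu); have -> : Cc / N%:R = (a^-1 - 1) / N%:R + 4 / N%:R by rewrite -mulrDl.
  apply: lerD; first by rewrite ler_norml; lra.
  by rewrite ler_pM2r ?invr_gt0//; lra.
have seg t : 0 <= t <= 1 -> c / N%:R <= dbd (u + rc t * (z - u)).
  move=> t01; apply: le_trans (dbd_segment u z t01).
  have cN : c / N%:R <= c by rewrite ler_pdivrMr// ler_peMr// ltW.
  rewrite le_min; apply/andP; split; first lra.
  by rewrite lerBrDr -lerBrDl ge_max; apply/andP; split; lra.
have zu1 : cmod (z - u) <= Cc / c * (c / N%:R).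
  by have -> : Cc / c * (c / N%:R) = Cc / N%:R by field; rewrite !gt_eqF.
have [_ h2 h3] := hA u z (c / N%:R) (divr_gt0 c0 Np) seg zu1.
exists u; split; [exact: uN|exact: h2|].
apply: (le_trans h3); apply: ler_wpM2l; last exact: zuC.
exact: mulr_ge0 A0 (cmod_ge0 _).
Qed.

(** Take the least [n] for which the upper bound holds: it fails at n - 1, and raising that failure
    to the power [m] gives the lower bound. *)
Lemma level_exists n0 z : pdisc z -> cmod z0 < cmod z ^+ (m ^ n0) ->
  exists n, [/\ (n0 < n)%N, cmod z0 ^+ m < cmod z ^+ (m ^ n) & cmod z ^+ (m ^ n) <= cmod z0].
Proof.
move=> /andP[zp z1] hn0; have /andP[r0 r1] := hz0.
have [k hk] := exists_pow_le r0 (ltW zp) z1.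
have ex : exists n, cmod z ^+ (m ^ n) <= cmod z0.
  exists k; apply: le_trans hk; apply: ler_wiXn2l; rewrite ?(ltW zp) ?(ltW z1)//.
  by rewrite ltnW// ltn_expl.
have [n hn nmin] := ex_minnP ex; exists n.
have nn : (n0 < n)%N.
  rewrite ltnNge; apply/negP => h; move: hn0; rewrite ltNge => /negP; apply.
  apply: le_trans hn; apply: ler_wiXn2l; rewrite ?(ltW zp) ?(ltW z1)//.
  by rewrite leq_exp2l.
split => //; case: n nn hn nmin => // n nn hn nmin.
have : cmod z0 < cmod z ^+ (m ^ n) by rewrite ltNge; apply/negP => /nmin; rewrite ltnn.
move=> h; rewrite expnSr exprM ltrXn2r ?exprn_ge0 ?ltW// gtn_eqF//; exact: ltn_trans m2.
Qed.

Lemma inv_R'_le n u : u ^+ (m ^ n) = z0 ->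
  (cmod (R' u) ^+ 2)^-1 <= (cmod z0 ^+ 2 * cmod (R' z0) ^+ 2)^-1 *
     ((m%:R ^+ (2 * n))^-1 * cmod ((iter_poly f n)^`().[Rm u]) ^+ 2).
Proof.
move=> uN; have /andP[r0 r1] := hz0.
have m0 : (0 < m)%N by exact: ltn_trans m2.
have N0 : (0 < m ^ n)%N by rewrite expn_gt0 m0.
have cuN : cmod u ^+ (m ^ n) = cmod z0 by rewrite -cmodX uN.
have pu : pdisc u := root_pdisc hz0 N0 uN.
have /andP[up u1] := pu.
have pz0 : pdisc z0 by [].
have Ru : 0 < cmod (R' u) by rewrite cmod_gt0; exact: (R'_neq0 m2 Rder Rpole Rfunc).
have Rz : 0 < cmod (R' z0) by rewrite cmod_gt0; exact: (R'_neq0 m2 Rder Rpole Rfunc).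
have := congr1 (@cmod R) (deriv_conjugacy m2 Rder Rfunc n pu).
rewrite uN !cmodM cmod_nat cmodX natrX; set D := cmod _.[_] => E.
(* As |u| < 1, the exponent N - 1 may be raised to N, which replaces a quantity depending on [n] by
   |z0|. *)
have h : cmod z0 <= cmod u ^+ (m ^ n).-1.
  by rewrite -cuN; apply: ler_wiXn2l; rewrite ?(ltW up) ?(ltW u1)// leq_pred.
have mn : 0 < m%:R ^+ n :> R by rewrite exprn_gt0// ltr0n.
have E2 : cmod (R' z0) * (m%:R ^+ n * cmod z0) <= D * cmod (R' u).
  by rewrite E ler_pM2l// ler_pM2l.
have E3 : (cmod (R' z0) * (m%:R ^+ n * cmod z0)) ^+ 2 <= (D * cmod (R' u)) ^+ 2.
  apply: lerXn2r => //; rewrite nnegrE.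
    by apply: mulr_ge0; rewrite ?cmod_ge0//; apply: mulr_ge0; rewrite ?cmod_ge0// ltW.
  by apply: mulr_ge0; exact: cmod_ge0.
by rewrite mulnC exprM; exact: inv_sqr_le E3.
Qed.

End Covers.

(** * Summation *)

Section Summation.
Variable R : realType.

Lemma sum_seq_le (T : eqType) (s : seq T) (t : T -> R) (c : R) :
  (forall u, u \in s -> t u <= c) -> \sum_(u <- s) t u <= (size s)%:R * c.
Proof.
elim: s => [|u s IH] h; first by rewrite big_nil mul0r.
rewrite big_cons /= -natr1 mulrDl mul1r addrC; apply: lerD.
  by apply: IH => v vs; apply: h; rewrite inE vs orbT.
by apply: h; rewrite inE eqxx.
Qed.

Lemma nneseries_le_bound (u : nat -> R) (B : R) : (forall n, 0 <= u n) ->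
  (forall k, \sum_(0 <= n < k) u n <= B) -> (\sum_(0 <= n <oo) (u n)%:E <= B%:E)%E.
Proof.
move=> u0 uB; apply: lime_le; first by apply: is_cvg_nneseries => n _ _; rewrite lee_fin.
by apply: nearW => k; rewrite sumEFin lee_fin.
Qed.

(** With X = |R' u|, this is the bound of the integrand times the area of a square of half-side A X
    t: [X] cancels against the power 2, and the power 4 leaves X^-2. *)
Lemma cover_term (A X t : R) : X != 0 ->
  ((A / X) ^+ 2 + (A / X) ^+ 4) * (2 * (A * X * t)) ^+ 2 =
  4 * A ^+ 4 * t ^+ 2 * (1 + A ^+ 2 * (X ^+ 2)^-1).
Proof. by move=> X0; field. Qed.

Lemma partial_sums_bound (T a : nat -> R) (B D Q s : R) : 0 <= B -> 0 <= D ->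
  0 < Q -> Q < 1 -> (forall n, 0 <= a n) ->
  (\sum_(1 <= n <oo) (a n)%:E = s%:E)%E ->
  (forall n, 0 <= T n) ->
  (forall n, T n <= B * Q ^+ n + (if n == 0%N then 0 else D * a n)) ->
  (\sum_(0 <= n <oo) (T n)%:E <= (B / (1 - Q) + D * s)%:E)%E.
Proof.
move=> B0 D0 Q0 Q1 a0 sE T0 TB; apply: nneseries_le_bound => // k.
apply: le_trans (ler_sum _ (fun n _ => TB n)) _; rewrite big_split /=; apply: lerD.
  have := @geometric_le_lim R k B Q B0 Q0; rewrite ger0_norm ?(ltW Q0)// => /(_ Q1).
  by apply: le_trans; rewrite /series /= /geometric.
have sk n : \sum_(1 <= i < n) a i <= s.
  rewrite -lee_fin -sE -sumEFin; apply: nneseries_lim_ge => i _ _; by rewrite lee_fin.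
have s0 : 0 <= s by apply: le_trans (sk 1%N); rewrite big_geq.
case: k => [|k]; first by rewrite big_geq// mulr_ge0.
rewrite big_ltn//= add0r; apply: le_trans (ler_wpM2l D0 (sk k.+1)).
rewrite mulr_sumr le_eqVlt; apply/orP; left; apply/eqP/eq_big_nat => i /andP[i1 _].
by rewrite gtn_eqF.
Qed.

End Summation.

Lemma root_seqs (R : realType) : exists rs : CC R * nat -> seq (CC R),
  forall y, (0 < y.2)%N ->
    [/\ uniq (rs y), (size (rs y) <= y.2)%N & forall u, (u \in rs y) = (u ^+ y.2 == y.1)].
Proof.
exists (fun y => if pselect (0 < y.2)%N is left h then sval (cid (root_seq y.1 h)) else [::]).
by move=> y h; case: pselect => // h'; exact: svalP (cid (root_seq y.1 h')).
Qed.

(** The condition [disc z] in [S_n] holds for every root, since |z0| < 1, so the list of all roots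
    enumerates the index set. *)
Lemma S_n_seq (R : realType) (f : {poly CC R}) (Rm : CC R -> CC R) (z0 : CC R) n
    (s : seq (CC R)) : 0 < cmod z0 < 1 -> (0 < (size f).-1)%N -> uniq s ->
  (forall u, (u \in s) = (u ^+ ((size f).-1 ^ n) == z0)) ->
  S_n f Rm z0 n = \sum_(u <- s) cmod ((iter_poly f n)^`().[Rm u]) ^+ 2.
Proof.
move=> hz0 m0 us hs; rewrite fsbig_seq//; apply: eq_fsbigl.
apply/seteqP; split => u /=; first by move=> [uN _]; rewrite hs; apply/eqP.
rewrite hs => /eqP uN; split => //.
have N0 : (0 < (size f).-1 ^ n)%N by rewrite expn_gt0 m0.
by have /andP[_] := root_pdisc hz0 N0 uN.
Qed.

Theorem mainTheorem5 (R : realType) (f : {poly CC R})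
    (Rmap F : CC R -> CC R) (z0 : CC R) :
  let m := (size f).-1 in
  (2 <= m)%N ->
  (* R : D -> Omega biholomorphic, R(0) = infinity; on D \ {0} it is a
     holomorphic bijection onto Omega \cap C *)
  (forall z, pdisc z -> basin f (Rmap z)) ->
  (forall w, basin f w -> exists2 z, pdisc z & Rmap z = w) ->
  (forall z1 z2, pdisc z1 -> pdisc z2 -> Rmap z1 = Rmap z2 -> z1 = z2) ->
  (forall z, pdisc z -> derivable Rmap z 1) ->
  cmod (Rmap z) @[z --> (0 : CC R)^'] --> +oo ->
  (* normalisation R^{-1} o f o R (z) = z^m on D *)
  (forall z, pdisc z -> f.[Rmap z] = Rmap (z ^+ m)) ->
  (* F = R^{-1} : Omega \cap C -> D \ {0} *)
  (forall z, pdisc z -> F (Rmap z) = z) ->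
  (* |z0| = r0 in (0,1) *)
  0 < cmod z0 < 1 ->
  exists C1 C2 : R, forall p : R, 2 <= p <= 4 ->
    let series := (\sum_(1 <= n <oo)
                     (((m%:R ^+ (4 * n))^-1 * S_n f Rmap z0 n)%:E))%E in
    series = +oo%E \/
    (\int[@area R]_(xy in [set xy | basin f (cplx xy)])
        ((cmod (derive1 F (cplx xy))) `^ p)%:E
      < C1%:E * series + C2%:E)%E.
Proof.
move=> m m2 _ Rsurj Rinj Rder Rpole Rfunc FR hz0.
have /andP[r0 r1] := hz0.
have m0 : (0 < m)%N by exact: ltn_trans m2.
have [A2 [C [n0 [A21 C0 outer]]]] := outer_cover m2 Rinj Rder Rpole Rfunc hz0.
have mn0 n : (0 < m ^ n)%N by rewrite expn_gt0 m0.
(* The modulus [b] of this root is where the two covers meet: b^(m^n0) = |z0|, so a point with |z| >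
   b lies in a shell of some level n > n0. *)
have [u0 u0E] := exists_root z0 (mn0 n0).
pose b := cmod u0.
have bE : b ^+ (m ^ n0) = cmod z0 by rewrite -cmodX u0E.
have /andP[b0 b1] : 0 < b < 1 := root_pdisc hz0 (mn0 n0) u0E.
have [A1 [q [K [A11 q0 q1 K0 inner]]]] := inner_cover m2 Rinj Rder Rpole Rfunc b0 b1.
have [c c0 hc] := R'_lower_bound m2 Rder Rpole Rfunc b0 b1.
have [rs hrs] := root_seqs R.
pose R' : CC R -> CC R := derive1 Rmap.
have R'0 z : pdisc z -> 0 < cmod (R' z).
  by move=> pz; rewrite cmod_gt0; exact: (R'_neq0 m2 Rder Rpole Rfunc).
pose sin n := rs (rc (b * q ^+ n) ^+ K, K).
pose sout n := rs (z0, (m ^ n)%N).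
have hin n : [/\ uniq (sin n), (size (sin n) <= K)%N &
    forall u, (u \in sin n) = (u ^+ K == rc (b * q ^+ n) ^+ K)] by exact: hrs.
have hout n : [/\ uniq (sout n), (size (sout n) <= m ^ n)%N &
    forall u, (u \in sout n) = (u ^+ (m ^ n) == z0)] by exact: (hrs (z0, (m ^ n)%N) (mn0 n)).
(* The Boolean separates inner squares ([true]) from those of the shells ([false]), so one sequence
   of finite families covers the basin. *)
pose s n : seq (bool * CC R) := [seq (true, u) | u <- sin n] ++
  (if (n0 < n)%N then [seq (false, u) | u <- sout n] else [::]).
pose h n (i : bool * CC R) : R := if i.1 then A1 * cmod (R' i.2) * q ^+ n
  else A2 * cmod (R' i.2) * (C / (m ^ n)%:R).
pose y (i : bool * CC R) : R := (if i.1 then A1 else A2) / cmod (R' i.2).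
pose w (n : nat) i := y i ^+ 2 + y i ^+ 4.
have A10 := le_trans ler01 A11; have A20 := le_trans ler01 A21.
have y0 i : 0 <= y i by rewrite divr_ge0 ?cmod_ge0//; case: i.1.
have w0 n i : 0 <= w n i by rewrite addr_ge0// exprn_ge0.
have h0 n i : 0 <= h n i.
  rewrite /h; case: i.1; apply: mulr_ge0; try exact: mulr_ge0 (cmod_ge0 _).
    by rewrite exprn_ge0// ltW.
  by rewrite divr_ge0.
pose T n := \sum_(i <- s n) w n i * (2 * h n i) ^+ 2.
have T0 n : 0 <= T n by apply: sumr_ge0 => i _; rewrite mulr_ge0// sqr_ge0.
pose a n := (m%:R ^+ (4 * n))^-1 * S_n f Rmap z0 n.
pose G := (cmod z0 ^+ 2 * cmod (R' z0) ^+ 2)^-1.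
pose D1 := 4 * A1 ^+ 4 * (1 + A1 ^+ 2 * (c ^+ 2)^-1).
pose D2 := 4 * A2 ^+ 4 * C ^+ 2.
pose D3 := D2 * (A2 ^+ 2 * G).
have G0 : 0 <= G by rewrite invr_ge0 mulr_ge0// sqr_ge0.
have D10 : 0 <= D1.
  by rewrite !mulr_ge0 ?exprn_ge0// addr_ge0// mulr_ge0 ?exprn_ge0// invr_ge0 sqr_ge0.
have D20 : 0 <= D2 by rewrite !mulr_ge0 ?exprn_ge0.
have D30 : 0 <= D3 by rewrite !mulr_ge0 ?exprn_ge0.
have mp n : 0 < m%:R ^+ n :> R by rewrite exprn_gt0// ltr0n.
have S_nE n : S_n f Rmap z0 n = \sum_(u <- sout n) cmod ((iter_poly f n)^`().[Rmap u]) ^+ 2.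
  by have [us _ hs] := hout n; apply: S_n_seq.
have a0 n : 0 <= a n.
  rewrite /a S_nE; apply: mulr_ge0; first by rewrite invr_ge0 ltW.
  by apply: sumr_ge0 => u _; rewrite sqr_ge0.
(* One ratio for both families: q for the inner circles, and 1 / 2 for the factor 1 / N = m^-n <=
   2^-n of the shells. *)
pose Q := Num.max q (1 / 2).
have Q0 : 0 < Q by rewrite lt_max q0.
have Q1 : Q < 1 by rewrite gt_max q1 /=; lra.
have qQ n : q ^+ n <= Q ^+ n.
  by apply: lerXn2r; rewrite ?nnegrE ?(ltW q0) ?(ltW Q0)// le_max lexx.
have sinR n u : u ^+ K = rc (b * q ^+ n) ^+ K -> c <= cmod (R' u).
  have bq : 0 < b * q ^+ n by rewrite mulr_gt0// exprn_gt0.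
  move=> /(cmod_root_rc bq K0) cu; apply: hc; first by rewrite -cmod_gt0 cu.
  by rewrite cu; apply: ler_piMr; [exact: ltW|apply: exprn_ile1; exact: ltW].
have sin_le n : \sum_(u <- sin n) w n (true, u) * (2 * h n (true, u)) ^+ 2 <= K%:R * D1 * Q ^+ n.
  have [_ sK hs] := hin n.
  have qn : 0 <= q ^+ n by rewrite exprn_ge0// ltW.
  have term u : u \in sin n -> w n (true, u) * (2 * h n (true, u)) ^+ 2 <= D1 * q ^+ n.
    rewrite hs => /eqP uK.
    have cR := sinR n u uK; have Rp : 0 < cmod (R' u) by exact: lt_le_trans cR.
    rewrite /w /h /y /= cover_term ?gt_eqF//.
    have -> : 4 * A1 ^+ 4 * (q ^+ n) ^+ 2 * (1 + A1 ^+ 2 * (cmod (R' u) ^+ 2)^-1) =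
      (4 * A1 ^+ 4 * (1 + A1 ^+ 2 * (cmod (R' u) ^+ 2)^-1)) * (q ^+ n * q ^+ n) by ring.
    apply: ler_pM.
    - apply: mulr_ge0; first by rewrite mulr_ge0 ?exprn_ge0.
      by rewrite addr_ge0// mulr_ge0 ?sqr_ge0// invr_ge0 sqr_ge0.
    - exact: mulr_ge0.
    - rewrite /D1; apply: ler_wpM2l; first by rewrite mulr_ge0 ?exprn_ge0.
      rewrite lerD2l; apply: ler_wpM2l; first exact: sqr_ge0.
      rewrite lef_pV2 ?posrE ?exprn_gt0//; apply: lerXn2r; rewrite ?nnegrE//; exact: ltW.
    - by rewrite ler_piMr// exprn_ile1// ltW.
  apply: (le_trans (sum_seq_le term)); rewrite mulrA.
  apply: (ler_pM (mulr_ge0 (ler0n _ _) D10) qn _ (qQ n)).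
  by apply: (ler_wpM2r D10); rewrite ler_nat.
have sout_le n : \sum_(u <- sout n) w n (false, u) * (2 * h n (false, u)) ^+ 2 <=
    D2 * Q ^+ n + D3 * a n.
  have [_ sN hs] := hout n.
  have Np : 0 < (m ^ n)%:R :> R by rewrite ltr0n mn0.
  pose X u := cmod ((iter_poly f n)^`().[Rmap u]) ^+ 2.
  have term u : u \in sout n -> w n (false, u) * (2 * h n (false, u)) ^+ 2 <=
      D2 / (m ^ n)%:R ^+ 2 + D3 * (m%:R ^+ (4 * n))^-1 * X u.
    rewrite hs => /eqP uN.
    have pu : pdisc u := root_pdisc hz0 (mn0 n) uN.
    have := inv_R'_le m2 Rder Rpole Rfunc hz0 uN; rewrite -/(X u) -/G => hR.
    rewrite /w /h /y /= cover_term ?gt_eqF ?R'0//.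
    have -> : 4 * A2 ^+ 4 * (C / (m ^ n)%:R) ^+ 2 * (1 + A2 ^+ 2 * (cmod (R' u) ^+ 2)^-1)
       = D2 / (m ^ n)%:R ^+ 2 + D2 / (m ^ n)%:R ^+ 2 * A2 ^+ 2 * (cmod (R' u) ^+ 2)^-1.
      by rewrite /D2 expr_div_n; ring.
    rewrite lerD2l; apply: (le_trans (ler_wpM2l _ hR)).
      by apply: mulr_ge0 (sqr_ge0 _); apply: divr_ge0 => //; exact: sqr_ge0.
    rewrite le_eqVlt; apply/orP; left; apply/eqP.
    rewrite /D3 natrX -exprM (_ : (4 * n)%N = (n * 2 + 2 * n)%N); last by rewrite [(n * 2)%N]mulnC -mulnDl.
    by rewrite exprD invfM; ring.
  rewrite big_seq; apply: (le_trans (ler_sum _ term)); rewrite -big_seq big_split /=.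
  apply: lerD; last by rewrite -mulr_sumr -S_nE /a mulrA.
  apply: (le_trans (sum_seq_le (fun u _ => lexx _))).
  apply: (@le_trans _ _ ((m ^ n)%:R * (D2 / (m ^ n)%:R ^+ 2))).
    apply: ler_wpM2r; last by rewrite ler_nat.
    by apply: divr_ge0 => //; exact: sqr_ge0.
  (* At most [N] roots, each costing O(N^-2) through the power 2, leave 1 / N, which is summable
     over the levels. *)
  have -> : (m ^ n)%:R * (D2 / (m ^ n)%:R ^+ 2) = D2 * ((m ^ n)%:R)^-1 by field; rewrite gt_eqF.
  apply: ler_wpM2l => //; rewrite natrX -exprVn; apply: lerXn2r; rewrite ?nnegrE ?invr_ge0 ?(ltW Q0)//.
  apply: (@le_trans _ _ (1 / 2)); last by rewrite le_max lexx orbT.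
  by rewrite mul1r lef_pV2 ?posrE ?ltr0n// ler_nat.
pose B := K%:R * D1 + D2.
have B0 : 0 <= B by rewrite addr_ge0// mulr_ge0.
have TB n : T n <= B * Q ^+ n + (if n == 0%N then 0 else D3 * a n).
  rewrite /T /s big_cat big_map /= mulrDl -addrA; apply: lerD; first exact: sin_le.
  have Qn : 0 <= D2 * Q ^+ n by rewrite mulr_ge0// exprn_ge0// ltW.
  case: ifPn => nn; last first.
    rewrite big_nil; apply: addr_ge0 => //; case: ifP => // _; exact: mulr_ge0.
  by rewrite big_map gtn_eqF ?(leq_ltn_trans _ nn)//; exact: sout_le.
(* Both constants are fixed before [p]; the added 1 makes the final inequality strict. *)
exists D3, (B / (1 - Q) + 1) => p p24 series.
have [->|sfin] := eqVneq series +oo%E; [by left|right].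
have s0 : (0 <= series)%E by apply: nneseries_ge0 => n _ _; rewrite lee_fin; exact: a0.
have [t tE] : exists t : R, series = t%:E.
  by move: s0 sfin; case: series => // t _ _; exists t.
have sumT := partial_sums_bound B0 D30 Q0 Q1 a0 tE T0 TB.
rewrite tE -EFinM -EFinD; apply: (@le_lt_trans _ _ (B / (1 - Q) + D3 * t)%:E); last first.
  by rewrite lte_fin; lra.
apply: le_trans sumT.
apply: (@area_integral_le_cover R _ _ (bool * CC R)%type s (fun i => Rmap i.2) h w _ h0 w0).
  by move=> x _; rewrite lee_fin powR_ge0.
move=> x /Rsurj[z pz zx].
have near_square u d : cmod (Rmap z - Rmap u) <= d -> csquare (Rmap u) d x.
  move=> hd; have := le_trans (cre_le _) hd; have := le_trans (cim_le _) hd.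
  rewrite zx creD creN cimD cimN cre_cplx cim_cplx !ler_norml => /andP[? ?] /andP[? ?].
  by split; rewrite /= in_itv /=; apply/andP; split; lra.
have wle n i (A := if i.1 then A1 else A2) : 0 < cmod (R' i.2) ->
    cmod (R' i.2) <= A * cmod (R' z) ->
    ((cmod (derive1 F (cplx x)) `^ p)%:E <= (w n i)%:E)%E.
  move=> Ri hA; rewrite lee_fin -zx (derive1_F m2 Rder Rpole Rfunc FR pz).
  have Rz := R'0 z pz.
  have yz : cmod (R' z)^-1 <= y i.
    rewrite cmodV /y (ler_pdivlMr _ _ Ri) mulrC (ler_pdivrMr _ _ Rz); exact: hA.
  apply: (le_trans (powR_le_sum (cmod_ge0 _) p24)); rewrite /w.
  by apply: lerD; apply: lerXn2r; rewrite ?nnegrE ?cmod_ge0.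
have /andP[zp z1] := pz.
have [zb|zb] := leP (cmod z) b.
  have zn0 : z != 0 by rewrite -cmod_gt0.
  have [j [u [uK hR hd]]] := inner z zn0 zb.
  have Ru : 0 < cmod (R' u) by exact: lt_le_trans c0 (sinR j u uK).
  exists j, (true, u); split.
  - rewrite /s mem_cat; apply/orP; left; apply/mapP; exists u => //.
    by have [_ _ ->] := hin j; apply/eqP.
  - exact: near_square.
  - exact: wle.
have zn : cmod z0 < cmod z ^+ (m ^ n0).
  by rewrite -bE ltrXn2r ?(ltW b0) ?(ltW zp) ?gtn_eqF ?mn0.
have [n [nn za zr]] := level_exists m2 hz0 pz zn.
have [u [uN hR hd]] := outer n z (ltnW nn) pz za zr.
exists n, (false, u); split.
- rewrite /s mem_cat nn; apply/orP; right; apply/mapP; exists u => //.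
  by have [_ _ ->] := hout n; apply/eqP.
- exact: near_square.
- by apply: wle => //; apply: R'0; exact: root_pdisc hz0 (mn0 n) uN.
Qed.
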